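(* Let $R>0$ and let $\mathbf{f}\in L_2(B_R;\mathcal{A};\mathbb{R})$ be monogenic in $B_R$, with decomposition $\mathbf{f}=\mathbf{f}(0)+\mathbf{g}+\mathbf{h}$ as described in the context. Then for $0\le r<R$, $$\mathcal{M}(\mathbf{f},r)\le|\mathbf{f}(0)|+\frac{2r}{(R-r)^2}\Big(A_1(r,R)\sup_{|\xi|<R}|\mathbf{Sc}\{\mathbf{f}(\xi)\}|+A_2(r,R)\sup_{|\xi|<R}|\mathbf{Sc}\{\mathbf{h}(\xi)\mathbf{e}_1\}|\Big),$$ where $A_1(r,R)=\sqrt{\tfrac23}\,\frac{(3R-r)(3R^2-Rr+r^2)}{(R-r)^2}$ and $A_2(r,R)=2(2R-r)$.
   Context: Quaternions $\mathbb{H}$ have basis $1,\mathbf{e}_1,\mathbf{e}_2,\mathbf{e}_3$ with $\mathbf{e}_i^2=-1$, $\mathbf{e}_1\mathbf{e}_2=\mathbf{e}_3=-\mathbf{e}_2\mathbf{e}_1$, $\mathbf{e}_2\mathbf{e}_3=\mathbf{e}_1=-\mathbf{e}_3\mathbf{e}_2$, $\mathbf{e}_3\mathbf{e}_1=\mathbf{e}_2=-\mathbf{e}_1\mathbf{e}_3$. $\mathbf{Sc}(a_0+a_1\mathbf{e}_1+a_2\mathbf{e}_2+a_3\mathbf{e}_3)=a_0$, conjugation flips the signs of $a_1,a_2,a_3$, $|\cdot|$ is the Euclidean norm. Reduced quaternions: $\mathcal{A}=\mathrm{span}_\mathbb{R}\{1,\mathbf{e}_1,\mathbf{e}_2\}$,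 with $x=(x_0,x_1,x_2)\in\mathbb{R}^3$ identified with $x_0+x_1\mathbf{e}_1+x_2\mathbf{e}_2$. $D=\partial_{x_0}+\mathbf{e}_1\partial_{x_1}+\mathbf{e}_2\partial_{x_2}$, $\overline{D}=\partial_{x_0}-\mathbf{e}_1\partial_{x_1}-\mathbf{e}_2\partial_{x_2}$; an $\mathcal{A}$-valued $C^1$ function $\mathbf{f}$ is monogenic if $D\mathbf{f}=0$. $B_R$ is the open ball of radius $R$ centered at $0$; $L_2(B_R;\mathcal{A};\mathbb{R})$ carries the real inner product $\langle\mathbf{f},\mathbf{g}\rangle=\int_{B_R}\mathbf{Sc}(\overline{\mathbf{f}}\mathbf{g})\,dV$. $\mathcal{M}(\mathbf{f},r)=\max_{|x|=r}|\mathbf{f}(x)|$. Spherical coordinates $x_0=r\cos\theta_1$, $x_1=r\sin\theta_1\cos\theta_2$, $x_2=r\sin\theta_1\sin\theta_2$; $P^m_n(t)=(1-t^2)^{m/2}\frac{d^m}{dt^m}P_n(t)$ (associated Legendre), $T_k,U_k$ Chebyshev polynomials of first and second kind; $U^l_{n}=P^l_{n}(\cos\theta_1)T_l(\cos\theta_2)$, $V^m_{n}=P^m_{n}(\cos\theta_1)\sin\theta_2\,U_{m-1}(\cos\theta_2)$. Basis polynomials: $\mathbf{X}^{l,\dagger}_n:=\tfrac12\overline{D}(r^{n+1}U^l_{n+1})$, $l=0,\ldots,n+1$, $\mathbf{Y}^{m,\dagger}_n:=\tfrac12\overline{D}(r^{n+1}V^m_{n+1})$, $m=1,\ldots,n+1$;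 $\mathbf{X}^{l,\dagger,*_R}_n,\mathbf{Y}^{m,\dagger,*_R}_n$ denote them normalized to unit norm in $L_2(B_R;\mathcal{A};\mathbb{R})$. These normalized polynomials ($n\ge0$) form an orthonormal basis of the space of square-integrable monogenic $\mathcal{A}$-valued functions on $B_R$, so each such $\mathbf{f}$ has a Fourier expansion $\mathbf{f}=\sum_{n\ge0}\big[\mathbf{X}^{0,\dagger,*_R}_na^{0,*_R}_n+\sum_{m=1}^{n+1}(\mathbf{X}^{m,\dagger,*_R}_na^{m,*_R}_n+\mathbf{Y}^{m,\dagger,*_R}_nb^{m,*_R}_n)\big]$ with real coefficients. The decomposition is $\mathbf{f}=\mathbf{f}(0)+\mathbf{g}+\mathbf{h}$, where $\mathbf{h}=\sum_{n\ge1}\big[\mathbf{X}^{n+1,\dagger,*_R}_na^{n+1,*_R}_n+\mathbf{Y}^{n+1,\dagger,*_R}_nb^{n+1,*_R}_n\big]$ (the part along the hyperholomorphic constants, which depend only on $x_1,x_2$) and $\mathbf{g}=\sum_{n\ge1}\big[\mathbf{X}^{0,\dagger,*_R}_na^{0,*_R}_n+\sum_{m=1}^{n}(\mathbf{X}^{m,\dagger,*_R}_na^{m,*_R}_n+\mathbf{Y}^{m,\dagger,*_R}_nb^{m,*_R}_n)\big]$. *)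

(* Defs.v *)
From Stdlib Require Import Reals Lra List ClassicalEpsilon Factorial.
Import ListNotations.
Open Scope R_scope.

Record quat := mkQ { q0 : R; q1 : R; q2 : R; q3 : R }.

Definition qzero : quat := mkQ 0 0 0 0.
Definition e1 : quat := mkQ 0 1 0 0.
Definition e2 : quat := mkQ 0 0 1 0.
Definition e3 : quat := mkQ 0 0 0 1.

Definition qadd (a b : quat) : quat :=
  mkQ (q0 a + q0 b) (q1 a + q1 b) (q2 a + q2 b) (q3 a + q3 b).
Definition qsub (a b : quat) : quat :=
  mkQ (q0 a - q0 b) (q1 a - q1 b) (q2 a - q2 b) (q3 a - q3 b).
Definition qscal (a : quat) (c : R) : quat :=
  mkQ (q0 a * c) (q1 a * c) (q2 a * c) (q3 a * c).
(* Hamilton product with e1 e2 = e3, e2 e3 = e1, e3 e1 = e2, e_i^2 = -1 *)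
Definition qmul (a b : quat) : quat :=
  mkQ (q0 a * q0 b - q1 a * q1 b - q2 a * q2 b - q3 a * q3 b)
      (q0 a * q1 b + q1 a * q0 b + q2 a * q3 b - q3 a * q2 b)
      (q0 a * q2 b - q1 a * q3 b + q2 a * q0 b + q3 a * q1 b)
      (q0 a * q3 b + q1 a * q2 b - q2 a * q1 b + q3 a * q0 b).
Definition qconj (a : quat) : quat := mkQ (q0 a) (- q1 a) (- q2 a) (- q3 a).
Definition qSc (a : quat) : R := q0 a.
Definition qnorm (a : quat) : R :=
  sqrt (q0 a ^ 2 + q1 a ^ 2 + q2 a ^ 2 + q3 a ^ 2).

(* ---------- Points of R^3, x = (x0, x1, x2) ~ x0 + x1 e1 + x2 e2 ---------- *)
Definition pt : Type := (R * R * R)%type.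
Definition norm3 (x : pt) : R :=
  let '(a, b, c) := x in sqrt (a ^ 2 + b ^ 2 + c ^ 2).
Definition psub (x y : pt) : pt :=
  let '(a, b, c) := x in let '(a', b', c') := y in (a - a', b - b', c - c').
Definition in_ball (Rr : R) (x : pt) : Prop := norm3 x < Rr.

Definition pd (i : nat) (F : pt -> R) (x : pt) (l : R) : Prop :=
  let '(a, b, c) := x in
  match i with
  | 0%nat => derivable_pt_lim (fun t => F (t, b, c)) a l
  | 1%nat => derivable_pt_lim (fun t => F (a, t, c)) b l
  | _ => derivable_pt_lim (fun t => F (a, b, t)) c l
  end.

(* the value of the partial derivative d/dx_i F at x (F differentiable there) *)
Definition pderiv (i : nat) (F : pt -> R) (x : pt) : R :=
  epsilon (inhabits 0) (fun l => pd i F x l).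

Definition qpd (i : nat) (f : pt -> quat) (x : pt) (d : quat) : Prop :=
  pd i (fun y => q0 (f y)) x (q0 d) /\ pd i (fun y => q1 (f y)) x (q1 d) /\
  pd i (fun y => q2 (f y)) x (q2 d) /\ pd i (fun y => q3 (f y)) x (q3 d).

Definition qcont_at (g : pt -> quat) (x : pt) : Prop :=
  forall eps, 0 < eps -> exists delta, 0 < delta /\
    forall y, norm3 (psub y x) < delta -> qnorm (qsub (g y) (g x)) < eps.

(* f is an A-valued C^1 function on B_R with D f = 0 there,
   D = d/dx0 + e1 d/dx1 + e2 d/dx2 (acting from the left). *)
Definition monogenic (f : pt -> quat) (Rr : R) : Prop :=
  (forall x, in_ball Rr x -> q3 (f x) = 0) /\
  exists d0 d1 d2 : pt -> quat,
    forall x, in_ball Rr x ->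
      qpd 0 f x (d0 x) /\ qpd 1 f x (d1 x) /\ qpd 2 f x (d2 x) /\
      qcont_at d0 x /\ qcont_at d1 x /\ qcont_at d2 x /\
      qadd (d0 x) (qadd (qmul e1 (d1 x)) (qmul e2 (d2 x))) = qzero.

(* value of the Riemann integral (meaningful when f is Riemann integrable) *)
Definition RInt (f : R -> R) (a b : R) : R :=
  epsilon (inhabits 0)
    (fun v => exists pr : Riemann_integrable f a b, RiemannInt pr = v).

Definition sph (r t1 t2 : R) : pt :=
  (r * cos t1, r * sin t1 * cos t2, r * sin t1 * sin t2).

Definition ball_int (F : pt -> R) (rho : R) : R :=
  RInt (fun r => RInt (fun t1 => RInt (fun t2 =>
      F (sph r t1 t2) * (r ^ 2 * sin t1)) 0 (2 * PI)) 0 PI) 0 rho.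

Definition L2_ball (f : pt -> quat) (Rr : R) : Prop :=
  exists M, forall rho, 0 < rho < Rr ->
    ball_int (fun x => qnorm (f x) ^ 2) rho <= M.

Definition inner (Rr : R) (u v : pt -> quat) : R :=
  epsilon (inhabits 0) (fun l =>
    forall eps, 0 < eps -> exists delta, 0 < delta /\
      forall rho, Rr - delta < rho < Rr ->
        Rabs (ball_int (fun x => qSc (qmul (qconj (u x)) (v x))) rho - l) < eps).

(* ---------- Real polynomials (coefficient lists, lowest degree first) ---- *)
Fixpoint peval (p : list R) (t : R) : R :=
  match p with [] => 0 | a :: p' => a + t * peval p' t end.
Fixpoint padd (p q : list R) : list R :=
  match p, q with
  | [], _ => q
  | _, [] => p
  | a :: p', b :: q' => (a + b) :: padd p' q'
  end.
Definition pscale (c : R) (p : list R) : list R := map (fun a => c * a) p.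
Fixpoint pmul (p q : list R) : list R :=
  match p with [] => [] | a :: p' => padd (pscale a q) (0 :: pmul p' q) end.
Fixpoint ppow (p : list R) (n : nat) : list R :=
  match n with 0%nat => [1] | S k => pmul p (ppow p k) end.
Fixpoint pderiv_aux (k : nat) (p : list R) : list R :=
  match p with [] => [] | a :: p' => (INR k * a) :: pderiv_aux (S k) p' end.
Definition pder (p : list R) : list R :=
  match p with [] => [] | _ :: p' => pderiv_aux 1 p' end.

(* Legendre polynomial via Rodrigues: P_n = 1/(2^n n!) d^n/dt^n (t^2-1)^n *)
Definition Legendre (n : nat) : list R :=
  pscale (/ (2 ^ n * INR (fact n))) (Nat.iter n pder (ppow [-1; 0; 1] n)).

Definition assocP (m n : nat) (t : R) : R :=
  sqrt (1 - t ^ 2) ^ m * peval (Nat.iter m pder (Legendre n)) t.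

Fixpoint chebT2 (n : nat) (t : R) : R * R :=
  match n with
  | 0%nat => (1, t)
  | S k => let '(a, b) := chebT2 k t in (b, 2 * t * b - a)
  end.
Definition chebT (n : nat) (t : R) : R := fst (chebT2 n t).
Fixpoint chebU2 (n : nat) (t : R) : R * R :=
  match n with
  | 0%nat => (1, 2 * t)
  | S k => let '(a, b) := chebU2 k t in (b, 2 * t * b - a)
  end.
Definition chebU (n : nat) (t : R) : R := fst (chebU2 n t).

(* cos theta1 = x0 / r, cos theta2 = x1 / rho, sin theta2 = x2 / rho,
   with r = |x|, rho = sqrt(x1^2 + x2^2). *)
Definition rU (l n : nat) (x : pt) : R :=
  let '(a, b, c) := x in
  let r := norm3 x in let rho := sqrt (b ^ 2 + c ^ 2) in
  r ^ n * (assocP l n (a / r) * chebT l (b / rho)).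
Definition rV (m n : nat) (x : pt) : R :=
  let '(a, b, c) := x in
  let r := norm3 x in let rho := sqrt (b ^ 2 + c ^ 2) in
  r ^ n * (assocP m n (a / r) * ((c / rho) * chebU (m - 1) (b / rho))).

(* (1/2) Dbar Phi for real-valued Phi, Dbar = d0 - e1 d1 - e2 d2 *)
Definition halfDbar (Phi : pt -> R) (x : pt) : quat :=
  mkQ (/ 2 * pderiv 0 Phi x) (- (/ 2) * pderiv 1 Phi x)
      (- (/ 2) * pderiv 2 Phi x) 0.

Definition Xd (l n : nat) : pt -> quat := halfDbar (rU l (S n)).
Definition Yd (m n : nat) : pt -> quat := halfDbar (rV m (S n)).

Definition normalize (Rr : R) (u : pt -> quat) : pt -> quat :=
  fun x => qscal (u x) (/ sqrt (inner Rr u u)).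
Definition Xs (Rr : R) (l n : nat) : pt -> quat := normalize Rr (Xd l n).
Definition Ys (Rr : R) (m n : nat) : pt -> quat := normalize Rr (Yd m n).

(* n-th term (n >= 1) of h: X^{n+1,*}_n a^{n+1,*}_n + Y^{n+1,*}_n b^{n+1,*}_n,
   with Fourier coefficients a = <X*, f>, b = <Y*, f>. *)
Definition hterm (f : pt -> quat) (Rr : R) (n : nat) (x : pt) : quat :=
  qadd (qscal (Xs Rr (S n) n x) (inner Rr (Xs Rr (S n) n) f))
       (qscal (Ys Rr (S n) n x) (inner Rr (Ys Rr (S n) n) f)).

Fixpoint hpartial (f : pt -> quat) (Rr : R) (N : nat) (x : pt) : quat :=
  match N with
  | 0%nat => qzero
  | S k => qadd (hpartial f Rr k x) (hterm f Rr (S k) x)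
  end.

Definition hpart (f : pt -> quat) (Rr : R) (x : pt) : quat :=
  epsilon (inhabits qzero) (fun q =>
    forall eps, 0 < eps -> exists N0, forall N, (N0 <= N)%nat ->
      qnorm (qsub (hpartial f Rr N x) q) < eps).

Definition coefA1 (r Rr : R) : R :=
  sqrt (2 / 3) * ((3 * Rr - r) * (3 * Rr ^ 2 - Rr * r + r ^ 2)) / (Rr - r) ^ 2.
Definition coefA2 (r Rr : R) : R := 2 * (2 * Rr - r).

(* Main.v *)
(* D f = 0 says that v = (f_0, - f_1, - f_2) has neither curl nor divergence. For two such fields
   v, u the vectors v_k u + u_k v - <u, v> e_k are divergence-free. Taking for u the Newton field of
   a point x and the field of its image in a sphere, and letting that sphere shrink, gives Poisson's
   formula for each component of v; since only Stokes' theorem on spheres is needed, f of class C^1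
   is enough. Expanding the Poisson kernel in Legendre polynomials splits v into homogeneous
   components, and the component of degree n of f_0 is at most (2n+1) (r/s)^n sup |f_0|.

   Let e(t) be a unit vector e rotated by t about the x_0-axis and M_k(t) the degree n component of
   v_k at e(t). The Riesz system and Euler's identity give
     (d/dt - i n)(M_1 - i M_2) = - (L_20 + i L_10) M_0,    L_ij = x_i d_j - x_j d_i,
   so exp(- i n t)(M_1 - i M_2) differs from its mean over t by a multiple of sup |grad M_0|, which
   Sonin's bound (1 - c^2) P_n'(c)^2 <= (n + 1/2)^2 controls by (2n+1)^2 sup |f_0|. That mean is the
   degree n term c_n z^n (z = x_1 + i x_2) of h, and |Re c_n|, |Im c_n| are at most
   2 R^(-n) sup |Sc (h e_1)|, since Sc (h e_1) is the real part of a power series in z. The sum over n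
   is an explicit rational function of r/s, and s tends to R. *)

From Stdlib Require Import Reals Lra Lia ClassicalEpsilon FunctionalExtensionality List.
Require Import Defs.
From Coquelicot Require Import Coquelicot.
Import ListNotations.
Open Scope R_scope.

(** * Continuity and differentiation of sphere integrals *)

(** The fields are only C^1, so no second derivative is ever taken and no Laplace equation is
    available: that the degree n components are homogeneous in the radius is read off from the
    uniqueness of power series coefficients along a line through 0. The vector estimate is made
    scalar. For a sign [sg] and a unit vector ([al], [be]), the increments D_k of v_k enter as sg
    D_0 + al D_1 - be D_2, and the direction is chosen only at the very end. In degree n this costs
    (2n+1) S1 for v_0, (2n+1)^2 S1 for the oscillation of the phase and 4 S2 for its mean, in all
    (2n+1)(2n+2) S1 + 4 S2 times q^n. Summed over n >= 1 this is 2q(6 - 3q + q^2)/(1-q)^3 S1 +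
    4q/(1-q) S2, which lies below the claimed bound; sqrt(2/3) enters only in that last comparison,
    through sqrt(2/3) >= 4/5. Integrals, inner products and h are chosen by [epsilon], so nothing is
    known about them before a limit is shown to exist. Hence the terms of h are first computed
    explicitly as c_n z^n, with the same c_n as in the mean of the phase. *)

Ltac toR := match goal with |- @eq _ ?a ?b => change (@eq R a b) end.

Lemma continuous_pair {U V W : UniformSpace} (f : U -> V) (g : U -> W) p :
  continuous f p -> continuous g p -> continuous (fun q => (f q, g q)) p.
Proof.
  intros Hf Hg P [e He].
  generalize (Hf _ (locally_ball (f p) e)) (Hg _ (locally_ball (g p) e)).
  unfold filtermap. intros H1 H2.
  generalize (filter_and _ _ H1 H2). apply filter_imp.
  intros q [A B]. apply He. split; assumption.
Qed.

Section RealContinuity.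
Context {U : UniformSpace}.
Implicit Types f g : U -> R.

Lemma cR_plus f g p : continuous f p -> continuous g p -> continuous (fun q => f q + g q) p.
Proof. intros; apply (continuous_plus f g); assumption. Qed.
Lemma cR_minus f g p : continuous f p -> continuous g p -> continuous (fun q => f q - g q) p.
Proof. intros; apply (continuous_minus f g); assumption. Qed.
Lemma cR_opp f p : continuous f p -> continuous (fun q => - f q) p.
Proof. intros; apply (continuous_opp f); assumption. Qed.
Lemma cR_mult f g p : continuous f p -> continuous g p -> continuous (fun q => f q * g q) p.
Proof. intros; apply (continuous_mult f g); assumption. Qed.
Lemma cR_comp (h : R -> R) f p :
  continuous f p -> continuous h (f p) -> continuous (fun q => h (f q)) p.
Proof. intros; apply (continuous_comp f h); assumption. Qed.
Lemma cR_sin f p : continuous f p -> continuous (fun q => sin (f q)) p.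
Proof. intros; apply cR_comp; [assumption | apply continuous_sin]. Qed.
Lemma cR_cos f p : continuous f p -> continuous (fun q => cos (f q)) p.
Proof. intros; apply cR_comp; [assumption | apply continuous_cos]. Qed.
Lemma cR_sqrt f p : continuous f p -> continuous (fun q => sqrt (f q)) p.
Proof. intros; apply cR_comp; [assumption | apply continuous_sqrt]. Qed.
Lemma cR_inv f p : continuous f p -> f p <> 0 -> continuous (fun q => / f q) p.
Proof. intros; apply cR_comp; [assumption | apply continuous_Rinv; assumption]. Qed.
Lemma cR_div f g p : continuous f p -> continuous g p -> g p <> 0 ->
  continuous (fun q => f q / g q) p.
Proof. intros; apply cR_mult; [|apply cR_inv]; assumption. Qed.
Lemma cR_abs f p : continuous f p -> continuous (fun q => Rabs (f q)) p.
Proof. intros; apply cR_comp; [assumption | apply continuous_Rabs]. Qed.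
Lemma cR_pow f n p : continuous f p -> continuous (fun q => f q ^ n) p.
Proof.
  intros H; induction n as [|n IH]; simpl.
  - apply continuous_const.
  - apply cR_mult; assumption.
Qed.
Lemma c_fst {V W : UniformSpace} (f : U -> V * W) p :
  continuous f p -> continuous (fun q => fst (f q)) p.
Proof. intros; apply (continuous_comp f fst); [assumption|apply continuous_fst]. Qed.
Lemma c_snd {V W : UniformSpace} (f : U -> V * W) p :
  continuous f p -> continuous (fun q => snd (f q)) p.
Proof. intros; apply (continuous_comp f snd); [assumption|apply continuous_snd]. Qed.
End RealContinuity.

(** Integrands on the sphere are taken continuous in both angles on the whole plane, so that no
    domain conditions on the angles have to be carried along. *)
Definition cont2 (g : R -> R -> R) : Prop :=
  forall t1 t2, continuous (fun q : R * R => g (fst q) (snd q)) (t1, t2).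

Lemma cont2_comp {U : UniformSpace} (g : R -> R -> R) (a b : U -> R) p :
  cont2 g -> continuous a p -> continuous b p -> continuous (fun q => g (a q) (b q)) p.
Proof.
  intros Hg Ha Hb.
  apply (continuous_comp (fun q => (a q, b q)) (fun q : R * R => g (fst q) (snd q))).
  - apply continuous_pair; assumption.
  - apply Hg.
Qed.

Lemma continuous_slice {U V W : UniformSpace} (f : U * V -> W) p y :
  continuous f (p, y) -> continuous (fun z => f (p, z)) y.
Proof.
  intros H. apply (continuous_comp (fun z => (p, z)) f); [|exact H].
  apply continuous_pair; [apply continuous_const|apply continuous_id].
Qed.

Lemma continuous2_fst (g : R -> R -> R) t1 t2 : cont2 g -> continuous (g t1) t2.
Proof. intros H. apply (continuous_slice (fun q : R * R => g (fst q) (snd q))), H. Qed.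

(** Structural search; what [cont] leaves open are non-vanishing denominators and continuity facts
    absent from the context. *)
Ltac cont_step :=
  match goal with
  | |- continuous (fun q => ?k) ?p => apply continuous_const
  | |- continuous (fun q => q) ?p => apply continuous_id
  | H : forall i, continuous (?f i) ?p |- continuous (?f _) ?p => apply H
  | H : forall i j, continuous (?f i j) ?p |- continuous (?f _ _) ?p => apply H
  | |- continuous fst ?p => apply continuous_fst
  | |- continuous snd ?p => apply continuous_snd
  | |- continuous sin ?p => apply continuous_sin
  | |- continuous cos ?p => apply continuous_cos
  | |- continuous sqrt ?p => apply continuous_sqrt
  | H : continuous ?f ?p |- continuous ?f ?p => exact H
  | H : forall t, continuous ?k t |- continuous ?k _ => apply H
  | H : cont2 ?g |- continuous (?g _) _ => apply continuous2_fst, H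
  | |- continuous (fun q => @?f q + @?g q) ?p => apply (cR_plus f g)
  | |- continuous (fun q => @?f q - @?g q) ?p => apply (cR_minus f g)
  | |- continuous (fun q => @?f q * @?g q) ?p => apply (cR_mult f g)
  | |- continuous (fun q => @?f q / @?g q) ?p => apply (cR_div f g)
  | |- continuous (fun q => - @?f q) ?p => apply (cR_opp f)
  | |- continuous (fun q => / @?f q) ?p => apply (cR_inv f)
  | |- continuous (fun q => (@?f q) ^ ?n) ?p => apply (cR_pow f n)
  | |- continuous (fun q => sin (@?f q)) ?p => apply (cR_sin f)
  | |- continuous (fun q => cos (@?f q)) ?p => apply (cR_cos f)
  | |- continuous (fun q => sqrt (@?f q)) ?p => apply (cR_sqrt f)
  | |- continuous (fun q => Rabs (@?f q)) ?p => apply (cR_abs f)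
  | |- continuous (fun q => (@?f q, @?g q)) ?p => apply (continuous_pair f g)
  | |- continuous (fun q => fst (@?f q)) ?p => apply (c_fst f)
  | |- continuous (fun q => snd (@?f q)) ?p => apply (c_snd f)
  | H : forall t, continuous ?k t |- continuous (fun q => ?k (@?f q)) ?p =>
      apply (cR_comp k f); [|apply H]
  | H : cont2 ?g |- continuous (fun q => ?g (@?a q) (@?b q)) ?p =>
      apply (cont2_comp g a b); [exact H| |]
  | |- continuous (fun q => ?f q) ?p => change (continuous f p)
  end; cbv beta.
Ltac cont := repeat cont_step.

Lemma RInt_plusR (f g : R -> R) a b : ex_RInt f a b -> ex_RInt g a b ->
  RInt (fun t => f t + g t) a b = RInt f a b + RInt g a b :> R.
Proof. intros; apply (RInt_plus (V := R_CompleteNormedModule) f g); assumption. Qed.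
Lemma RInt_minusR (f g : R -> R) a b : ex_RInt f a b -> ex_RInt g a b ->
  RInt (fun t => f t - g t) a b = RInt f a b - RInt g a b :> R.
Proof. intros; apply (RInt_minus (V := R_CompleteNormedModule) f g); assumption. Qed.
Lemma RInt_scalR k (f : R -> R) a b : ex_RInt f a b ->
  RInt (fun t => k * f t) a b = k * RInt f a b :> R.
Proof. intros; apply (RInt_scal (V := R_CompleteNormedModule) f); assumption. Qed.
Lemma RInt_extR (f g : R -> R) a b : (forall t, f t = g t) -> RInt f a b = RInt g a b :> R.
Proof. intros; apply (RInt_ext (V := R_CompleteNormedModule)); auto. Qed.
Lemma RInt_constR k a b : RInt (fun _ => k) a b = (b - a) * k :> R.
Proof. apply (RInt_const (V := R_CompleteNormedModule)). Qed.
Lemma ex_RInt_contR (f : R -> R) a b : (forall t, continuous f t) -> ex_RInt f a b.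
Proof. intros H; apply (ex_RInt_continuous (V := R_CompleteNormedModule)); intros; apply H. Qed.

(** The tube lemma: finitely many of the neighbourhoods cover the compact interval. Radii are picked
    by choice because the compactness statement asks for a function of the point. *)
Lemma locally_tube {U : UniformSpace} (P : U -> R -> Prop) (a b : R) (p : U) :
  (forall y, a <= y <= b -> locally (p, y) (fun q => P (fst q) (snd q))) ->
  locally p (fun q => forall y, a <= y <= b -> P q y).
Proof.
  intros H.
  assert (D : forall y, { d : posreal | a <= y <= b ->
      forall q, ball (p, y) d q -> P (fst q) (snd q) }).
  { intros y. apply constructive_indefinite_description.
    destruct (classic (a <= y <= b)) as [Hy|Hy].
    - destruct (H y Hy) as [d Hd]. exists d. intros _ q Hq. apply Hd, Hq.
    - exists (mkposreal 1 Rlt_0_1). tauto. }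
  destruct (compactness_value_1d a b (fun y => proj1_sig (D y))) as [d Hd].
  exists d. intros q Hq y Hy.
  apply NNPP. intros N. apply (Hd y Hy). intros [t [Ht [H1 H2]]]. apply N.
  apply (proj2_sig (D t) Ht (q, y)). split; simpl.
  - apply ball_le with (1 := H2). exact Hq.
  - exact H1.
Qed.

Lemma locally_tube_continuous {U : UniformSpace} (f : U -> R -> R) (a b : R) (p : U) (eps : posreal) :
  (forall y, a <= y <= b -> continuous (fun q : U * R => f (fst q) (snd q)) (p, y)) ->
  locally p (fun q => forall y, a <= y <= b -> Rabs (f q y - f p y) < eps).
Proof.
  intros H. apply (locally_tube (fun q y => Rabs (f q y - f p y) < eps)).
  intros y Hy.
  assert (C : continuous (fun q : U * R => Rabs (f (fst q) (snd q) - f p (snd q))) (p, y)).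
  { apply cR_abs, cR_minus; [apply H, Hy|].
    apply (continuous_comp (fun q : U * R => (p, snd q)) (fun q : U * R => f (fst q) (snd q))).
    - cont.
    - apply H, Hy. }
  assert (L : locally (Rabs (f p y - f p y)) (fun z => z < eps)).
  { apply (open_lt eps). rewrite Rminus_diag, Rabs_R0. apply cond_pos. }
  apply (C _ L).
Qed.

Lemma continuous_RInt_param {U : UniformSpace} (f : U -> R -> R) (a b : R) (p : U) :
  a <= b ->
  (forall y, a <= y <= b -> continuous (fun q : U * R => f (fst q) (snd q)) (p, y)) ->
  locally p (fun q => ex_RInt (f q) a b) ->
  continuous (fun q => RInt (f q) a b) p.
Proof.
  intros Hab H Hi. apply filterlim_locally. intros eps.
  (* The summand 1 keeps the denominator positive when [a = b]. *)
  assert (He : 0 < eps / (b - a + 1)).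
  { apply Rdiv_lt_0_compat; [apply cond_pos|lra]. }
  generalize (filter_and _ _ Hi (locally_tube_continuous f a b p (mkposreal _ He) H)).
  apply filter_imp. intros q [Iq Hq].
  change (Rabs (RInt (f q) a b - RInt (f p) a b) < eps).
  assert (Ip : ex_RInt (f p) a b) by apply (locally_singleton _ _ Hi).
  rewrite <- RInt_minusR by assumption.
  apply Rle_lt_trans with ((b - a) * (eps / (b - a + 1))).
  - apply abs_RInt_le_const; [exact Hab|apply (ex_RInt_minus (V := R_NormedModule)); assumption|].
    intros t Ht. left. apply (Hq t Ht).
  - simpl in He. apply Rlt_le_trans with ((b - a + 1) * (eps / (b - a + 1))).
    + apply Rmult_lt_compat_r; lra.
    + right. field. lra.
Qed.

(* Integral over the unit sphere in the coordinates (theta_1, theta_2). *)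
Definition SI (g : R -> R -> R) : R :=
  RInt (fun t1 => RInt (g t1) 0 (2 * PI) * sin t1) 0 PI.

Lemma cont2_inner g t1 : cont2 g -> ex_RInt (g t1) 0 (2 * PI).
Proof.
  intros H. apply (@ex_RInt_continuous R_CompleteNormedModule). intros t2 _.
  apply (continuous_slice (fun q : R * R => g (fst q) (snd q))), H.
Qed.

Lemma cont2_outer_continuous g t1 : cont2 g -> continuous (fun t => RInt (g t) 0 (2 * PI) * sin t) t1.
Proof.
  intros H. apply cR_mult; [|cont].
  apply continuous_RInt_param.
  - generalize PI_RGT_0; lra.
  - intros y _. apply H.
  - apply filter_forall. intros q. apply cont2_inner, H.
Qed.

Lemma cont2_outer g : cont2 g -> ex_RInt (fun t => RInt (g t) 0 (2 * PI) * sin t) 0 PI.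
Proof.
  intros H. apply (@ex_RInt_continuous R_CompleteNormedModule). intros t _.
  apply cont2_outer_continuous, H.
Qed.

Lemma cont2_plus f g : cont2 f -> cont2 g -> cont2 (fun a b => f a b + g a b).
Proof. intros Hf Hg a b; apply cR_plus; auto. Qed.
Lemma cont2_minus f g : cont2 f -> cont2 g -> cont2 (fun a b => f a b - g a b).
Proof. intros Hf Hg a b; apply cR_minus; auto. Qed.
Lemma cont2_mult f g : cont2 f -> cont2 g -> cont2 (fun a b => f a b * g a b).
Proof. intros Hf Hg a b; apply cR_mult; auto. Qed.
Lemma cont2_scal k g : cont2 g -> cont2 (fun a b => k * g a b).
Proof. intros Hg a b; apply cR_mult; cont; auto. Qed.
Lemma cont2_const k : cont2 (fun _ _ => k).
Proof. intros a b; cont. Qed.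

Lemma SI_ext f g : (forall a b, f a b = g a b) -> SI f = SI g.
Proof.
  intros H. f_equal. extensionality t1. extensionality t2. apply H.
Qed.

Lemma SI_plus f g : cont2 f -> cont2 g -> SI (fun a b => f a b + g a b) = SI f + SI g.
Proof.
  intros Hf Hg. unfold SI.
  rewrite <- RInt_plusR by (apply cont2_outer; assumption).
  f_equal. extensionality t1.
  rewrite RInt_plusR by (apply cont2_inner; assumption). ring.
Qed.

Lemma SI_scal k g : cont2 g -> SI (fun a b => k * g a b) = k * SI g.
Proof.
  intros Hg. unfold SI.
  rewrite <- RInt_scalR by (apply cont2_outer; assumption).
  f_equal. extensionality t1.
  rewrite RInt_scalR by (apply cont2_inner; assumption). ring.
Qed.

Lemma SI_minus f g : cont2 f -> cont2 g -> SI (fun a b => f a b - g a b) = SI f - SI g.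
Proof.
  intros Hf Hg.
  rewrite (SI_ext _ (fun a b => f a b + (-1) * g a b)) by (intros; ring).
  rewrite SI_plus, SI_scal; auto using cont2_scal. ring.
Qed.

Lemma SI_le f g : cont2 f -> cont2 g -> (forall a b, f a b <= g a b) -> SI f <= SI g.
Proof.
  intros Hf Hg H. generalize PI_RGT_0; intros Hpi. apply RInt_le; try (apply cont2_outer; assumption); [lra|].
  intros t Ht. apply Rmult_le_compat_r.
  - left. apply sin_gt_0; lra.
  - apply RInt_le; try (apply cont2_inner; assumption); [lra|]. intros; apply H.
Qed.

Lemma SI_const k : SI (fun _ _ => k) = 4 * PI * k.
Proof.
  unfold SI. rewrite (RInt_ext _ (fun t => scal (2 * PI * k) (sin t))).
  2:{ intros t _. rewrite RInt_constR. unfold scal; simpl; unfold mult; simpl. ring. }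
  apply is_RInt_unique.
  replace (4 * PI * k) with (scal (2 * PI * k) (minus (- cos PI) (- cos 0))).
  2:{ rewrite cos_PI, cos_0. unfold scal, minus, plus, opp; simpl; unfold mult; simpl. ring. }
  apply (is_RInt_scal (V := R_NormedModule)).
  apply (is_RInt_derive (V := R_CompleteNormedModule) (fun t => - cos t)).
  - intros x _. auto_derive; [trivial|ring].
  - intros x _. cont.
Qed.

Lemma SI_abs_le g M : cont2 g -> (forall a b, Rabs (g a b) <= M) -> Rabs (SI g) <= 4 * PI * M.
Proof.
  intros Hg H. apply Rabs_le. split.
  - replace (- (4 * PI * M)) with (SI (fun _ _ => - M)) by (rewrite SI_const; ring).
    apply SI_le; auto using cont2_const. intros a b. generalize (H a b); intros K.
    apply Rabs_le_between in K. lra.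
  - rewrite <- SI_const. apply SI_le; auto using cont2_const. intros a b.
    generalize (H a b); intros K. apply Rabs_le_between in K. lra.
Qed.

(** The tube lemma applied once for each angle; this uniform closeness is what allows limits and
    derivatives under [SI]. *)
Lemma locally_sphere {U : UniformSpace} (h : U -> R -> R -> R) (p : U) (eps : posreal) :
  (forall t1 t2, continuous (fun q : U * R * R => h (fst (fst q)) (snd (fst q)) (snd q)) (p, t1, t2)) ->
  locally p (fun q => forall t1, 0 <= t1 <= PI -> forall t2, 0 <= t2 <= 2 * PI ->
     Rabs (h q t1 t2 - h p t1 t2) < eps).
Proof.
  intros H.
  apply (locally_tube (fun q t1 => forall t2, 0 <= t2 <= 2 * PI ->
     Rabs (h q t1 t2 - h p t1 t2) < eps)).
  intros t1 _.
  apply (locally_tube (fun (q : U * R) t2 =>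
     Rabs (h (fst q) (snd q) t2 - h p (snd q) t2) < eps)).
  intros t2 _.
  assert (C : continuous (fun q : U * R * R => Rabs (h (fst (fst q)) (snd (fst q)) (snd q) -
     h p (snd (fst q)) (snd q))) (p, t1, t2)).
  { apply cR_abs, cR_minus; [apply H|].
    apply (continuous_comp (fun q : U * R * R => (p, snd (fst q), snd q))
       (fun q : U * R * R => h (fst (fst q)) (snd (fst q)) (snd q))).
    - cont.
    - apply H. }
  assert (L : locally (Rabs (h p t1 t2 - h p t1 t2)) (fun z => z < eps)).
  { apply (open_lt eps). rewrite Rminus_diag, Rabs_R0. apply cond_pos. }
  apply (C _ L).
Qed.

(** Compactness gives bounds only on the rectangle of angles, so this version does not ask for them
    at all angles. *)
Lemma SI_abs_le_on g M : cont2 g ->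
  (forall a b, 0 <= a <= PI -> 0 <= b <= 2 * PI -> Rabs (g a b) <= M) -> Rabs (SI g) <= 4 * PI * M.
Proof.
  intros Hg H. generalize PI_RGT_0; intros Hpi.
  assert (M0 : 0 <= M).
  { apply Rle_trans with (2 := H 0 0 ltac:(lra) ltac:(lra)). apply Rabs_pos. }
  assert (E : SI (fun _ _ => M) = 4 * PI * M) by apply SI_const.
  rewrite <- E. unfold SI.
  apply Rle_trans with (RInt (fun t1 => Rabs (RInt (g t1) 0 (2 * PI) * sin t1)) 0 PI).
  { apply abs_RInt_le; [lra|apply cont2_outer, Hg]. }
  apply RInt_le.
  - lra.
  - apply (@ex_RInt_continuous R_CompleteNormedModule). intros t _.
    apply cR_abs, cont2_outer_continuous, Hg.
  - apply cont2_outer, cont2_const.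
  - intros t Ht. rewrite Rabs_mult. assert (S : 0 < sin t) by (apply sin_gt_0; lra).
    rewrite (Rabs_right (sin t)) by lra. apply Rmult_le_compat_r; [lra|].
    rewrite RInt_constR.
    apply abs_RInt_le_const; [lra|apply cont2_inner, Hg|].
    intros; apply H; lra.
Qed.

Lemma SI_continuous {U : UniformSpace} (h : U -> R -> R -> R) (p : U) :
  (forall t1 t2, continuous (fun q : U * R * R => h (fst (fst q)) (snd (fst q)) (snd q)) (p, t1, t2)) ->
  locally p (fun q => cont2 (h q)) ->
  continuous (fun q => SI (h q)) p.
Proof.
  intros H Hc. apply filterlim_locally. intros eps.
  generalize PI_RGT_0; intros Hpi.
  assert (He : 0 < eps / (8 * PI)).
  { apply Rdiv_lt_0_compat; [apply cond_pos|lra]. }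
  generalize (filter_and _ _ Hc (locally_sphere h p (mkposreal _ He) H)).
  apply filter_imp. intros q [Iq Hq].
  change (Rabs (SI (h q) - SI (h p)) < eps).
  assert (Ip : cont2 (h p)) by apply (locally_singleton _ _ Hc).
  rewrite <- SI_minus by assumption.
  apply Rle_lt_trans with (4 * PI * (eps / (8 * PI))).
  - apply SI_abs_le_on; [apply cont2_minus; assumption|].
    intros a b Ha Hb. left. apply (Hq a Ha b Hb).
  - replace (4 * PI * (eps / (8 * PI))) with (eps / 2) by (field; lra).
    generalize (cond_pos eps); lra.
Qed.

(** The mean value theorem replaces the difference quotient by [h'] at an intermediate parameter,
    which is close to [h' x] uniformly in the angles. *)
Lemma SI_derive (h h' : R -> R -> R -> R) (x : R) :
  locally x (fun y => forall t1 t2, is_derive (fun u => h u t1 t2) y (h' y t1 t2)) ->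
  (forall t1 t2, continuous (fun q : R * R * R => h' (fst (fst q)) (snd (fst q)) (snd q)) (x, t1, t2)) ->
  locally x (fun y => cont2 (h y)) ->
  cont2 (h' x) ->
  is_derive (fun y => SI (h y)) x (SI (h' x)).
Proof.
  intros Hd Hc Hh Hh'. split; [apply is_linear_scal_l|].
  (* The differential of Coquelicot speaks of every limit point of the filter; here the only one is
     [x]. *)
  intros z Hz. rewrite <- (is_filter_lim_locally_unique (V := R_NormedModule) x z Hz). clear z Hz.
  intros eps. generalize PI_RGT_0; intros Hpi.
  assert (He : 0 < eps / (4 * PI)).
  { apply Rdiv_lt_0_compat; [apply cond_pos|lra]. }
  generalize (filter_and _ _ Hd (locally_sphere h' x (mkposreal _ He) Hc)).
  intros [d1 L1]. destruct Hh as [d2 L2].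
  assert (Hm : 0 < Rmin d1 d2) by (apply Rmin_pos; apply cond_pos).
  exists (mkposreal _ Hm). intros y Hy.
  assert (Y1 : Rabs (y - x) < d1). { apply Rlt_le_trans with (1 := Hy). apply Rmin_l. }
  assert (Y2 : Rabs (y - x) < d2). { apply Rlt_le_trans with (1 := Hy). apply Rmin_r. }
  change (Rabs (SI (h y) - SI (h x) - (y - x) * SI (h' x)) <= eps * Rabs (y - x)).
  assert (Cy : cont2 (h y)) by (apply L2, Y2).
  assert (Cx : cont2 (h x)) by (apply L2, ball_center).
  rewrite <- SI_minus, <- SI_scal, <- SI_minus by auto using cont2_minus, cont2_scal.
  replace (eps * Rabs (y - x)) with (4 * PI * (eps / (4 * PI) * Rabs (y - x))) by (field; lra).
  apply SI_abs_le_on; [auto using cont2_minus, cont2_scal|].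
  intros t1 t2 H1 H2.
  destruct (MVT_gen (fun u => h u t1 t2) x y (fun u => h' u t1 t2)) as [c [Hcc E]].
  - intros u Hu. apply (L1 u). apply Rle_lt_trans with (2 := Y1).
    unfold Rmin, Rmax in Hu. destruct (Rle_dec x y); unfold minus, plus, opp, abs; simpl.
    + rewrite !Rabs_right; lra.
    + rewrite !Rabs_left1; lra.
  - intros u Hu. apply derivable_continuous_pt. exists (h' u t1 t2). apply is_derive_Reals.
    apply (L1 u). apply Rle_lt_trans with (2 := Y1).
    unfold Rmin, Rmax in Hu. destruct (Rle_dec x y); unfold minus, plus, opp, abs; simpl.
    + rewrite !Rabs_right; lra.
    + rewrite !Rabs_left1; lra.
  - rewrite E.
    replace (h' c t1 t2 * (y - x) - (y - x) * h' x t1 t2) with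
      ((h' c t1 t2 - h' x t1 t2) * (y - x)) by ring.
    rewrite Rabs_mult. apply Rmult_le_compat_r; [apply Rabs_pos|]. left.
    apply (L1 c); [|exact H1|exact H2]. apply Rle_lt_trans with (2 := Y1).
    unfold Rmin, Rmax in Hcc. destruct (Rle_dec x y); unfold minus, plus, opp, abs; simpl.
    + rewrite !Rabs_right; lra.
    + rewrite !Rabs_left1; lra.
Qed.

Lemma is_derive_val (f : R -> R) (x l l' : R) : is_derive f x l -> l = l' -> is_derive f x l'.
Proof. intros H E; rewrite <- E; exact H. Qed.
Lemma dR_const k (x : R) : is_derive (fun _ : R => k) x 0.
Proof. apply (is_derive_const (V := R_NormedModule)). Qed.
Lemma dR_id (x : R) : is_derive (fun t : R => t) x 1.
Proof. apply (is_derive_id (K := R_AbsRing)). Qed.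
Lemma dR_plus (f g : R -> R) (x l m : R) : is_derive f x l -> is_derive g x m ->
  is_derive (fun t => f t + g t) x (l + m).
Proof. apply (is_derive_plus (V := R_NormedModule)). Qed.
Lemma dR_minus (f g : R -> R) (x l m : R) : is_derive f x l -> is_derive g x m ->
  is_derive (fun t => f t - g t) x (l - m).
Proof. apply (is_derive_minus (V := R_NormedModule)). Qed.
Lemma dR_opp (f : R -> R) (x l : R) : is_derive f x l -> is_derive (fun t => - f t) x (- l).
Proof. apply (is_derive_opp (V := R_NormedModule)). Qed.
Lemma dR_mult (f g : R -> R) (x l m : R) : is_derive f x l -> is_derive g x m ->
  is_derive (fun t => f t * g t) x (l * g x + f x * m).
Proof. intros; apply (is_derive_mult f g); auto. intros; apply Rmult_comm. Qed.
Lemma dR_scal k (f : R -> R) (x l : R) : is_derive f x l -> is_derive (fun t => k * f t) x (k * l).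
Proof. apply (is_derive_scal f). Qed.
Lemma dR_comp (h f : R -> R) (x l m : R) : is_derive h (f x) m -> is_derive f x l ->
  is_derive (fun t => h (f t)) x (l * m).
Proof. apply (is_derive_comp (V := R_NormedModule) h f). Qed.

Lemma RInt_derive_param (h h' : R -> R -> R) (a b x : R) :
  a <= b ->
  locally x (fun y => forall t, is_derive (fun u => h u t) y (h' y t)) ->
  (forall t, continuous (fun q : R * R => h' (fst q) (snd q)) (x, t)) ->
  locally x (fun y => ex_RInt (h y) a b) ->
  is_derive (fun y => RInt (h y) a b) x (RInt (h' x) a b).
Proof.
  intros Hab Hd Hc Hh.
  assert (Ih' : ex_RInt (h' x) a b).
  { apply ex_RInt_contR. intros t. apply (continuous_slice (fun q : R * R => h' (fst q) (snd q))), Hc. }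
  split; [apply is_linear_scal_l|].
  intros z Hz. rewrite <- (is_filter_lim_locally_unique (V := R_NormedModule) x z Hz). clear z Hz.
  intros eps.
  assert (He : 0 < eps / (b - a + 1)).
  { apply Rdiv_lt_0_compat; [apply cond_pos|lra]. }
  generalize (filter_and _ _ Hd (locally_tube_continuous h' a b x (mkposreal _ He) (fun y _ => Hc y))).
  intros [d1 L1]. destruct Hh as [d2 L2].
  assert (Hm : 0 < Rmin d1 d2) by (apply Rmin_pos; apply cond_pos).
  exists (mkposreal _ Hm). intros y Hy.
  assert (Y1 : Rabs (y - x) < d1). { apply Rlt_le_trans with (1 := Hy). apply Rmin_l. }
  assert (Y2 : Rabs (y - x) < d2). { apply Rlt_le_trans with (1 := Hy). apply Rmin_r. }
  change (Rabs (RInt (h y) a b - RInt (h x) a b - (y - x) * RInt (h' x) a b) <= eps * Rabs (y - x)).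
  assert (Cy : ex_RInt (h y) a b) by (apply L2, Y2).
  assert (Cx : ex_RInt (h x) a b) by (apply L2, ball_center).
  assert (Cd := ex_RInt_minus (V := R_NormedModule) _ _ _ _ Cy Cx).
  assert (Cs := ex_RInt_scal (V := R_NormedModule) _ _ _ (y - x) Ih').
  rewrite <- RInt_minusR, <- RInt_scalR, <- RInt_minusR by assumption.
  apply Rle_trans with ((b - a) * (eps / (b - a + 1) * Rabs (y - x))).
  2:{ rewrite <- Rmult_assoc. apply Rmult_le_compat_r; [apply Rabs_pos|].
      apply Rle_trans with ((b - a + 1) * (eps / (b - a + 1))).
      - apply Rmult_le_compat_r; lra.
      - right. field. lra. }
  apply abs_RInt_le_const; [exact Hab| |].
  { apply (ex_RInt_minus (V := R_NormedModule) _ _ _ _ Cd Cs). }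
  intros t Ht.
  destruct (MVT_gen (fun u => h u t) x y (fun u => h' u t)) as [c [Hcc E]].
  - intros u Hu. apply (L1 u). apply Rle_lt_trans with (2 := Y1).
    unfold Rmin, Rmax in Hu. destruct (Rle_dec x y); unfold minus, plus, opp, abs; simpl.
    + rewrite !Rabs_right; lra.
    + rewrite !Rabs_left1; lra.
  - intros u Hu. apply derivable_continuous_pt. exists (h' u t). apply is_derive_Reals.
    apply (L1 u). apply Rle_lt_trans with (2 := Y1).
    unfold Rmin, Rmax in Hu. destruct (Rle_dec x y); unfold minus, plus, opp, abs; simpl.
    + rewrite !Rabs_right; lra.
    + rewrite !Rabs_left1; lra.
  - rewrite E.
    replace (h' c t * (y - x) - (y - x) * h' x t) with
      ((h' c t - h' x t) * (y - x)) by ring.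
    rewrite Rabs_mult. apply Rmult_le_compat_r; [apply Rabs_pos|]. left.
    apply (L1 c); [|exact Ht]. apply Rle_lt_trans with (2 := Y1).
    unfold Rmin, Rmax in Hcc. destruct (Rle_dec x y); unfold minus, plus, opp, abs; simpl.
    + rewrite !Rabs_right; lra.
    + rewrite !Rabs_left1; lra.
Qed.

Lemma RInt_deriveR (f df : R -> R) a b :
  (forall x, is_derive f x (df x)) -> (forall x, continuous df x) ->
  RInt df a b = f b - f a :> R.
Proof.
  intros Hd Hc. apply is_RInt_unique.
  apply (is_RInt_derive (V := R_CompleteNormedModule) f df); intros; auto.
Qed.

(** * Stokes' theorem on the sphere *)

Section Stokes.
Variables G g0 g1 g2 : R -> R -> R.
Hypothesis HG : cont2 G.
Hypothesis H0 : cont2 g0.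
Hypothesis H1 : cont2 g1.
Hypothesis H2 : cont2 g2.
Hypothesis D1 : forall t1 t2, is_derive (fun t => G t t2) t1
  (- sin t1 * g0 t1 t2 + cos t1 * cos t2 * g1 t1 t2 + cos t1 * sin t2 * g2 t1 t2).
Hypothesis D2 : forall t1 t2, is_derive (fun t => G t1 t) t2
  (- sin t1 * sin t2 * g1 t1 t2 + sin t1 * cos t2 * g2 t1 t2).
Hypothesis Per : forall t1, G t1 (2 * PI) = G t1 0.

(** [G] is a function on the sphere and [g0], [g1], [g2] its partial derivatives in space, entering
    through the chain rules [D1] and [D2]. The integrand is the derivative of [G] in the second
    angle, so periodicity makes it integrate to 0. *)
Lemma stokes_12 :
  SI (fun t1 t2 => sin t1 * cos t2 * g2 t1 t2 - sin t1 * sin t2 * g1 t1 t2) = 0.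
Proof.
  unfold SI. rewrite (RInt_extR _ (fun _ => 0)).
  - rewrite RInt_constR. ring.
  - intros t1. rewrite (RInt_deriveR (G t1)).
    + rewrite Per. ring.
    + intros t2. eapply is_derive_val; [apply D2|ring].
    + intros t2. cont.
Qed.

(** sin t1 * F is the divergence d/dt1 (k sin t1 G) + d/dt2 (k' cos t1 G): since k' has derivative
    -k, the terms k cos t1 G cancel. The first part integrates to 0 because sin t1 vanishes at both
    poles, the second by periodicity. *)
Lemma stokes_aux (k k' : R -> R) (F : R -> R -> R) :
  (forall t, is_derive k' t (- k t)) -> (forall t, continuous k t) ->
  k' (2 * PI) = k' 0 -> cont2 F ->
  (forall t1 t2, sin t1 * F t1 t2 =
     sin t1 * k t2 * (- sin t1 * g0 t1 t2 + cos t1 * cos t2 * g1 t1 t2 + cos t1 * sin t2 * g2 t1 t2)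
     + cos t1 * k' t2 * (- sin t1 * sin t2 * g1 t1 t2 + sin t1 * cos t2 * g2 t1 t2)) ->
  SI F = 0.
Proof.
  intros Dk Ck Pk CF E.
  assert (Ck' : forall t, continuous k' t).
  { intros t. apply (ex_derive_continuous (V := R_NormedModule)). eexists. apply Dk. }
  set (d1 := fun t1 t2 => - sin t1 * g0 t1 t2 + cos t1 * cos t2 * g1 t1 t2 + cos t1 * sin t2 * g2 t1 t2) in *.
  set (d2 := fun t1 t2 => - sin t1 * sin t2 * g1 t1 t2 + sin t1 * cos t2 * g2 t1 t2) in *.
  assert (C1 : cont2 (fun t1 t2 => k t2 * (cos t1 * G t1 t2 + sin t1 * d1 t1 t2))).
  { intros t1 t2. unfold d1. cont. }
  assert (C0 : cont2 (fun t1 t2 => k t2 * (sin t1 * G t1 t2))).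
  { intros t1 t2. cont. }
  assert (C2 : forall t1 t, continuous (fun t2 => - k t2 * G t1 t2 + k' t2 * d2 t1 t2) t).
  { intros t1 t2. unfold d2. cont. }
  unfold SI.
  rewrite (RInt_extR _ (fun t1 => RInt (fun t2 => k t2 * (cos t1 * G t1 t2 + sin t1 * d1 t1 t2)) 0 (2 * PI))).
  - rewrite (RInt_deriveR (fun t1 => RInt (fun t2 => k t2 * (sin t1 * G t1 t2)) 0 (2 * PI))).
    + assert (Z : forall y, sin y = 0 -> RInt (fun t2 => k t2 * (sin y * G y t2)) 0 (2 * PI) = 0 :> R).
      { intros y Hy. rewrite (RInt_extR _ (fun _ => 0)), RInt_constR; [ring|].
        intros t. rewrite Hy. ring. }
      rewrite !Z by (apply sin_PI || apply sin_0). ring.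
    + intros t1. apply (RInt_derive_param (fun t1 t2 => k t2 * (sin t1 * G t1 t2))
        (fun t1 t2 => k t2 * (cos t1 * G t1 t2 + sin t1 * d1 t1 t2))).
      * generalize PI_RGT_0; lra.
      * apply filter_forall. intros y t.
        apply (is_derive_scal (fun u => sin u * G u t)).
        apply (dR_mult sin (fun u => G u t)); [apply is_derive_sin|apply D1].
      * intros t. apply C1.
      * apply filter_forall. intros y. apply (cont2_inner _ y C0).
    + intros t1. apply continuous_RInt_param.
      * generalize PI_RGT_0; lra.
      * intros y _. apply C1.
      * apply filter_forall. intros y. apply (cont2_inner _ y C1).
  - intros t1. symmetry.
    assert (Z : RInt (fun t2 => - k t2 * G t1 t2 + k' t2 * d2 t1 t2) 0 (2 * PI) = 0 :> R).
    { rewrite (RInt_deriveR (fun t2 => k' t2 * G t1 t2)).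
      - rewrite Per, Pk. ring.
      - intros t2. apply (dR_mult k' (G t1)); [apply Dk|apply D2].
      - apply C2. }
    rewrite (Rmult_comm _ (sin t1)), <- (RInt_scalR (sin t1)) by (apply cont2_inner, CF).
    rewrite (RInt_extR (fun t => sin t1 * F t1 t) (fun t2 => k t2 * (cos t1 * G t1 t2 + sin t1 * d1 t1 t2) + cos t1 *
       (- k t2 * G t1 t2 + k' t2 * d2 t1 t2))).
    + rewrite RInt_plusR, RInt_scalR, Z; [rewrite Rmult_0_r, Rplus_0_r; reflexivity| | |].
      * apply ex_RInt_contR, C2.
      * apply (cont2_inner _ t1 C1).
      * apply ex_RInt_contR. intros t. apply cR_mult; [cont|apply C2].
    + intros t2. rewrite E. unfold d1, d2. ring.
Qed.

(** The rotation in the (x_0, x_1)-plane is cos t2 d/dt1 - cot t1 sin t2 d/dt2, whence the two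
    weights; for the (x_0, x_2)-plane they become sin and cos. *)
Lemma stokes_01 :
  SI (fun t1 t2 => cos t1 * g1 t1 t2 - sin t1 * cos t2 * g0 t1 t2) = 0.
Proof.
  apply (stokes_aux cos (fun t => - sin t)).
  - intros t. auto_derive; [trivial|ring].
  - intros; cont.
  - rewrite sin_2PI, sin_0. reflexivity.
  - intros t1 t2; cont; auto.
  - intros t1 t2. generalize (sin2_cos2 t2). unfold Rsqr. intros S.
    replace (sin t1 * (cos t1 * g1 t1 t2 - sin t1 * cos t2 * g0 t1 t2)) with
     (sin t1 * (cos t1 * ((sin t2 * sin t2 + cos t2 * cos t2) * g1 t1 t2) - sin t1 * cos t2 * g0 t1 t2))
     by (rewrite S; ring).
    ring.
Qed.

Lemma stokes_02 :
  SI (fun t1 t2 => cos t1 * g2 t1 t2 - sin t1 * sin t2 * g0 t1 t2) = 0.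
Proof.
  apply (stokes_aux sin cos).
  - intros t. apply is_derive_cos.
  - intros; cont.
  - rewrite cos_2PI, cos_0. reflexivity.
  - intros t1 t2; cont; auto.
  - intros t1 t2. generalize (sin2_cos2 t2). unfold Rsqr. intros S.
    replace (sin t1 * (cos t1 * g2 t1 t2 - sin t1 * sin t2 * g0 t1 t2)) with
     (sin t1 * (cos t1 * ((sin t2 * sin t2 + cos t2 * cos t2) * g2 t1 t2) - sin t1 * sin t2 * g0 t1 t2))
     by (rewrite S; ring).
    ring.
Qed.
End Stokes.

(** * Flux of a divergence-free field through a moving sphere *)

(** The point of the unit sphere with these angles. Every index above 1 is read as 2, here and in
    most of the indexed families below. *)
Definition om (i : nat) (t1 t2 : R) : R :=
  match i with 0%nat => cos t1 | 1%nat => sin t1 * cos t2 | _ => sin t1 * sin t2 end.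

Definition co (i : nat) (y : pt) : R :=
  match i with 0%nat => fst (fst y) | 1%nat => snd (fst y) | _ => snd y end.

(* The chain rule along every differentiable curve through y is used as the
   notion of gradient: it is closed under algebraic operations for free. *)
Definition hgrad (phi : pt -> R) (y : pt) (g : nat -> R) : Prop :=
  forall (c : nat -> R -> R) (t : R) (dc : nat -> R),
    (forall i, is_derive (c i) t (dc i)) ->
    (c 0%nat t, c 1%nat t, c 2%nat t) = y ->
    is_derive (fun u => phi (c 0%nat u, c 1%nat u, c 2%nat u)) t
      (g 0%nat * dc 0%nat + g 1%nat * dc 1%nat + g 2%nat * dc 2%nat).

Definition delta (i j : nat) : R := if Nat.eqb i j then 1 else 0.

Lemma om_cont i : cont2 (om i).
Proof. intros a b; destruct i as [|[|i]]; simpl; cont. Qed.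

Lemma om_sphere t1 t2 : om 0 t1 t2 ^ 2 + om 1 t1 t2 ^ 2 + om 2 t1 t2 ^ 2 = 1.
Proof.
  simpl. generalize (sin2_cos2 t2) (sin2_cos2 t1). unfold Rsqr. intros S1 S2.
  replace (cos t1 * (cos t1 * 1) + sin t1 * cos t2 * (sin t1 * cos t2 * 1) + sin t1 * sin t2 * (sin t1 * sin t2 * 1))
    with (cos t1 * cos t1 + sin t1 * sin t1 * (sin t2 * sin t2 + cos t2 * cos t2)) by ring.
  rewrite S1. lra.
Qed.


Section Flow.
Variables (Psi : nat -> pt -> R) (J : nat -> nat -> pt -> R) (a0 a1 : R) (b0 b1 : nat -> R).

(** The moving sphere has radius a0 + a1 lam and centre b0 + b1 lam; [flowV] is the velocity of its
    points and [flux] the flux of [Psi] through it. *)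
Definition flowA lam := a0 + a1 * lam.
Definition flowV k t1 t2 := a1 * om k t1 t2 + b1 k.
Definition flowY (i : nat) lam t1 t2 := flowA lam * om i t1 t2 + (b0 i + b1 i * lam).
Definition flowP lam t1 t2 : pt := (flowY 0 lam t1 t2, flowY 1 lam t1 t2, flowY 2 lam t1 t2).
Definition flux lam : R := flowA lam ^ 2 *
   SI (fun t1 t2 => om 0 t1 t2 * Psi 0%nat (flowP lam t1 t2) + om 1 t1 t2 * Psi 1%nat (flowP lam t1 t2)
     + om 2 t1 t2 * Psi 2%nat (flowP lam t1 t2)).

Variable dom : pt -> Prop.
Hypothesis HJ : forall z i, dom z -> hgrad (Psi i) z (fun j => J i j z).
Hypothesis CP : forall z i, dom z -> continuous (Psi i) z.
Hypothesis CJ : forall z i j, dom z -> continuous (J i j) z.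
Hypothesis trJ : forall z, dom z -> J 0 0 z + J 1 1 z + J 2 2 z = 0.

Lemma flowP_cont lam t1 t2 :
  continuous (fun q : R * R * R => flowP (fst (fst q)) (snd (fst q)) (snd q)) (lam, t1, t2).
Proof. unfold flowP, flowY, flowA, om. cont. Qed.

Section Fixed.
Variable lam : R.
Hypothesis Hd : forall t1 t2, dom (flowP lam t1 t2).

Lemma flowP_cont2 (f : pt -> R) : (forall z, dom z -> continuous f z) ->
  cont2 (fun t1 t2 => f (flowP lam t1 t2)).
Proof.
  intros Hf t1 t2.
  apply (continuous_comp (fun q : R * R => flowP lam (fst q) (snd q)) f); [|apply Hf, Hd].
  unfold flowP, flowY, flowA, om. cont.
Qed.

(** Derivative with respect to omega_j of the product Psi_i V_k, both factors regarded as functions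
    of omega. *)
Let g i k j t1 t2 := flowA lam * J i j (flowP lam t1 t2) * flowV k t1 t2
   + Psi i (flowP lam t1 t2) * (a1 * delta k j).

Lemma g_cont i k j : cont2 (g i k j).
Proof.
  intros t1 t2. unfold g. apply cR_plus; apply cR_mult.
  - apply cR_mult; cont. apply flowP_cont2; auto.
  - unfold flowV. cont. apply om_cont.
  - apply flowP_cont2; auto.
  - cont.
Qed.

Lemma G_cont i k : cont2 (fun t1 t2 => Psi i (flowP lam t1 t2) * flowV k t1 t2).
Proof.
  intros t1 t2. apply cR_mult.
  - apply flowP_cont2; auto.
  - unfold flowV. cont. apply om_cont.
Qed.

Lemma om_D1 i t1 t2 : is_derive (fun t => om i t t2) t1
  (- sin t1 * delta 0 i + cos t1 * cos t2 * delta 1 i + cos t1 * sin t2 * (if Nat.leb 2 i then 1 else 0)).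
Proof. destruct i as [|[|i]]; simpl; unfold delta; simpl; auto_derive; trivial; ring. Qed.
Lemma om_D2 i t1 t2 : is_derive (fun t => om i t1 t) t2
  (- sin t1 * sin t2 * delta 1 i + sin t1 * cos t2 * (if Nat.leb 2 i then 1 else 0)).
Proof. destruct i as [|[|i]]; simpl; unfold delta; simpl; auto_derive; trivial; ring. Qed.

Lemma G_D1 i k t1 t2 : (k <= 2)%nat -> is_derive (fun t => Psi i (flowP lam t t2) * flowV k t t2) t1
  (- sin t1 * g i k 0 t1 t2 + cos t1 * cos t2 * g i k 1 t1 t2 + cos t1 * sin t2 * g i k 2 t1 t2).
Proof.
  intros Hk. eapply is_derive_val.
  - apply dR_mult.
    + apply (HJ (flowP lam t1 t2) i (Hd t1 t2) (fun n t => flowY n lam t t2) t1).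
      * intros n. unfold flowY. apply dR_plus; [|apply dR_const]. apply dR_scal, om_D1.
      * reflexivity.
    + unfold flowV. apply dR_plus; [|apply dR_const]. apply dR_scal, om_D1.
  - unfold g. destruct k as [|[|[|k]]]; [| | |lia]; unfold delta; simpl; ring.
Qed.

Lemma G_D2 i k t1 t2 : (k <= 2)%nat -> is_derive (fun t => Psi i (flowP lam t1 t) * flowV k t1 t) t2
  (- sin t1 * sin t2 * g i k 1 t1 t2 + sin t1 * cos t2 * g i k 2 t1 t2).
Proof.
  intros Hk. eapply is_derive_val.
  - apply dR_mult.
    + apply (HJ (flowP lam t1 t2) i (Hd t1 t2) (fun n t => flowY n lam t1 t) t2).
      * intros n. unfold flowY. apply dR_plus; [|apply dR_const]. apply dR_scal, om_D2.
      * reflexivity.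
    + unfold flowV. apply dR_plus; [|apply dR_const]. apply dR_scal, om_D2.
  - unfold g. destruct k as [|[|[|k]]]; [| | |lia]; unfold delta; simpl; ring.
Qed.

Lemma G_per i k t1 : Psi i (flowP lam t1 (2 * PI)) * flowV k t1 (2 * PI) =
   Psi i (flowP lam t1 0) * flowV k t1 0.
Proof.
  unfold flowP, flowY, flowV, om. rewrite cos_2PI, sin_2PI, cos_0, sin_0. reflexivity.
Qed.

(* The integrand is omega . curl (Psi x V), V the velocity of the moving sphere. *)
Lemma flow_zero : SI (fun t1 t2 =>
   2 * a1 * (om 0 t1 t2 * Psi 0%nat (flowP lam t1 t2) + om 1 t1 t2 * Psi 1%nat (flowP lam t1 t2)
     + om 2 t1 t2 * Psi 2%nat (flowP lam t1 t2)) +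
   flowA lam * (
     om 0 t1 t2 * (J 0 0 (flowP lam t1 t2) * flowV 0 t1 t2 + J 0 1 (flowP lam t1 t2) * flowV 1 t1 t2 + J 0 2 (flowP lam t1 t2) * flowV 2 t1 t2) +
     om 1 t1 t2 * (J 1 0 (flowP lam t1 t2) * flowV 0 t1 t2 + J 1 1 (flowP lam t1 t2) * flowV 1 t1 t2 + J 1 2 (flowP lam t1 t2) * flowV 2 t1 t2) +
     om 2 t1 t2 * (J 2 0 (flowP lam t1 t2) * flowV 0 t1 t2 + J 2 1 (flowP lam t1 t2) * flowV 1 t1 t2 + J 2 2 (flowP lam t1 t2) * flowV 2 t1 t2))) = 0.
Proof.
  assert (S12 : forall i k, (k <= 2)%nat -> SI (fun t1 t2 => sin t1 * cos t2 * g i k 2 t1 t2 - sin t1 * sin t2 * g i k 1 t1 t2) = 0).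
  { intros i k Hk. apply (stokes_12 (fun t1 t2 => Psi i (flowP lam t1 t2) * flowV k t1 t2)
      (g i k 1) (g i k 2)); auto using g_cont, G_D2, G_per. }
  assert (S01 : forall i k, (k <= 2)%nat -> SI (fun t1 t2 => cos t1 * g i k 1 t1 t2 - sin t1 * cos t2 * g i k 0 t1 t2) = 0).
  { intros i k Hk. apply (stokes_01 (fun t1 t2 => Psi i (flowP lam t1 t2) * flowV k t1 t2)
      (g i k 0) (g i k 1) (g i k 2)); auto using g_cont, G_D1, G_D2, G_per, G_cont. }
  assert (S02 : forall i k, (k <= 2)%nat -> SI (fun t1 t2 => cos t1 * g i k 2 t1 t2 - sin t1 * sin t2 * g i k 0 t1 t2) = 0).
  { intros i k Hk. apply (stokes_02 (fun t1 t2 => Psi i (flowP lam t1 t2) * flowV k t1 t2)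
      (g i k 0) (g i k 1) (g i k 2)); auto using g_cont, G_D1, G_D2, G_per, G_cont. }
  assert (C12 : forall i k, cont2 (fun t1 t2 => sin t1 * cos t2 * g i k 2 t1 t2 - sin t1 * sin t2 * g i k 1 t1 t2)).
  { intros i k t1 t2. cont; apply g_cont. }
  assert (C01 : forall i k, cont2 (fun t1 t2 => cos t1 * g i k 1 t1 t2 - sin t1 * cos t2 * g i k 0 t1 t2)).
  { intros i k t1 t2. cont; apply g_cont. }
  assert (C02 : forall i k, cont2 (fun t1 t2 => cos t1 * g i k 2 t1 t2 - sin t1 * sin t2 * g i k 0 t1 t2)).
  { intros i k t1 t2. cont; apply g_cont. }
  transitivity (
    SI (fun t1 t2 =>
      (((sin t1 * cos t2 * g 1 2 2 t1 t2 - sin t1 * sin t2 * g 1 2 1 t1 t2) -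
       (sin t1 * cos t2 * g 2 1 2 t1 t2 - sin t1 * sin t2 * g 2 1 1 t1 t2)) -
      ((cos t1 * g 2 0 2 t1 t2 - sin t1 * sin t2 * g 2 0 0 t1 t2) -
       (cos t1 * g 0 2 2 t1 t2 - sin t1 * sin t2 * g 0 2 0 t1 t2))) +
      ((cos t1 * g 0 1 1 t1 t2 - sin t1 * cos t2 * g 0 1 0 t1 t2) -
       (cos t1 * g 1 0 1 t1 t2 - sin t1 * cos t2 * g 1 0 0 t1 t2)))).
  (* In the variable omega, curl (Psi x V) = 2 a1 Psi + A (V . grad) Psi - A (div Psi) V, where div
     V = 3 a1 and (Psi . grad) V = a1 Psi; the last term vanishes because J has trace 0. *)
  - apply SI_ext. intros t1 t2. unfold g, delta; simpl.
    generalize (trJ _ (Hd t1 t2)).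
    set (y := flowP lam t1 t2). intros T.
    assert (E : J 2 2 y = - J 0 0 y - J 1 1 y) by lra. rewrite E.
    unfold flowV, om. ring.
  - assert (Zp : forall f h, cont2 f -> cont2 h -> SI f = 0 -> SI h = 0 -> SI (fun a b => f a b + h a b) = 0).
    { intros f h Cf Ch Ef Eh. rewrite SI_plus, Ef, Eh by assumption. ring. }
    assert (Zm : forall f h, cont2 f -> cont2 h -> SI f = 0 -> SI h = 0 -> SI (fun a b => f a b - h a b) = 0).
    { intros f h Cf Ch Ef Eh. rewrite SI_minus, Ef, Eh by assumption. ring. }
    apply Zp; [| |apply Zm; [| |apply Zm|apply Zm]|apply Zm]; auto using cont2_minus.
Qed.
End Fixed.

(** Differentiating the squared radius times the integral gives [flowA lam] times exactly the
    integral of [flow_zero]. *)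
Lemma flux_derive lam : locally lam (fun l => forall t1 t2, dom (flowP l t1 t2)) ->
  is_derive flux lam 0.
Proof.
  intros Hd. pose proof (locally_singleton _ _ Hd) as Hd0. unfold flux.
  pose (h := fun l t1 t2 => om 0 t1 t2 * Psi 0%nat (flowP l t1 t2) + om 1 t1 t2 * Psi 1%nat (flowP l t1 t2)
     + om 2 t1 t2 * Psi 2%nat (flowP l t1 t2)).
  pose (dJ := fun l t1 t2 => 
     om 0 t1 t2 * (J 0 0 (flowP l t1 t2) * flowV 0 t1 t2 + J 0 1 (flowP l t1 t2) * flowV 1 t1 t2 + J 0 2 (flowP l t1 t2) * flowV 2 t1 t2) +
     om 1 t1 t2 * (J 1 0 (flowP l t1 t2) * flowV 0 t1 t2 + J 1 1 (flowP l t1 t2) * flowV 1 t1 t2 + J 1 2 (flowP l t1 t2) * flowV 2 t1 t2) +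
     om 2 t1 t2 * (J 2 0 (flowP l t1 t2) * flowV 0 t1 t2 + J 2 1 (flowP l t1 t2) * flowV 1 t1 t2 + J 2 2 (flowP l t1 t2) * flowV 2 t1 t2)).
  assert (Ch : forall l, (forall t1 t2, dom (flowP l t1 t2)) -> cont2 (h l)).
  { intros l Hl t1 t2. unfold h. cont; match goal with
      | |- continuous (fun q => om ?i _ _) _ => apply om_cont
      | |- continuous (fun q => Psi ?i _) _ => apply (flowP_cont2 l Hl (Psi i)); auto
      end. }
  assert (Cd : cont2 (dJ lam)).
  { intros t1 t2. unfold dJ, flowV. cont; match goal with
      | |- continuous (fun q => om ?i _ _) _ => apply om_cont
      | |- continuous (fun q => J ?i ?j _) _ => apply (flowP_cont2 lam Hd0 (J i j)); auto
      end. }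
  assert (D : is_derive (fun l => SI (h l)) lam (SI (dJ lam))).
  { apply SI_derive.
    - revert Hd. apply filter_imp. intros l Hl t1 t2.
      assert (DP : forall i, is_derive (fun u => Psi i (flowP u t1 t2)) l
        (J i 0%nat (flowP l t1 t2) * flowV 0 t1 t2 + J i 1%nat (flowP l t1 t2) * flowV 1 t1 t2 + J i 2%nat (flowP l t1 t2) * flowV 2 t1 t2)).
      { intros i. apply (HJ (flowP l t1 t2) i (Hl t1 t2) (fun n u => flowY n u t1 t2) l (fun n => flowV n t1 t2)); [|reflexivity].
        intros n. unfold flowY, flowV, flowA. auto_derive; [trivial|ring]. }
      unfold h, dJ. apply dR_plus; [apply dR_plus|]; apply dR_scal; apply DP.
    - intros t1 t2. unfold dJ, flowV.
      assert (CC : forall i j, continuous (fun q : R * R * R => J i j (flowP (fst (fst q)) (snd (fst q)) (snd q))) (lam, t1, t2)).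
      { intros i j. apply (continuous_comp (fun q : R * R * R => flowP (fst (fst q)) (snd (fst q)) (snd q)) (J i j)).
        - apply flowP_cont.
        - apply CJ, Hd0. }
      unfold om. cont; apply CC.
    - revert Hd. apply filter_imp. exact Ch.
    - exact Cd. }
  eapply is_derive_val.
  - apply (dR_mult (fun l => flowA l ^ 2) _ _ (2 * a1 * flowA lam)); [|apply D].
    unfold flowA. auto_derive; [trivial|simpl; ring].
  - generalize (flow_zero lam Hd0). intros Z.
    rewrite (SI_ext _ (fun t1 t2 => 2 * a1 * h lam t1 t2 + flowA lam * dJ lam t1 t2)) in Z by reflexivity.
    rewrite SI_plus, !SI_scal in Z by auto using cont2_scal.
    transitivity (flowA lam * (2 * a1 * SI (h lam) + flowA lam * SI (dJ lam))).
    + unfold h. cbv beta. simpl pow. ring.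
    + rewrite Z. ring.
Qed.
End Flow.

(** * Calculus of gradients in the sense of the chain rule *)

Section Gradients.
Variable y : pt.
Lemma hgrad_eq phi g h : hgrad phi y g ->
  (forall j, (j <= 2)%nat -> g j = h j) -> hgrad phi y h.
Proof.
  intros H E c t dc Hc Hy. rewrite <- !E by lia. apply H; assumption.
Qed.
Lemma hgrad_const k : hgrad (fun _ => k) y (fun _ => 0).
Proof. intros c t dc Hc Hy. eapply is_derive_val; [apply dR_const|ring]. Qed.
Lemma hgrad_plus f g df dg : hgrad f y df -> hgrad g y dg ->
  hgrad (fun z => f z + g z) y (fun j => df j + dg j).
Proof.
  intros Hf Hg c t dc Hc Hy. eapply is_derive_val.
  - apply dR_plus; [apply Hf|apply Hg]; eassumption.
  - simpl. ring.
Qed.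
Lemma hgrad_minus f g df dg : hgrad f y df -> hgrad g y dg ->
  hgrad (fun z => f z - g z) y (fun j => df j - dg j).
Proof.
  intros Hf Hg c t dc Hc Hy. eapply is_derive_val.
  - apply dR_minus; [apply Hf|apply Hg]; eassumption.
  - simpl. ring.
Qed.
Lemma hgrad_mult f g df dg : hgrad f y df -> hgrad g y dg ->
  hgrad (fun z => f z * g z) y (fun j => df j * g y + f y * dg j).
Proof.
  intros Hf Hg c t dc Hc Hy. eapply is_derive_val.
  - apply dR_mult; [apply Hf|apply Hg]; eassumption.
  - cbv beta. rewrite Hy. ring.
Qed.
Lemma hgrad_scal k f df : hgrad f y df -> hgrad (fun z => k * f z) y (fun j => k * df j).
Proof.
  intros Hf c t dc Hc Hy. eapply is_derive_val.
  - apply dR_scal; apply Hf; eassumption.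
  - simpl. ring.
Qed.
Lemma hgrad_co i : (i <= 2)%nat -> hgrad (co i) y (delta i).
Proof.
  intros Hi c t dc Hc Hy. unfold delta. destruct i as [|[|[|i]]]; [| | |lia]; simpl.
  - eapply is_derive_val; [apply Hc|]. simpl; ring.
  - eapply is_derive_val; [apply Hc|]. simpl; ring.
  - eapply is_derive_val; [apply Hc|]. simpl; ring.
Qed.
Lemma hgrad_comp h dh f df : is_derive h (f y) dh -> hgrad f y df ->
  hgrad (fun z => h (f z)) y (fun j => dh * df j).
Proof.
  intros Hh Hf c t dc Hc Hy. eapply is_derive_val.
  - apply (dR_comp h); [|apply Hf; eassumption]. rewrite Hy. exact Hh.
  - simpl. ring.
Qed.
End Gradients.

Lemma continuous_co i z : continuous (co i) z.
Proof. destruct i as [|[|i]]; unfold co; cont. Qed.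

(** * The divergence-free tensor of two curl-free and divergence-free fields *)

Definition dot (u v : nat -> R) : R := u 0%nat * v 0%nat + u 1%nat * v 1%nat + u 2%nat * v 2%nat.

Section Stress.
Variables (v : nat -> pt -> R) (dv : nat -> nat -> pt -> R) (bd : pt -> Prop).
Hypothesis Hv : forall z i, bd z -> hgrad (v i) z (fun j => dv i j z).
Hypothesis Cv : forall z i, bd z -> continuous (v i) z.
Hypothesis Cdv : forall z i j, bd z -> continuous (dv i j) z.
Hypothesis Sv : forall z i j, bd z -> dv i j z = dv j i z.
Hypothesis Tv : forall z, bd z -> dv 0%nat 0%nat z + dv 1%nat 1%nat z + dv 2%nat 2%nat z = 0.

Variables (x : nat -> R) (al be : R).
Hypothesis Hx : al * be = dot x x.

(* With al * be = |x|^2 the field ku = (al y - x) kq^(-3/2) is a gradient without divergence: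
   (al, be) = (1, |x|^2) is the Newton field of the point x, and (|x|^2/s^2, s^2) the field of
   its image in the sphere of radius s. *)
Definition kq (z : pt) : R :=
  al * dot (fun i => co i z) (fun i => co i z) - 2 * dot x (fun i => co i z) + be.
Definition kk (z : pt) : R := / (kq z * sqrt (kq z)).
Definition ku (i : nat) (z : pt) : R := (al * co i z - x i) * kk z.
Definition kdu (i j : nat) (z : pt) : R :=
  al * delta i j * kk z + (al * co i z - x i) * (- 3 * (al * co j z - x j) * (kk z / kq z)).

Lemma kq_grad z : hgrad kq z (fun j => 2 * (al * co j z - x j)).
Proof.
  unfold kq, dot. eapply hgrad_eq.
  - apply hgrad_plus; [apply hgrad_minus|apply hgrad_const].
    + apply hgrad_scal. apply hgrad_plus; [apply hgrad_plus|]; apply hgrad_mult; apply hgrad_co; lia.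
    + apply hgrad_scal. apply hgrad_plus; [apply hgrad_plus|]; apply hgrad_scal, hgrad_co; lia.
  - intros j Hj. unfold delta. destruct j as [|[|[|j]]]; [| | |lia]; simpl; ring.
Qed.

Lemma kk_grad z : 0 < kq z -> hgrad kk z (fun j => - 3 * (al * co j z - x j) * (kk z / kq z)).
Proof.
  intros Hq. unfold kk at 1.
  eapply hgrad_eq.
  - apply (hgrad_comp z (fun w => / (w * sqrt w)) (- (3/2) * (/ (kq z * sqrt (kq z)) / kq z))); [|apply kq_grad].
    assert (Hs : 0 < sqrt (kq z)) by (apply sqrt_lt_R0; exact Hq).
    auto_derive.
    + split; [exact Hq|]. split; [|trivial]. apply Rgt_not_eq, Rmult_lt_0_compat; assumption.
    + set (w := kq z) in *. assert (E : w = sqrt w * sqrt w) by (symmetry; apply sqrt_sqrt; lra).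
      set (t := sqrt w) in *. rewrite E. field. lra.
  - intros j _. unfold kk. simpl. field. split.
    + apply Rgt_not_eq, sqrt_lt_R0, Hq.
    + lra.
Qed.

Lemma ku_grad i z : (i <= 2)%nat -> 0 < kq z -> hgrad (ku i) z (fun j => kdu i j z).
Proof.
  intros Hi Hq. unfold ku. eapply hgrad_eq.
  - apply hgrad_mult; [apply hgrad_minus; [apply hgrad_scal, hgrad_co, Hi|apply hgrad_const]|apply kk_grad, Hq].
  - intros j _. unfold kdu. simpl. ring.
Qed.

Lemma kdu_sym i j z : kdu i j z = kdu j i z.
Proof.
  unfold kdu. replace (delta j i) with (delta i j).
  - ring.
  - unfold delta. rewrite PeanoNat.Nat.eqb_sym. reflexivity.
Qed.

(** Up to the factor 3 kk / kq the trace is al kq - |al y - x|^2, and these agree exactly because al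
    be = |x|^2. *)
Lemma kdu_trace z : 0 < kq z -> kdu 0 0 z + kdu 1 1 z + kdu 2 2 z = 0.
Proof.
  intros Hq. unfold kdu, delta; simpl.
  transitivity (3 * kk z / kq z * (al * kq z - ((al * co 0 z - x 0%nat) ^ 2 + (al * co 1 z - x 1%nat) ^ 2 + (al * co 2 z - x 2%nat) ^ 2))).
  { simpl. field. lra. }
  replace (al * kq z) with (al * (al * dot (fun i => co i z) (fun i => co i z) - 2 * dot x (fun i => co i z)) + dot x x).
  2:{ unfold kq. rewrite <- Hx. ring. }
  unfold dot. simpl. ring.
Qed.

Lemma kq_cont z : continuous kq z.
Proof.
  unfold kq, dot.
  assert (K1 : forall i, continuous (co i) z) by (intros; apply continuous_co).
  cont.
Qed.
Lemma kk_cont z : 0 < kq z -> continuous kk z.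
Proof.
  intros Hq. unfold kk.
  assert (0 < sqrt (kq z)) by (apply sqrt_lt_R0; exact Hq).
  cont; try apply kq_cont. apply Rgt_not_eq, Rmult_lt_0_compat; assumption.
Qed.
Lemma ku_cont i z : 0 < kq z -> continuous (ku i) z.
Proof. intros Hq. unfold ku. cont; [apply continuous_co|apply kk_cont, Hq]. Qed.
Lemma kdu_cont i j z : 0 < kq z -> continuous (kdu i j) z.
Proof.
  intros Hq. unfold kdu.
  assert (K1 : forall i, continuous (co i) z) by (intros; apply continuous_co).
  assert (K2 := kk_cont z Hq). assert (K3 := kq_cont z).
  cont. lra.
Qed.

Section Component.
Variable k : nat.
Hypothesis Hk : (k <= 2)%nat.

(* Row k of a tensor that is divergence-free when w and u are both curl- and divergence-free. *)
Definition stress (w u : nat -> R) (i : nat) : R := w k * u i + w i * u k - delta k i * dot w u.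

Definition sPsi (i : nat) (z : pt) : R := stress (fun n => v n z) (fun n => ku n z) i.
Definition sJ (i j : nat) (z : pt) : R :=
  (dv k j z * ku i z + v k z * kdu i j z) + (dv i j z * ku k z + v i z * kdu k j z)
  - delta k i * (dv 0 j z * ku 0 z + v 0%nat z * kdu 0 j z + (dv 1 j z * ku 1 z + v 1%nat z * kdu 1 j z)
     + (dv 2 j z * ku 2 z + v 2%nat z * kdu 2 j z)).

Definition sdom z := bd z /\ 0 < kq z.

Lemma sPsi_grad i z : (i <= 2)%nat -> sdom z -> hgrad (sPsi i) z (fun j => sJ i j z).
Proof.
  intros Hi [Hb Hq]. unfold sPsi, stress, dot, sJ.
  apply hgrad_minus; [apply hgrad_plus|apply hgrad_scal; apply hgrad_plus; [apply hgrad_plus|]];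
    apply hgrad_mult; (apply Hv, Hb || (apply ku_grad; [lia|exact Hq])).
Qed.

(** By symmetry of both Jacobians the derivative of <v, u> in direction k equals u . grad v_k + v .
    grad u_k, which cancels the non-divergence terms; what remains is v_k div u + u_k div v. *)
Lemma sJ_trace z : sdom z -> sJ 0 0 z + sJ 1 1 z + sJ 2 2 z = 0.
Proof.
  intros [Hb Hq]. unfold sJ.
  generalize (Tv z Hb) (kdu_trace z Hq) (Sv z 0 1 Hb) (Sv z 0 2 Hb) (Sv z 1 2 Hb)
    (kdu_sym 0 1 z) (kdu_sym 0 2 z) (kdu_sym 1 2 z).
  intros T1 T2 E1 E2 E3 E4 E5 E6.
  assert (F1 : dv 2%nat 2%nat z = - dv 0%nat 0%nat z - dv 1%nat 1%nat z) by lra.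
  assert (F2 : kdu 2 2 z = - kdu 0 0 z - kdu 1 1 z) by lra.
  unfold delta. destruct k as [|[|[|n]]]; [| | |lia]; simpl; rewrite ?F1, ?F2, ?E1, ?E2, ?E3, ?E4, ?E5, ?E6; ring.
Qed.

Lemma sPsi_cont i z : sdom z -> continuous (sPsi i) z.
Proof.
  intros [Hb Hq]. unfold sPsi, stress, dot.
  assert (K1 : forall i, continuous (v i) z) by (intros; apply Cv, Hb).
  assert (K3 : forall i, continuous (ku i) z) by (intros; apply ku_cont, Hq).
  cont.
Qed.
Lemma sJ_cont i j z : sdom z -> continuous (sJ i j) z.
Proof.
  intros [Hb Hq]. unfold sJ.
  assert (K1 : forall i, continuous (v i) z) by (intros; apply Cv, Hb).
  assert (K2 : forall i j, continuous (dv i j) z) by (intros; apply Cdv, Hb).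
  assert (K3 : forall i, continuous (ku i) z) by (intros; apply ku_cont, Hq).
  assert (K4 : forall i j, continuous (kdu i j) z) by (intros; apply kdu_cont, Hq).
  cont.
Qed.

(** [flux_derive] quantifies over all indices, whereas [delta], unlike [om], does not identify the
    indices above 2. *)
Definition clip (i : nat) : nat := match i with 0%nat => 0%nat | 1%nat => 1%nat | _ => 2%nat end.

Lemma stress_flux_derive a0 a1 b0 b1 lam :
  locally lam (fun l => forall t1 t2, sdom (flowP a0 a1 b0 b1 l t1 t2)) ->
  is_derive (flux sPsi a0 a1 b0 b1) lam 0.
Proof.
  intros H.
  apply (flux_derive (fun i => sPsi (clip i)) (fun i => sJ (clip i)) a0 a1 b0 b1 sdom).
  - intros z i Hz. apply sPsi_grad; [destruct i as [|[|i]]; simpl; lia|exact Hz].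
  - intros z i Hz. apply sPsi_cont, Hz.
  - intros z i j Hz. apply sJ_cont, Hz.
  - intros z Hz. apply sJ_trace, Hz.
  - exact H.
Qed.
End Component.
End Stress.

(** * Poisson's formula *)

(** Only continuity is asked for at 0, because at that parameter the sphere may have collapsed onto
    the singularity of the Newton field. *)
Lemma zero_derive_const (g : R -> R) :
  continuous g 0 -> (forall t, 0 < t <= 1 -> is_derive g t 0) -> g 1 = g 0.
Proof.
  intros C D.
  destruct (MVT_gen g 0 1 (fun _ => 0)) as [c [_ E]].
  - intros t Ht. rewrite Rmin_left, Rmax_right in Ht by lra. apply D; lra.
  - intros t Ht. rewrite Rmin_left, Rmax_right in Ht by lra.
    apply continuity_pt_filterlim.
    destruct (Req_dec t 0) as [->|N]; [exact C|].
    apply (ex_derive_continuous (V := R_NormedModule)). exists 0. apply D; lra.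
  - lra.
Qed.

Lemma locally_lt_continuous {U : UniformSpace} (f g : U -> R) p :
  continuous f p -> continuous g p -> f p < g p -> locally p (fun q => f q < g q).
Proof.
  intros Hf Hg H.
  assert (C : continuous (fun q => g q - f q) p) by cont.
  assert (L : locally (g p - f p) (fun z => 0 < z)) by (apply (open_gt 0); lra).
  generalize (C _ L). unfold filtermap. apply filter_imp. intros q Hq; lra.
Qed.

Lemma in_ball_sq Rr a b c : 0 < Rr -> a ^ 2 + b ^ 2 + c ^ 2 < Rr ^ 2 -> in_ball Rr (a, b, c).
Proof.
  intros HR H. unfold in_ball, norm3. rewrite <- (sqrt_pow2 Rr) by lra.
  apply sqrt_lt_1; [|apply pow2_ge_0|exact H].
  generalize (pow2_ge_0 a) (pow2_ge_0 b) (pow2_ge_0 c); lra.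
Qed.

Definition sdot (x : nat -> R) t1 t2 : R := x 0%nat * om 0 t1 t2 + x 1%nat * om 1 t1 t2 + x 2%nat * om 2 t1 t2.

Lemma sdot_bound x t1 t2 : Rabs (sdot x t1 t2) <= sqrt (dot x x).
Proof.
  rewrite <- sqrt_Rsqr_abs. apply sqrt_le_1_alt. unfold Rsqr, sdot, dot.
  generalize (om_sphere t1 t2). generalize (om 0 t1 t2) (om 1 t1 t2) (om 2 t1 t2). intros p q w E.
  generalize (x 0%nat) (x 1%nat) (x 2%nat). intros a b c.
  apply Rle_trans with ((a * a + b * b + c * c) * (p ^ 2 + q ^ 2 + w ^ 2)); [|rewrite E; lra].
  generalize (pow2_ge_0 (a * q - b * p)) (pow2_ge_0 (a * w - c * p)) (pow2_ge_0 (b * w - c * q)). nra.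
Qed.

Lemma sdot_cont x : cont2 (sdot x).
Proof. intros a b. unfold sdot. cont; apply om_cont. Qed.

Definition sphpt (s t1 t2 : R) : pt := (s * om 0 t1 t2, s * om 1 t1 t2, s * om 2 t1 t2).

(** The Jacobian is carried as data; its symmetry says that the curl vanishes. *)
Definition riesz (Rr : R) (v : nat -> pt -> R) (dv : nat -> nat -> pt -> R) : Prop :=
  (forall z i, in_ball Rr z -> hgrad (v i) z (fun j => dv i j z)) /\
  (forall z i, in_ball Rr z -> continuous (v i) z) /\
  (forall z i j, in_ball Rr z -> continuous (dv i j) z) /\
  (forall z i j, in_ball Rr z -> dv i j z = dv j i z) /\
  (forall z, in_ball Rr z -> dv 0%nat 0%nat z + dv 1%nat 1%nat z + dv 2%nat 2%nat z = 0).

Lemma sphere_in_ball Rr s t1 t2 : 0 < s < Rr -> in_ball Rr (sphpt s t1 t2).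
Proof.
  intros Hs. unfold sphpt. apply in_ball_sq; [lra|].
  generalize (om_sphere t1 t2); intros E.
  replace ((s * om 0 t1 t2) ^ 2 + (s * om 1 t1 t2) ^ 2 + (s * om 2 t1 t2) ^ 2) with
    (s ^ 2 * (om 0 t1 t2 ^ 2 + om 1 t1 t2 ^ 2 + om 2 t1 t2 ^ 2)) by ring.
  rewrite E. nra.
Qed.

Lemma dom_cont2 (dom : pt -> Prop) (f : pt -> R) (P : R -> R -> pt) :
  (forall t1 t2, dom (P t1 t2)) -> (forall z, dom z -> continuous f z) ->
  (forall t1 t2, continuous (fun q : R * R => P (fst q) (snd q)) (t1, t2)) ->
  cont2 (fun t1 t2 => f (P t1 t2)).
Proof.
  intros Hd Hf HP t1 t2.
  apply (continuous_comp (fun q : R * R => P (fst q) (snd q)) f); [apply HP|apply Hf, Hd].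
Qed.

Section Poisson.
Variables (Rr s : R) (v : nat -> pt -> R) (dv : nat -> nat -> pt -> R) (x : nat -> R).
Hypothesis Hr : riesz Rr v dv.
Hypothesis Hs : 0 < s < Rr.
Hypothesis Hx : dot x x < s ^ 2.
Variable k : nat.
Hypothesis Hk : (k <= 2)%nat.

Let r2 := dot x x.
Let r := sqrt r2.
Let X : pt := (x 0%nat, x 1%nat, x 2%nat).

Let r2_ge : 0 <= r2.
Proof. unfold r2, dot. generalize (Rle_0_sqr (x 0%nat)) (Rle_0_sqr (x 1%nat)) (Rle_0_sqr (x 2%nat)). unfold Rsqr. lra. Qed.
Let r_ge : 0 <= r. Proof. apply sqrt_pos. Qed.
Let r_sq : r * r = r2. Proof. apply sqrt_sqrt, r2_ge. Qed.
Let r_lt : r < s.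
Proof.
  unfold r. rewrite <- (sqrt_pow2 s) by lra. apply sqrt_lt_1; [apply r2_ge|apply pow2_ge_0|exact Hx].
Qed.
Let xo t1 t2 : - r <= sdot x t1 t2 <= r.
Proof. apply Rabs_le_between, sdot_bound. Qed.

(** The squared distance from the sphere point s omega to x. *)
Definition pD t1 t2 := s ^ 2 - 2 * s * sdot x t1 t2 + dot x x.

Let pD_pos t1 t2 : 0 < pD t1 t2.
Proof. unfold pD. fold r2. rewrite <- r_sq. generalize (xo t1 t2). nra. Qed.

(* Three ways of moving a sphere: shrinking the sphere of radius s onto x, shrinking it
   onto 0, and translating it from centre 0 to centre - x. *)
Local Notation toward := (flowP 0 s x (fun i => - x i)).
Local Notation dilate := (flowP 0 s (fun _ => 0) (fun _ => 0)).
Local Notation shift := (flowP s 0 (fun _ => 0) (fun i => - x i)).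

(** The triangle inequality for lam s omega + (1 - lam) x. Absolute values admit parameters slightly
    outside [0, 1], as derivatives at the ends require. *)
Let flow_in_ball lam t1 t2 : Rabs lam * s + Rabs (1 - lam) * r < Rr ->
  in_ball Rr (toward lam t1 t2).
Proof.
  intros H. unfold flowP, flowY, flowA. apply in_ball_sq; [lra|].
  generalize (om_sphere t1 t2) (xo t1 t2); intros E K. unfold sdot in K.
  set (w := x 0%nat * om 0 t1 t2 + x 1%nat * om 1 t1 t2 + x 2%nat * om 2 t1 t2) in *.
  apply Rle_lt_trans with (lam ^ 2 * s ^ 2 + 2 * lam * (1 - lam) * s * w + (1 - lam) ^ 2 * r2).
  - right. replace (lam ^ 2 * s ^ 2) with (lam ^ 2 * s ^ 2 * (om 0 t1 t2 ^ 2 + om 1 t1 t2 ^ 2 + om 2 t1 t2 ^ 2))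
      by (rewrite E; ring).
    unfold r2, dot, w. ring.
  - apply Rle_lt_trans with ((Rabs lam * s + Rabs (1 - lam) * r) ^ 2).
    + rewrite <- r_sq.
      replace ((Rabs lam * s + Rabs (1 - lam) * r) ^ 2) with
       ((Rabs lam) ^ 2 * s ^ 2 + 2 * (Rabs lam * Rabs (1 - lam)) * s * r + (Rabs (1 - lam)) ^ 2 * (r * r)) by ring.
      rewrite !pow2_abs, <- Rabs_mult.
      assert (lam * (1 - lam) * w <= Rabs (lam * (1 - lam)) * r).
      { apply Rle_trans with (1 := Rle_abs _). rewrite Rabs_mult.
        apply Rmult_le_compat_l; [apply Rabs_pos|]. apply Rabs_le. exact K. }
      nra.
    + assert (0 <= Rabs lam * s) by (apply Rmult_le_pos; [apply Rabs_pos|lra]).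
      assert (0 <= Rabs (1 - lam) * r) by (apply Rmult_le_pos; [apply Rabs_pos|exact r_ge]).
      nra.
Qed.

Let flow_open lam : 0 <= lam <= 1 -> locally lam (fun l => Rabs l * s + Rabs (1 - l) * r < Rr).
Proof.
  intros Hl. apply (locally_lt_continuous (fun l : R => Rabs l * s + Rabs (1 - l) * r) (fun _ => Rr)).
  - cont.
  - cont.
  - cbv beta. rewrite !Rabs_right by lra. nra.
Qed.

(** On the sphere of radius s the Newton field of x and the field of its image have the same
    denominator |s omega - x|^3, so both are given by this formula, with [al] equal to 1 and to
    |x|^2 / s^2. *)
Let U (al : R) (n : nat) t1 t2 : R := (al * (s * om n t1 t2) - x n) / (pD t1 t2 * sqrt (pD t1 t2)).

Let pD_cont : cont2 pD.
Proof. intros a b. unfold pD. cont. apply sdot_cont. Qed.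

Let sqrt_pD_pos t1 t2 : 0 < sqrt (pD t1 t2).
Proof. apply sqrt_lt_R0, pD_pos. Qed.

Let U_cont al n : cont2 (U al n).
Proof.
  intros a b. unfold U. cont.
  - apply om_cont.
  - simpl. apply Rgt_not_eq, Rmult_lt_0_compat; auto.
Qed.

(** The flux density omega . (row k of the tensor of w and U) through the sphere. *)
Let fstress (w : nat -> R) al t1 t2 : R :=
  om 0 t1 t2 * stress k w (fun n => U al n t1 t2) 0
  + om 1 t1 t2 * stress k w (fun n => U al n t1 t2) 1
  + om 2 t1 t2 * stress k w (fun n => U al n t1 t2) 2.

Let stress_cont2 (w : nat -> R -> R -> R) al : (forall n, cont2 (w n)) ->
  cont2 (fun t1 t2 => fstress (fun n => w n t1 t2) al t1 t2).
Proof.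
  intros Hw a b. unfold fstress, stress, dot.
  assert (forall n, continuous (fun q : R * R => U al n (fst q) (snd q)) (a, b)) by (intros; apply U_cont).
  assert (forall n, continuous (fun q : R * R => om n (fst q) (snd q)) (a, b)) by (intros; apply om_cont).
  assert (forall n, continuous (fun q : R * R => w n (fst q) (snd q)) (a, b)) by (intros; apply Hw).
  cont; auto.
Qed.

Let vflow lam t1 t2 n := v n (toward lam t1 t2).

(** The flux stays constant while the sphere of radius s shrinks onto x; in the limit v is frozen at
    its value in x. *)
Let step1 : SI (fun t1 t2 => fstress (fun n => v n (sphpt s t1 t2)) 1 t1 t2)
   = SI (fun t1 t2 => fstress (fun n => v n X) 1 t1 t2).
Proof.
  destruct Hr as [Hg [Cv [Cd [Sy Tr]]]].
  (* The factor lam^2 of the area cancels the factor lam^(-2) of the Newton field, so the flux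
     written in this form extends continuously to [lam = 0]. *)
  pose (g := fun lam => s ^ 2 * SI (fun t1 t2 => fstress (vflow lam t1 t2) 1 t1 t2)).
  assert (Cw : forall l, Rabs l * s + Rabs (1 - l) * r < Rr ->
     cont2 (fun t1 t2 => fstress (vflow l t1 t2) 1 t1 t2)).
  { intros l Hl. apply (stress_cont2 (fun n t1 t2 => vflow l t1 t2 n)). intros n.
    unfold vflow. apply (dom_cont2 (in_ball Rr) (v n)).
    - intros t1 t2. apply flow_in_ball, Hl.
    - intros z Hz. apply Cv, Hz.
    - intros t1 t2. unfold flowP, flowY, flowA, om. cont. }
  assert (Kq : forall lam t1 t2, kq x 1 r2 (toward lam t1 t2) = lam ^ 2 * pD t1 t2).
  { intros lam t1 t2. unfold kq, pD, sdot, r2, dot, flowP, flowY, flowA; cbn [co fst snd].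
    replace (s ^ 2) with (s ^ 2 * (om 0 t1 t2 ^ 2 + om 1 t1 t2 ^ 2 + om 2 t1 t2 ^ 2)) by (rewrite om_sphere; ring).
    ring. }
  assert (E : g 1 = g 0).
  { apply zero_derive_const.
    - unfold g. apply cR_mult; [cont|].
      apply SI_continuous.
      + intros t1 t2. 
        assert (forall n, continuous (fun q : R * R * R => vflow (fst (fst q)) (snd (fst q)) (snd q) n) (0, t1, t2)).
        { intros n. unfold vflow.
          apply (continuous_comp (fun q : R * R * R => toward (fst (fst q)) (snd (fst q)) (snd q)) (v n)).
          - apply flowP_cont.
          - apply Cv, flow_in_ball. simpl. rewrite Rabs_R0, Rabs_right; lra. }
        assert (forall n, continuous (fun q : R * R * R => U 1 n (snd (fst q)) (snd q)) (0, t1, t2)).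
        { intros n. apply cont2_comp; [apply U_cont|cont|cont]. }
        assert (forall n, continuous (fun q : R * R * R => om n (snd (fst q)) (snd q)) (0, t1, t2)).
        { intros n. apply cont2_comp; [apply om_cont|cont|cont]. }
        unfold fstress, stress, dot. cont; auto.
      + generalize (flow_open 0 ltac:(lra)). apply filter_imp. intros l Hl. apply Cw, Hl.
    - intros lam Hl.
      apply (is_derive_ext_loc (flux (sPsi v x 1 r2 k) 0 s x (fun i => - x i))).
      + assert (L : locally lam (fun l => 0 < l)) by (apply (open_gt 0); lra).
        generalize (filter_and _ _ L (flow_open lam ltac:(lra))). apply filter_imp.
        intros l [Pl Hl'].
        unfold flux, g. rewrite <- (SI_scal (s ^ 2)) by (apply Cw; exact Hl').
        rewrite <- (SI_scal (flowA 0 s l ^ 2)).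
        * apply SI_ext. intros t1 t2.
          assert (KU : forall n, (n <= 2)%nat -> ku x 1 r2 n (toward l t1 t2) = / l ^ 2 * U 1 n t1 t2).
          { intros n Hn. unfold ku, kk, U. rewrite Kq, sqrt_mult, sqrt_pow2 by (try apply pow2_ge_0; auto with real; left; auto).
            replace (1 * co n (toward l t1 t2) - x n) with (l * (1 * (s * om n t1 t2) - x n)).
            - field. repeat split; try lra; apply Rgt_not_eq; (apply sqrt_pD_pos || apply pD_pos || lra).
            - destruct n as [|[|[|n]]]; [| | |lia]; unfold flowP, flowY, flowA; simpl; ring. }
          unfold sPsi, fstress, stress, dot, vflow, flowA.
          destruct k as [|[|[|kk]]]; [| | |lia]; rewrite !KU by lia; field; lra.
        * intros t1 t2.
          assert (Hd : forall t1 t2, sdom (in_ball Rr) x 1 r2 (toward l t1 t2)).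
          { intros u1 u2. split; [apply flow_in_ball, Hl'|]. rewrite Kq. apply Rmult_lt_0_compat; [apply pow_lt; lra|auto]. }
          assert (CC : forall i, continuous (fun q : R * R => sPsi v x 1 r2 k i (toward l (fst q) (snd q))) (t1, t2)).
          { intros i. apply (continuous_comp (fun q : R * R => toward l (fst q) (snd q)) (sPsi v x 1 r2 k i)).
            - unfold flowP, flowY, flowA, om. cont.
            - apply (sPsi_cont v (in_ball Rr)); auto. }
          cont; match goal with
            | |- continuous (fun q => om _ _ _) _ => apply om_cont
            | _ => apply CC
            end.
      + apply (stress_flux_derive v dv (in_ball Rr) Hg Cv Cd Sy Tr x 1 r2 ltac:(unfold r2; ring) k Hk).
        assert (L : locally lam (fun l => 0 < l)) by (apply (open_gt 0); lra).
        generalize (filter_and _ _ L (flow_open lam ltac:(lra))). apply filter_imp.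
        intros l [Pl Hl'] u1 u2. split; [apply flow_in_ball, Hl'|]. rewrite Kq. apply Rmult_lt_0_compat; [apply pow_lt; lra|auto]. }
  unfold g in E. apply Rmult_eq_reg_l in E; [|apply pow_nonzero; lra].
  transitivity (SI (fun t1 t2 => fstress (vflow 1 t1 t2) 1 t1 t2)).
  - apply SI_ext. intros t1 t2. unfold vflow, flowP, flowY, flowA, sphpt.
    f_equal. extensionality n. f_equal. f_equal; [f_equal|]; ring.
  - rewrite E. apply SI_ext. intros t1 t2. unfold vflow, flowP, flowY, flowA, X.
    f_equal. extensionality n. f_equal. f_equal; [f_equal|]; ring.
Qed.

Let al2 := r2 / s ^ 2.

(** The image of x lies outside the closed ball of radius s, so its field is regular inside.
    Shrinking the sphere to the point 0 makes the flux vanish with the area. *)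
Let step2 : SI (fun t1 t2 => fstress (fun n => v n (sphpt s t1 t2)) al2 t1 t2) = 0.
Proof.
  destruct Hr as [Hg [Cv [Cd [Sy Tr]]]].
  assert (Kq : forall lam t1 t2, kq x al2 (s ^ 2) (dilate lam t1 t2)
     = lam ^ 2 * r2 - 2 * lam * s * sdot x t1 t2 + s ^ 2).
  { intros lam t1 t2. unfold kq, sdot, dot, flowP, flowY, flowA; cbn [co fst snd].
    transitivity (al2 * (lam ^ 2 * (s ^ 2 * (om 0 t1 t2 ^ 2 + om 1 t1 t2 ^ 2 + om 2 t1 t2 ^ 2)))
      - 2 * lam * s * (x 0%nat * om 0 t1 t2 + x 1%nat * om 1 t1 t2 + x 2%nat * om 2 t1 t2) + s ^ 2); [ring|].
    rewrite om_sphere. unfold al2. field. lra. }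
  assert (Kp : forall lam t1 t2, Rabs lam * r < s -> 0 < lam ^ 2 * r2 - 2 * lam * s * sdot x t1 t2 + s ^ 2).
  { intros lam t1 t2 Hl. apply Rlt_le_trans with ((s - Rabs lam * r) ^ 2); [apply pow_lt; lra|].
    assert (lam * sdot x t1 t2 <= Rabs lam * r).
    { apply Rle_trans with (1 := Rle_abs _). rewrite Rabs_mult.
      apply Rmult_le_compat_l; [apply Rabs_pos|]. apply Rabs_le, xo. }
    rewrite <- (pow2_abs lam), <- r_sq. nra. }
  assert (Dm : forall lam, Rabs lam * r < s -> Rabs lam * s < Rr ->
     forall t1 t2, sdom (in_ball Rr) x al2 (s ^ 2) (dilate lam t1 t2)).
  { intros lam H1 H2 t1 t2. split.
    - unfold flowP, flowY, flowA. apply in_ball_sq; [lra|].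
      apply Rle_lt_trans with ((Rabs lam * s) ^ 2).
      + right. rewrite Rpow_mult_distr, pow2_abs.
        transitivity (lam ^ 2 * s ^ 2 * (om 0 t1 t2 ^ 2 + om 1 t1 t2 ^ 2 + om 2 t1 t2 ^ 2)); [ring|].
        rewrite om_sphere. ring.
      + assert (0 <= Rabs lam * s) by (apply Rmult_le_pos; [apply Rabs_pos|lra]). nra.
    - rewrite Kq. apply Kp, H1. }
  assert (D : forall lam, 0 <= lam <= 1 ->
     is_derive (flux (sPsi v x al2 (s ^ 2) k) 0 s (fun _ => 0) (fun _ => 0)) lam 0).
  { intros lam Hl.
    apply (stress_flux_derive v dv (in_ball Rr) Hg Cv Cd Sy Tr x al2 (s ^ 2)); [|exact Hk|].
    - unfold al2, r2. field. lra.
    - assert (L1 : locally lam (fun l : R => Rabs l * r < s)).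
      { apply (locally_lt_continuous (fun l : R => Rabs l * r) (fun _ => s)); [cont|cont|].
        cbv beta. rewrite Rabs_right by lra. nra. }
      assert (L2 : locally lam (fun l : R => Rabs l * s < Rr)).
      { apply (locally_lt_continuous (fun l : R => Rabs l * s) (fun _ => Rr)); [cont|cont|].
        cbv beta. rewrite Rabs_right by lra. nra. }
      generalize (filter_and _ _ L1 L2). apply filter_imp. intros l [H1 H2]. apply Dm; assumption. }
  assert (E : flux (sPsi v x al2 (s ^ 2) k) 0 s (fun _ => 0) (fun _ => 0) 1 =
     flux (sPsi v x al2 (s ^ 2) k) 0 s (fun _ => 0) (fun _ => 0) 0).
  { apply zero_derive_const.
    - apply (ex_derive_continuous (V := R_NormedModule)). exists 0. apply D; lra.
    - intros t Ht. apply D; lra. }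
  unfold flux at 2 in E. unfold flowA at 1 in E.
  replace ((0 + s * 0) ^ 2) with 0 in E by ring. rewrite Rmult_0_l in E.
  unfold flux, flowA at 1 in E. apply Rmult_integral in E. destruct E as [E|E].
  - exfalso. revert E. apply pow_nonzero. lra.
  - rewrite <- E. apply SI_ext. intros t1 t2.
    assert (EP : dilate 1 t1 t2 = sphpt s t1 t2).
    { unfold flowP, flowY, flowA, sphpt. f_equal; [f_equal|]; ring. }
    rewrite EP.
    assert (KU : forall n, (n <= 2)%nat -> U al2 n t1 t2 = ku x al2 (s ^ 2) n (sphpt s t1 t2)).
    { intros n Hn. unfold ku, kk, U. rewrite <- EP, Kq.
      replace (1 ^ 2 * r2 - 2 * 1 * s * sdot x t1 t2 + s ^ 2) with (pD t1 t2) by (unfold pD, r2; ring).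
      rewrite EP. unfold sphpt, Rdiv. destruct n as [|[|[|n]]]; [| | |lia]; cbn [co fst snd]; reflexivity. }
    unfold sPsi, fstress, stress, dot.
    destruct k as [|[|[|kk]]]; [| | |lia]; rewrite !KU by lia; reflexivity.
Qed.

(** For a constant field w the Newton field of x may be recentred: its flux through the sphere about
    0 is that of the Newton field of 0 through the sphere about -x, and moving the centre back to 0
    does not change it. There u = omega / s^2 and the density is the constant w_k / s^2. *)
Let step3 : SI (fun t1 t2 => fstress (fun n => v n X) 1 t1 t2) = 4 * PI * v k X / s ^ 2.
Proof.
  pose (w := fun (n : nat) (_ : pt) => v n X).
  pose (dw := fun (i j : nat) (_ : pt) => 0).
  pose (F := flux (sPsi w (fun _ => 0) 1 0 k) s 0 (fun _ => 0) (fun i => - x i)).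
  assert (Kq : forall mu t1 t2, kq (fun _ => 0) 1 0 (shift mu t1 t2)
     = s ^ 2 - 2 * mu * s * sdot x t1 t2 + mu ^ 2 * r2).
  { intros mu t1 t2. unfold kq, sdot, r2, dot, flowP, flowY, flowA; cbn [co fst snd].
    replace (s ^ 2) with (s ^ 2 * (om 0 t1 t2 ^ 2 + om 1 t1 t2 ^ 2 + om 2 t1 t2 ^ 2)) by (rewrite om_sphere; ring).
    ring. }
  assert (Dm : forall mu, Rabs mu * r < s ->
     forall t1 t2, sdom (fun _ => True) (fun _ => 0) 1 0 (shift mu t1 t2)).
  { intros mu Hl t1 t2. split; [exact I|]. rewrite Kq.
    apply Rlt_le_trans with ((s - Rabs mu * r) ^ 2); [apply pow_lt; lra|].
    assert (mu * sdot x t1 t2 <= Rabs mu * r).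
    { apply Rle_trans with (1 := Rle_abs _). rewrite Rabs_mult.
      apply Rmult_le_compat_l; [apply Rabs_pos|]. apply Rabs_le, xo. }
    rewrite <- (pow2_abs mu), <- r_sq. nra. }
  assert (D : forall mu, 0 <= mu <= 1 -> is_derive F mu 0).
  { intros mu Hl.
    apply (stress_flux_derive w dw (fun _ => True)).
    - intros z i _. apply hgrad_const.
    - intros z i _. apply continuous_const.
    - intros z i j _. apply continuous_const.
    - reflexivity.
    - intros z _. unfold dw. ring.
    - unfold dot. ring.
    - exact Hk.
    - assert (L1 : locally mu (fun l : R => Rabs l * r < s)).
      { apply (locally_lt_continuous (fun l : R => Rabs l * r) (fun _ => s)); [cont|cont|].
        cbv beta. rewrite Rabs_right by lra. nra. }
      revert L1. apply filter_imp. intros l H1. apply Dm; assumption. }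
  assert (E : F 1 = F 0).
  { apply zero_derive_const.
    - apply (ex_derive_continuous (V := R_NormedModule)). exists 0. apply D; lra.
    - intros t Ht. apply D; lra. }
  assert (E1 : F 1 = s ^ 2 * SI (fun t1 t2 => fstress (fun n => v n X) 1 t1 t2)).
  { unfold F, flux, flowA at 1. replace (s + 0 * 1) with s by ring. f_equal.
    apply SI_ext. intros t1 t2.
    assert (KU : forall n, (n <= 2)%nat -> ku (fun _ => 0) 1 0 n (shift 1 t1 t2) = U 1 n t1 t2).
    { intros n Hn. unfold ku, kk, U. rewrite Kq.
      replace (s ^ 2 - 2 * 1 * s * sdot x t1 t2 + 1 ^ 2 * r2) with (pD t1 t2) by (unfold pD, r2; ring).
      unfold Rdiv. f_equal.
      unfold flowP, flowY, flowA. destruct n as [|[|[|n]]]; [| | |lia]; cbn [co fst snd]; ring. }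
    unfold sPsi, fstress, stress, dot.
    destruct k as [|[|[|kk]]]; [| | |lia]; rewrite !KU by lia; reflexivity. }
  assert (E0 : F 0 = 4 * PI * v k X).
  { unfold F, flux, flowA at 1. replace (s + 0 * 0) with s by ring.
    rewrite (SI_ext _ (fun t1 t2 => v k X / s ^ 2)).
    - rewrite SI_const. field. lra.
    - intros t1 t2.
      assert (KU : forall n, (n <= 2)%nat -> ku (fun _ => 0) 1 0 n (shift 0 t1 t2) = om n t1 t2 / s ^ 2).
      { intros n Hn. unfold ku, kk. rewrite Kq.
        replace (s ^ 2 - 2 * 0 * s * sdot x t1 t2 + 0 ^ 2 * r2) with (s ^ 2) by ring.
        rewrite sqrt_pow2 by lra.
        unfold flowP, flowY, flowA. destruct n as [|[|[|n]]]; [| | |lia]; cbn [co fst snd]; field; lra. }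
      unfold sPsi, stress, dot, w, delta.
      transitivity (v k X / s ^ 2 * (om 0 t1 t2 ^ 2 + om 1 t1 t2 ^ 2 + om 2 t1 t2 ^ 2)).
      + destruct k as [|[|[|kk]]]; [| | |lia]; rewrite !KU by lia; cbn [Nat.eqb]; field; lra.
      + rewrite om_sphere. ring. }
  rewrite E1, E0 in E. apply (Rmult_eq_reg_l (s ^ 2)); [|apply pow_nonzero; lra].
  rewrite E. field. lra.
Qed.

(** The two fields differ on the sphere by s (1 - |x|^2/s^2) omega / |s omega - x|^3. This
    difference is normal, and for a normal u the flux density of row k reduces to v_k <omega, u>:
    the other components of v drop out. *)
Theorem poisson_formula :
  SI (fun t1 t2 => v k (sphpt s t1 t2) * (s * (s ^ 2 - dot x x) / (pD t1 t2 * sqrt (pD t1 t2))))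
  = 4 * PI * v k (x 0%nat, x 1%nat, x 2%nat).
Proof.
  assert (Cs : forall n, cont2 (fun t1 t2 => v n (sphpt s t1 t2))).
  { destruct Hr as [_ [Cv _]]. intros n.
    apply (dom_cont2 (in_ball Rr) (v n)).
    - intros t1 t2. apply sphere_in_ball, Hs.
    - intros z Hz. apply Cv, Hz.
    - intros t1 t2. unfold sphpt, om. cont. }
  fold X. replace (4 * PI * v k X) with (s ^ 2 * (4 * PI * v k X / s ^ 2)) by (field; lra).
  rewrite <- step3, <- step1.
  rewrite <- (Rminus_0_r (SI (fun t1 t2 => fstress (fun n => v n (sphpt s t1 t2)) 1 t1 t2))), <- step2.
  rewrite <- SI_minus, <- SI_scal.
  - apply SI_ext. intros t1 t2. unfold fstress, stress, U. fold r2.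
    generalize (pD_pos t1 t2) (sqrt_pD_pos t1 t2). intros P1 P2.
    set (Q := / (pD t1 t2 * sqrt (pD t1 t2))). unfold Rdiv. fold Q.
    transitivity (v k (sphpt s t1 t2) * (s ^ 3 * (1 - al2) * Q)
       * (om 0 t1 t2 ^ 2 + om 1 t1 t2 ^ 2 + om 2 t1 t2 ^ 2)).
    + rewrite om_sphere. unfold al2. field. lra.
    + unfold delta, dot. destruct k as [|[|[|kk]]]; [| | |lia]; cbn [Nat.eqb]; ring.
  - apply cont2_minus; apply (stress_cont2 (fun n t1 t2 => v n (sphpt s t1 t2))); assumption.
  - apply (stress_cont2 (fun n t1 t2 => v n (sphpt s t1 t2))); assumption.
  - apply (stress_cont2 (fun n t1 t2 => v n (sphpt s t1 t2))); assumption.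
Qed.
End Poisson.

(** * Legendre polynomials *)

(** Bonnet's three-term recurrence, run on the pair of consecutive Legendre polynomials. *)
Fixpoint leg2 (n : nat) (c : R) : R * R :=
  match n with
  | O => (1, c)
  | S m => let '(a, b) := leg2 m c in
     (b, ((2 * INR m + 3) * c * b - (INR m + 1) * a) / (INR m + 2))
  end.
Definition leg n c := fst (leg2 n c).

(** From P'_(m+1) = c P'_m + (m+1) P_m; [leg_derive] confirms that this is the derivative. *)
Fixpoint dleg (n : nat) (c : R) : R :=
  match n with O => 0 | S m => c * dleg m c + (INR m + 1) * leg m c end.
Fixpoint ddleg (n : nat) (c : R) : R :=
  match n with O => 0 | S m => dleg m c + c * ddleg m c + (INR m + 1) * dleg m c end.

Lemma leg2_eq n c : leg2 n c = (leg n c, leg (S n) c).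
Proof. unfold leg. simpl. destruct (leg2 n c); reflexivity. Qed.

Lemma leg_0 c : leg 0 c = 1. Proof. reflexivity. Qed.
Lemma leg_1 c : leg 1 c = c. Proof. reflexivity. Qed.
Lemma leg_SS n c : leg (S (S n)) c =
  ((2 * INR n + 3) * c * leg (S n) c - (INR n + 1) * leg n c) / (INR n + 2).
Proof. unfold leg at 1. simpl. rewrite leg2_eq. reflexivity. Qed.

Lemma INR2_pos n : 0 < INR n + 2.
Proof. generalize (pos_INR n); lra. Qed.

Lemma leg_rec n c : (INR n + 2) * leg (S (S n)) c =
  (2 * INR n + 3) * c * leg (S n) c - (INR n + 1) * leg n c.
Proof. rewrite leg_SS. field. generalize (INR2_pos n); lra. Qed.

Lemma dleg_S n c : dleg (S n) c = c * dleg n c + (INR n + 1) * leg n c.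
Proof. reflexivity. Qed.

Lemma dleg_down n c : c * dleg (S n) c = dleg n c + (INR n + 1) * leg (S n) c.
Proof.
  induction n as [|n IH].
  - simpl. rewrite leg_0, leg_1. ring.
  - rewrite (dleg_S (S n)). rewrite Rmult_plus_distr_l, IH, !S_INR.
    replace (INR n + 1 + 1) with (INR n + 2) by ring.
    rewrite leg_rec, (dleg_S n). ring.
Qed.

Lemma leg_derive_pair n c : is_derive (leg n) c (dleg n c) /\ is_derive (leg (S n)) c (dleg (S n) c).
Proof.
  induction n as [|n [IH1 IH2]].
  - split.
    + apply (is_derive_ext (fun _ => 1)); [reflexivity|apply dR_const].
    + apply (is_derive_ext (fun t => t)); [reflexivity|].
      eapply is_derive_val; [apply dR_id|]. simpl. rewrite leg_0. ring.
  - split; [exact IH2|].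
    apply (is_derive_ext (fun t => / (INR n + 2) * ((2 * INR n + 3) * (t * leg (S n) t) - (INR n + 1) * leg n t))).
    { intros t. toR. rewrite leg_SS. field. generalize (INR2_pos n); lra. }
    eapply is_derive_val.
    + apply dR_scal, dR_minus; apply dR_scal; [apply dR_mult; [apply dR_id|exact IH2]|exact IH1].
    + generalize (dleg_down n c). rewrite (dleg_S (S n)), S_INR. intros E.
      apply (Rmult_eq_reg_l (INR n + 2)); [|generalize (INR2_pos n); lra].
      rewrite <- Rmult_assoc, Rinv_r, Rmult_1_l by (generalize (INR2_pos n); lra).
      transitivity ((2 * INR n + 3) * leg (S n) c + (INR n + 2) * (c * dleg (S n) c)
        + (INR n + 1) * (c * dleg (S n) c - dleg n c)); [ring|].
      rewrite E. ring.
Qed.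

Lemma leg_derive n c : is_derive (leg n) c (dleg n c).
Proof. apply leg_derive_pair. Qed.

Lemma leg_cont n c : continuous (leg n) c.
Proof. apply (ex_derive_continuous (V := R_NormedModule)). exists (dleg n c). apply leg_derive. Qed.

Lemma dleg_derive n c : is_derive (dleg n) c (ddleg n c).
Proof.
  induction n as [|n IH].
  - apply (is_derive_ext (fun _ => 0)); [reflexivity|apply dR_const].
  - apply (is_derive_ext (fun t => t * dleg n t + (INR n + 1) * leg n t)); [reflexivity|].
    eapply is_derive_val.
    + apply dR_plus; [apply dR_mult; [apply dR_id|exact IH]|apply dR_scal, leg_derive].
    + simpl. ring.
Qed.

Lemma dleg_cont n c : continuous (dleg n) c.
Proof. apply (ex_derive_continuous (V := R_NormedModule)). exists (ddleg n c). apply dleg_derive. Qed.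

Lemma leg_up n c : (1 - c ^ 2) * dleg (S n) c = (INR n + 1) * (leg n c - c * leg (S n) c).
Proof.
  generalize (dleg_down n c) (dleg_S n c). intros E1 E2.
  transitivity (dleg (S n) c - c * (c * dleg (S n) c)); [ring|]. rewrite E1, E2. ring.
Qed.

(** Legendre's equation, obtained by differentiating both sides of [leg_up]. *)
Lemma leg_ode n c : (1 - c ^ 2) * ddleg n c - 2 * c * dleg n c = - INR n * (INR n + 1) * leg n c.
Proof.
  destruct n as [|n]; [simpl; ring|].
  assert (D1 : is_derive (fun t => (1 - t ^ 2) * dleg (S n) t) c
    (- 2 * c * dleg (S n) c + (1 - c ^ 2) * ddleg (S n) c)).
  { apply (dR_mult (fun t => 1 - t ^ 2) (dleg (S n)) c (- 2 * c)); [|apply dleg_derive].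
    auto_derive; [trivial|ring]. }
  assert (D2 : is_derive (fun t => (1 - t ^ 2) * dleg (S n) t) c
    ((INR n + 1) * (dleg n c - (1 * leg (S n) c + c * dleg (S n) c)))).
  { apply (is_derive_ext (fun t => (INR n + 1) * (leg n t - t * leg (S n) t))).
    - intros t. toR. rewrite leg_up. reflexivity.
    - apply dR_scal, dR_minus; [apply leg_derive|].
      apply (dR_mult (fun t => t) (leg (S n))); [apply dR_id|apply leg_derive]. }
  generalize (is_derive_unique _ _ _ D1) (is_derive_unique _ _ _ D2). intros U1 U2.
  rewrite U1 in U2. rewrite dleg_down, S_INR in *. lra.
Qed.

Lemma leg_at_1 n : leg n 1 = 1 /\ leg (S n) 1 = 1.
Proof.
  induction n as [|n [A1 A2]]; [split; reflexivity|]. split; [exact A2|].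
  rewrite leg_SS, A1, A2. field. generalize (INR2_pos n); lra.
Qed.
Lemma leg_at_m1 n : leg n (-1) = (-1) ^ n /\ leg (S n) (-1) = (-1) ^ (S n).
Proof.
  induction n as [|n [A1 A2]]; [split; [reflexivity|rewrite leg_1; simpl; ring]|]. split; [exact A2|].
  rewrite leg_SS, A1, A2. simpl. field. generalize (INR2_pos n); lra.
Qed.

Definition sonin n c := INR n * (INR n + 1) * leg n c ^ 2 + (1 - c ^ 2) * dleg n c ^ 2.

Lemma sonin_derive n c : is_derive (sonin n) c (2 * c * dleg n c ^ 2).
Proof.
  assert (Sq : forall w : R, is_derive (fun w => w ^ 2) w (2 * w)) by (intros; auto_derive; [trivial|ring]).
  unfold sonin. apply (is_derive_val (fun t => INR n * (INR n + 1) * leg n t ^ 2 + (1 - t ^ 2) * dleg n t ^ 2) c (INR n * (INR n + 1) * (dleg n c * (2 * leg n c)) + ((- 2 * c) * dleg n c ^ 2 + (1 - c ^ 2) * (ddleg n c * (2 * dleg n c))))).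
  - apply dR_plus.
    + apply (dR_scal (INR n * (INR n + 1)) (fun t => leg n t ^ 2)). apply (dR_comp (fun w => w ^ 2) (leg n) c (dleg n c) (2 * leg n c)); [apply Sq|apply leg_derive].
    + apply (dR_mult (fun t => 1 - t ^ 2) (fun t => dleg n t ^ 2) c (- 2 * c) (ddleg n c * (2 * dleg n c))).
      * auto_derive; [trivial|ring].
      * apply (dR_comp (fun w => w ^ 2) (dleg n)); [apply Sq|apply dleg_derive].
  - generalize (leg_ode n c). intros E.
    transitivity (2 * dleg n c * (INR n * (INR n + 1) * leg n c + (1 - c ^ 2) * ddleg n c - c * dleg n c)); [simpl; ring|].
    replace ((1 - c ^ 2) * ddleg n c) with (2 * c * dleg n c - INR n * (INR n + 1) * leg n c) by lra.
    ring.
Qed.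

(** The derivative 2 c P'_n(c)^2 has the sign of c, so the maximum over [-1, 1] is attained at an
    end, where P_n^2 = 1. *)
Lemma sonin_bound n c : Rabs c <= 1 -> sonin n c <= INR n * (INR n + 1).
Proof.
  intros Hc. apply Rabs_le_between in Hc.
  assert (Cp : forall t, continuity_pt (sonin n) t).
  { intros t. apply continuity_pt_filterlim. apply (ex_derive_continuous (V := R_NormedModule)).
    eexists; apply sonin_derive. }
  destruct (Rle_lt_dec 0 c) as [H|H].
  - destruct (MVT_gen (sonin n) c 1 (fun t => 2 * t * dleg n t ^ 2)) as [d [Hd E]].
    + intros t _. apply sonin_derive.
    + intros; apply Cp.
    + rewrite Rmin_left, Rmax_right in Hd by lra.
      assert (sonin n 1 = INR n * (INR n + 1)).
      { unfold sonin. rewrite (proj1 (leg_at_1 n)). ring. }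
      assert (0 <= 2 * d * dleg n d ^ 2 * (1 - c)).
      { apply Rmult_le_pos; [apply Rmult_le_pos; [lra|apply pow2_ge_0]|lra]. }
      lra.
  - destruct (MVT_gen (sonin n) (-1) c (fun t => 2 * t * dleg n t ^ 2)) as [d [Hd E]].
    + intros t _. apply sonin_derive.
    + intros; apply Cp.
    + rewrite Rmin_left, Rmax_right in Hd by lra.
      assert (sonin n (-1) = INR n * (INR n + 1)).
      { unfold sonin. rewrite (proj1 (leg_at_m1 n)), <- pow_mult, PeanoNat.Nat.mul_comm, pow_mult.
        replace ((-1) ^ 2) with 1 by ring. rewrite pow1. ring. }
      assert (0 <= 2 * (- d) * dleg n d ^ 2 * (c - -1)).
      { apply Rmult_le_pos; [apply Rmult_le_pos; [lra|apply pow2_ge_0]|lra]. }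
      lra.
Qed.

Lemma dleg_bound n c : Rabs c <= 1 -> (1 - c ^ 2) * dleg n c ^ 2 <= (INR n + / 2) ^ 2.
Proof.
  intros Hc. generalize (sonin_bound n c Hc) (pos_INR n) (pow2_ge_0 (leg n c)). unfold sonin. intros A B C.
  assert (0 <= INR n * (INR n + 1) * leg n c ^ 2).
  { apply Rmult_le_pos; [apply Rmult_le_pos; lra|exact C]. }
  nra.
Qed.

Lemma leg_bound n c : Rabs c <= 1 -> Rabs (leg n c) <= 1.
Proof.
  intros Hc. destruct n as [|n].
  (* In degree 0 Sonin's function carries the factor n(n+1) = 0 and says nothing about P_0. *)
  - rewrite leg_0, Rabs_R1; lra.
  - generalize (sonin_bound (S n) c Hc) (pos_INR n). unfold sonin. rewrite S_INR. intros A B.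
    assert (0 <= (1 - c ^ 2) * dleg (S n) c ^ 2).
    { apply Rmult_le_pos; [|apply pow2_ge_0]. apply Rabs_le_between in Hc. nra. }
    assert (K : leg (S n) c ^ 2 <= 1).
    { apply (Rmult_le_reg_l ((INR n + 1) * (INR n + 1 + 1))); [nra|lra]. }
    rewrite <- (pow2_abs (leg (S n) c)) in K. generalize (Rabs_pos (leg (S n) c)). nra.
Qed.

(** * The generating function and the Poisson kernel *)

Section Generating.
Variable c : R.
Hypothesis Hc : Rabs c <= 1.
Let a n := leg n c.

Let cva : Rbar_le 1 (CV_radius a).
Proof.
  apply (proj1 (CV_radius_bounded a)). exists 1. intros n. rewrite pow1, Rmult_1_r. apply leg_bound, Hc.
Qed.
Let exa q : Rabs q < 1 -> ex_pseries a q.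
Proof.
  intros Hq. apply CV_radius_inside. apply Rbar_lt_le_trans with 1; [exact Hq|exact cva].
Qed.
Let exd q : Rabs q < 1 -> ex_pseries (PS_derive a) q.
Proof.
  intros Hq. apply CV_radius_inside. rewrite CV_radius_derive. apply Rbar_lt_le_trans with 1; [exact Hq|exact cva].
Qed.

Let D q := 1 - 2 * q * c + q ^ 2.
Let D_pos q : Rabs q < 1 -> 0 < D q.
Proof.
  intros Hq. unfold D. apply Rlt_le_trans with ((1 - Rabs q) ^ 2); [apply pow_lt; lra|].
  assert (q * c <= Rabs q * 1).
  { apply Rle_trans with (1 := Rle_abs _). rewrite Rabs_mult. apply Rmult_le_compat_l; [apply Rabs_pos|exact Hc]. }
  rewrite <- (pow2_abs q). nra.
Qed.

(** Bonnet's recurrence is the comparison of coefficients in (1 - 2qc + q^2) G' = (c - q) G; the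
    coefficients 0 and 1 are treated apart because of the shifts. *)
Let ode q : Rabs q < 1 -> D q * PSeries (PS_derive a) q = (c - q) * PSeries a q.
Proof.
  intros Hq.
  assert (I : forall b : nat -> R, ex_pseries b q -> ex_pseries (PS_incr_1 b) q).
  { intros b Hb. apply ex_pseries_incr_1, Hb. }
  assert (Sc : forall (k : R) (b : nat -> R), ex_pseries b q -> ex_pseries (PS_scal k b) q).
  { intros k b Hb. apply ex_pseries_scal; [apply Rmult_comm|exact Hb]. }
  assert (E : PSeries (PS_plus (PS_derive a) (PS_plus (PS_scal (- 2 * c) (PS_incr_1 (PS_derive a)))
      (PS_incr_1 (PS_incr_1 (PS_derive a))))) q = PSeries (PS_plus (PS_scal c a) (PS_scal (-1) (PS_incr_1 a))) q).
  { apply PSeries_ext. intros [|[|n]].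
    - change (INR 1 * leg 1 c + (- 2 * c * 0 + 0) = c * leg 0 c + -1 * 0).
      rewrite leg_0, leg_1. simpl. ring.
    - change (INR 2 * leg 2 c + (- 2 * c * (INR 1 * leg 1 c) + 0) = c * leg 1 c + -1 * leg 0 c).
      generalize (leg_rec 0 c). rewrite leg_0, leg_1. simpl. intros E. lra.
    - change (INR (S (S (S n))) * leg (S (S (S n))) c + (- 2 * c * (INR (S (S n)) * leg (S (S n)) c)
        + INR (S n) * leg (S n) c) = c * leg (S (S n)) c + -1 * leg (S n) c).
      generalize (leg_rec (S n) c). rewrite !S_INR. intros E. lra. }
  assert (X0 := exa q Hq). assert (X1 := exd q Hq). assert (X2 := I _ X0). assert (X3 := I _ X1).
  assert (X4 := I _ X3). assert (X5 := Sc (- 2 * c) _ X3). assert (X6 := Sc c _ X0). assert (X7 := Sc (-1) _ X2).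
  assert (X8 := ex_pseries_plus _ _ _ X5 X4).
  rewrite (PSeries_plus _ _ _ X1 X8), (PSeries_plus _ _ _ X5 X4), (PSeries_plus _ _ _ X6 X7) in E.
  rewrite !PSeries_scal, (PSeries_incr_1 (PS_incr_1 (PS_derive a))), (PSeries_incr_1 (PS_derive a)), (PSeries_incr_1 a) in E.
  unfold D. lra.
Qed.

(** By the differential equation G sqrt(D) has derivative 0 along the segment from 0 to q, and its
    value at 0 is 1. *)
Lemma leg_generating q : Rabs q < 1 -> PSeries a q * sqrt (D q) = 1.
Proof.
  intros Hq.
  pose (H := fun t => PSeries a (t * q) * sqrt (D (t * q))).
  assert (Ht : forall t, 0 <= t <= 1 -> Rabs (t * q) < 1).
  { intros t Ht. rewrite Rabs_mult, (Rabs_right t) by lra. generalize (Rabs_pos q). nra. }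
  assert (Dd : forall t, 0 <= t <= 1 -> is_derive H t 0).
  { intros t T. unfold H.
    apply (is_derive_ext (fun t => (fun w => PSeries a w * sqrt (D w)) (t * q))); [reflexivity|].
    eapply is_derive_val.
    - apply (dR_comp (fun w => PSeries a w * sqrt (D w))).
      + apply dR_mult.
        * apply is_derive_PSeries. apply Rbar_lt_le_trans with 1; [apply Ht, T|exact cva].
        * apply (dR_comp sqrt D _ (2 * (t * q) - 2 * c) (/ (2 * sqrt (D (t * q))))).
          -- auto_derive; [apply D_pos, Ht, T|]. ring.
          -- unfold D. auto_derive; [trivial|ring].
      + auto_derive; [trivial|reflexivity].
    - assert (P := D_pos _ (Ht t T)). assert (S : 0 < sqrt (D (t * q))) by (apply sqrt_lt_R0, P).
      assert (SS : sqrt (D (t * q)) * sqrt (D (t * q)) = D (t * q)) by (apply sqrt_sqrt; lra).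
      generalize (ode _ (Ht t T)). intros O.
      set (w := sqrt (D (t * q))) in *.
      transitivity (q * (/ w * (D (t * q) * PSeries (PS_derive a) (t * q) - (c - t * q) * PSeries a (t * q)))).
      + rewrite <- SS. field. lra.
      + rewrite O. ring. }
  assert (E : H 1 = H 0).
  { destruct (MVT_gen H 0 1 (fun _ => 0)) as [d [_ E]].
    - intros t T. rewrite Rmin_left, Rmax_right in T by lra. apply Dd; lra.
    - intros t T. rewrite Rmin_left, Rmax_right in T by lra.
      apply continuity_pt_filterlim. apply (ex_derive_continuous (V := R_NormedModule)). exists 0. apply Dd; lra.
    - lra. }
  unfold H in E. rewrite Rmult_1_l, Rmult_0_l in E. rewrite E.
  rewrite PSeries_0. unfold a, D. rewrite leg_0. replace (1 - 2 * 0 * c + 0 ^ 2) with 1 by ring.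
  rewrite sqrt_1. ring.
Qed.

(** The series is 2 q G' + G with G = D^(-1/2), and the differential equation eliminates G'. *)
Lemma poisson_kernel_series q : Rabs q < 1 ->
  is_pseries (fun n => (2 * INR n + 1) * leg n c) q ((1 - q ^ 2) / (D q * sqrt (D q))).
Proof.
  intros Hq.
  assert (E : (1 - q ^ 2) / (D q * sqrt (D q)) = plus (scal 2 (scal q (PSeries (PS_derive a) q : R_NormedModule))) (PSeries a q)).
  { unfold plus, scal; simpl; unfold mult; simpl.
    assert (P := D_pos _ Hq). assert (S : 0 < sqrt (D q)) by (apply sqrt_lt_R0, P).
    generalize (ode q Hq) (leg_generating q Hq). intros O G.
    apply (Rmult_eq_reg_l (D q)); [|lra].
    transitivity ((1 - q ^ 2) / sqrt (D q)); [field; split; lra|].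
    transitivity (2 * q * (D q * PSeries (PS_derive a) q) + D q * PSeries a q); [|ring].
    rewrite O. replace (PSeries a q) with (/ sqrt (D q)).
    - unfold D at 3. field. lra.
    - apply (Rmult_eq_reg_r (sqrt (D q))); [|lra]. rewrite G. field. lra. }
  rewrite E.
  apply (is_pseries_ext (PS_plus (PS_scal 2 (PS_incr_1 (PS_derive a))) a)).
  - intros [|n].
    + change (2 * 0 + leg 0 c = (2 * INR 0 + 1) * leg 0 c). simpl INR. ring.
    + change (2 * (INR (S n) * leg (S n) c) + leg (S n) c = (2 * INR (S n) + 1) * leg (S n) c). ring.
  - exact (is_pseries_plus (V := R_NormedModule) _ _ _ _ _
      (is_pseries_scal (V := R_NormedModule) 2 _ _ _ (Rmult_comm _ _)
        (is_pseries_incr_1 (V := R_NormedModule) _ _ _ (PSeries_correct _ _ (exd q Hq))))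
      (PSeries_correct _ _ (exa q Hq))).
Qed.
End Generating.

(** * Homogeneous components *)

(** The tail of the majorant does not depend on further variables of [a], so the bound is uniform
    and permits termwise integration without a general convergence theorem. *)
Lemma series_tail_bound (a b : nat -> R) (l m : R) N :
  is_series a l -> is_series b m -> (forall n, Rabs (a n) <= b n) ->
  Rabs (l - sum_n a N) <= m - sum_n b N.
Proof.
  intros Ha Hb H.
  assert (T : forall (c : nat -> R) (k : R), is_series c k -> is_series (fun n => c (S N + n)%nat) (k - sum_n c N)).
  { intros c k Hc. apply (is_series_incr_n (V := R_NormedModule) c (S N) (k - sum_n c N)); [lia|].
    match goal with |- is_series _ ?X => replace X with k; [exact Hc|] end.
    change (k = k - sum_n c N + sum_n c N); ring. }
  assert (Ta := T _ _ Ha). assert (Tb := T _ _ Hb).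
  rewrite <- (is_series_unique _ _ Ta), <- (is_series_unique _ _ Tb).
  assert (Ex : ex_series (fun n => Rabs (a (S N + n)%nat))).
  { apply (ex_series_le (V := R_CompleteNormedModule) _ (fun n => b (S N + n)%nat)).
    - intros n. change (Rabs (Rabs (a (S N + n)%nat)) <= b (S N + n)%nat). rewrite Rabs_Rabsolu. apply H.
    - eexists; exact Tb. }
  eapply Rle_trans; [apply Series_Rabs, Ex|].
  apply Series_le; [|eexists; exact Tb].
  intros n. split; [apply Rabs_pos|apply H].
Qed.

Lemma is_series_scalR (c : R) (a : nat -> R) (l : R) :
  is_series a l -> is_series (fun n => c * a n) (c * l).
Proof. exact (is_series_scal (V := R_NormedModule) c a l). Qed.

Lemma SI_sum_n (F : nat -> R -> R -> R) N : (forall n, cont2 (F n)) ->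
  cont2 (fun a b => sum_n (fun n => F n a b) N) /\
  SI (fun a b => sum_n (fun n => F n a b) N) = sum_n (fun n => SI (F n)) N.
Proof.
  intros HF. induction N as [|N [IH1 IH2]].
  - split.
    + intros a b. apply (continuous_ext (fun q : R * R => F 0%nat (fst q) (snd q))); [intros; rewrite sum_O; reflexivity|apply HF].
    + rewrite sum_O. apply SI_ext. intros; rewrite sum_O; reflexivity.
  - split.
    + intros a b. apply (continuous_ext (fun q : R * R => sum_n (fun n => F n (fst q) (snd q)) N + F (S N) (fst q) (snd q))).
      * intros; rewrite sum_Sn; reflexivity.
      * apply cR_plus; [apply IH1|apply HF].
    + rewrite sum_Sn, <- IH2. rewrite (SI_ext _ (fun a b => sum_n (fun n => F n a b) N + F (S N) a b)).
      * rewrite SI_plus; [reflexivity|exact IH1|apply HF].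
      * intros; rewrite sum_Sn; reflexivity.
Qed.

Lemma SI_abs_weight f g eps : cont2 f -> cont2 g -> 
  (forall a b, Rabs (g a b) <= eps) ->
  Rabs (SI (fun a b => f a b * g a b)) <= eps * SI (fun a b => Rabs (f a b)).
Proof.
  intros Hf Hg H.
  assert (Ca : cont2 (fun a b => Rabs (f a b))) by (intros a b; cont).
  rewrite <- SI_scal by exact Ca.
  assert (P : forall a b, Rabs (f a b * g a b) <= eps * Rabs (f a b)).
  { intros a b. rewrite Rabs_mult, Rmult_comm. apply Rmult_le_compat_r; [apply Rabs_pos|apply H]. }
  apply Rabs_le. split.
  - rewrite <- (Rmult_1_l (SI _)), <- Ropp_mult_distr_l_reverse, <- SI_scal by (apply cont2_scal, Ca).
    apply SI_le; [apply cont2_scal, cont2_scal, Ca|apply cont2_mult; assumption|].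
    intros a b. generalize (P a b). intros Q. apply Rabs_le_between in Q. lra.
  - apply SI_le; [apply cont2_mult; assumption|apply cont2_scal, Ca|].
    intros a b. generalize (P a b). intros Q. apply Rabs_le_between in Q. lra.
Qed.

Lemma sdot_unit e t1 t2 : dot e e = 1 -> Rabs (sdot e t1 t2) <= 1.
Proof. intros H. rewrite <- sqrt_1, <- H. apply sdot_bound. Qed.

Lemma leg_cont2 n e : cont2 (fun t1 t2 => leg n (sdot e t1 t2)).
Proof.
  intros a b. apply (cR_comp (leg n) (fun q : R * R => sdot e (fst q) (snd q))).
  - apply sdot_cont.
  - apply leg_cont.
Qed.

Section Expansion.
Variables (Rr : R) (v : nat -> pt -> R) (dv : nat -> nat -> pt -> R).
Hypothesis Hr : riesz Rr v dv.

Lemma v_cont2 s n : 0 < s < Rr -> cont2 (fun t1 t2 => v n (sphpt s t1 t2)).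
Proof.
  intros Hs. destruct Hr as [_ [Cv _]].
  apply (dom_cont2 (in_ball Rr) (v n)).
  - intros t1 t2. apply sphere_in_ball, Hs.
  - intros z Hz. apply Cv, Hz.
  - intros t1 t2. unfold sphpt, om. cont.
Qed.

(** Multiplied by (2n+1)/(4 pi), this is the value at s e of the degree n component of v_k. *)
Definition moment k s e n := SI (fun t1 t2 => v k (sphpt s t1 t2) * leg n (sdot e t1 t2)).

(** The Poisson kernel is expanded and integrated termwise. Negative [lam] is included so that the
    result is a power series identity on a full neighbourhood of 0. *)
Lemma v_series k s e lam : (k <= 2)%nat -> 0 < s < Rr -> dot e e = 1 -> Rabs lam < s ->
  is_series (fun n => (2 * INR n + 1) * (lam / s) ^ n * (moment k s e n / (4 * PI)))
    (v k (lam * e 0%nat, lam * e 1%nat, lam * e 2%nat)).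
Proof.
  intros Hk Hs He Hl. generalize PI_RGT_0; intros Hpi.
  set (q := lam / s).
  assert (Hq : Rabs q < 1).
  { unfold q, Rdiv. rewrite Rabs_mult, Rabs_inv, (Rabs_right s) by lra.
    apply (Rmult_lt_reg_r s); [lra|]. rewrite Rmult_assoc, Rinv_l by lra. lra. }
  pose (f := fun t1 t2 => v k (sphpt s t1 t2)).
  assert (Cf : cont2 f) by (apply v_cont2, Hs).
  pose (K := fun t1 t2 => (1 - q ^ 2) / ((1 - 2 * q * sdot e t1 t2 + q ^ 2) * sqrt (1 - 2 * q * sdot e t1 t2 + q ^ 2))).
  assert (Dpos : forall t1 t2, 0 < 1 - 2 * q * sdot e t1 t2 + q ^ 2).
  { intros t1 t2. apply Rlt_le_trans with ((1 - Rabs q) ^ 2); [apply pow_lt; lra|].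
    assert (q * sdot e t1 t2 <= Rabs q * 1).
    { apply Rle_trans with (1 := Rle_abs _). rewrite Rabs_mult. apply Rmult_le_compat_l; [apply Rabs_pos|apply sdot_unit, He]. }
    rewrite <- (pow2_abs q). nra. }
  assert (CK : cont2 K).
  { intros a b. unfold K. assert (Cs := sdot_cont e). cont. simpl.
    apply Rgt_not_eq, Rmult_lt_0_compat; [apply Dpos|apply sqrt_lt_R0, Dpos]. }
  assert (PF : SI (fun t1 t2 => f t1 t2 * K t1 t2) = 4 * PI * v k (lam * e 0%nat, lam * e 1%nat, lam * e 2%nat)).
  { assert (Dx : dot (fun i => lam * e i) (fun i => lam * e i) = lam ^ 2).
    { unfold dot in *. replace (lam ^ 2) with (lam ^ 2 * (e 0%nat * e 0%nat + e 1%nat * e 1%nat + e 2%nat * e 2%nat)) by (rewrite He; ring). ring. }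
    rewrite <- (poisson_formula Rr s v dv (fun i => lam * e i) Hr Hs) by
      (exact Hk || (rewrite Dx, <- (pow2_abs lam); generalize (Rabs_pos lam); nra)).
    apply SI_ext. intros t1 t2. unfold f. f_equal.
    unfold pD. rewrite Dx.
    replace (sdot (fun i => lam * e i) t1 t2) with (lam * sdot e t1 t2) by (unfold sdot; ring).
    unfold K. replace (s ^ 2 - 2 * s * (lam * sdot e t1 t2) + lam ^ 2) with
      (s ^ 2 * (1 - 2 * q * sdot e t1 t2 + q ^ 2)) by (unfold q; field; lra).
    rewrite sqrt_mult, sqrt_pow2 by (lra || apply pow2_ge_0 || (left; apply Dpos)).
    assert (P1 := Dpos t1 t2). assert (P2 := sqrt_lt_R0 _ P1).
    set (w := 1 - 2 * q * sdot e t1 t2 + q ^ 2) in *.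
    unfold q. field. repeat split; lra. }
  (* As |P_n| <= 1, the terms are dominated by (2n+1)|q|^n, which is the kernel series itself at c =
     1. *)
  assert (Bs : is_series (fun n => (2 * INR n + 1) * Rabs q ^ n)
     ((1 - Rabs q ^ 2) / ((1 - 2 * Rabs q * 1 + Rabs q ^ 2) * sqrt (1 - 2 * Rabs q * 1 + Rabs q ^ 2)))).
  { generalize (poisson_kernel_series 1 ltac:(rewrite Rabs_R1; lra) (Rabs q) ltac:(rewrite Rabs_Rabsolu; exact Hq)).
    intros G. apply is_pseries_R in G. revert G. apply is_series_ext. intros n. rewrite (proj1 (leg_at_1 n)). toR. ring. }
  set (B := _ / _) in Bs.
  set (M := SI (fun a b => Rabs (f a b))).
  assert (Key : forall N, Rabs (4 * PI * v k (lam * e 0%nat, lam * e 1%nat, lam * e 2%nat)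
     - sum_n (fun n => (2 * INR n + 1) * q ^ n * moment k s e n) N) <=
     (B - sum_n (fun n => (2 * INR n + 1) * Rabs q ^ n) N) * M).
  { intros N.
    pose (T := fun n t1 t2 => (2 * INR n + 1) * leg n (sdot e t1 t2) * q ^ n).
    assert (CT : forall n, cont2 (T n)).
    { intros n a b. unfold T. assert (Cl := leg_cont2 n e a b). cont. }
    assert (CfT : forall n, cont2 (fun t1 t2 => f t1 t2 * T n t1 t2)) by (intros n; apply cont2_mult; auto).
    rewrite <- PF.
    replace (sum_n (fun n => (2 * INR n + 1) * q ^ n * moment k s e n) N) with
      (SI (fun a b => f a b * sum_n (fun n => T n a b) N)).
    - rewrite <- SI_minus; [|apply cont2_mult; assumption|apply cont2_mult; [exact Cf|apply (proj1 (SI_sum_n T N CT))]].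
      rewrite (SI_ext _ (fun a b => f a b * (K a b - sum_n (fun n => T n a b) N))) by (intros; ring).
      apply SI_abs_weight; [exact Cf|apply cont2_minus; [exact CK|apply (proj1 (SI_sum_n T N CT))]|].
      intros a b. apply series_tail_bound.
      + generalize (poisson_kernel_series (sdot e a b) (sdot_unit e a b He) q Hq). intros G. apply is_pseries_R in G. exact G.
      + exact Bs.
      + intros n. unfold T. rewrite !Rabs_mult, <- RPow_abs.
        assert (P0 : 0 <= 2 * INR n + 1) by (generalize (pos_INR n); lra).
        rewrite (Rabs_right (2 * INR n + 1)) by lra.
        apply Rmult_le_compat_r; [apply pow_le, Rabs_pos|].
        rewrite <- (Rmult_1_r (2 * INR n + 1)) at 2. apply Rmult_le_compat_l; [exact P0|].
        apply leg_bound, sdot_unit, He.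
    - rewrite (SI_ext _ (fun a b => sum_n (fun n => f a b * T n a b) N)).
      + rewrite (proj2 (SI_sum_n _ N CfT)). apply sum_n_ext. intros n.
        unfold moment. rewrite <- SI_scal.
        * apply SI_ext. intros; unfold T, f; ring.
        * apply cont2_mult; [exact Cf|apply leg_cont2].
      + intros a b. symmetry. apply (sum_n_mult_l (K := R_Ring)). }
  apply (is_series_ext (fun n => / (4 * PI) * ((2 * INR n + 1) * q ^ n * moment k s e n))).
  { intros n. toR. unfold Rdiv. ring. }
  replace (v k (lam * e 0%nat, lam * e 1%nat, lam * e 2%nat)) with
    (/ (4 * PI) * (4 * PI * v k (lam * e 0%nat, lam * e 1%nat, lam * e 2%nat))) by (field; lra).
  apply is_series_scalR.
  set (L := 4 * PI * _) in *. set (S := sum_n _) in *.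
  change (is_lim_seq (sum_n (fun n => (2 * INR n + 1) * q ^ n * moment k s e n)) L).
  assert (L1 : is_lim_seq (fun N => (B - sum_n (fun n => (2 * INR n + 1) * Rabs q ^ n) N) * M) 0).
  { replace (Finite 0) with (Rbar_mult (B - B) M) by (simpl; f_equal; ring).
    apply is_lim_seq_scal_r. apply is_lim_seq_minus'; [apply is_lim_seq_const|exact Bs]. }
  apply (is_lim_seq_ext (fun N => L - (L - sum_n (fun n => (2 * INR n + 1) * q ^ n * moment k s e n) N))); [intros; ring|].
  replace (Finite L) with (Finite (L - 0)) by (f_equal; ring).
  apply is_lim_seq_minus'; [apply is_lim_seq_const|].
  apply is_lim_seq_abs_0.
  apply (is_lim_seq_le_le (fun _ => 0) _ (fun N => (B - sum_n (fun n => (2 * INR n + 1) * Rabs q ^ n) N) * M)).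
  - intros N. split; [apply Rabs_pos|apply Key].
  - apply is_lim_seq_const.
  - exact L1.
Qed.

(** The expansions from the two spheres represent the same function of [lam] near 0, so their
    coefficients agree. *)
Lemma moment_homog k s1 s2 e n : (k <= 2)%nat -> 0 < s1 < Rr -> 0 < s2 < Rr -> dot e e = 1 ->
  moment k s1 e n / s1 ^ n = moment k s2 e n / s2 ^ n.
Proof.
  intros Hk H1 H2 He. generalize PI_RGT_0; intros Hpi.
  pose (a := fun s n => (2 * INR n + 1) * (moment k s e n / s ^ n / (4 * PI))).
  assert (P : forall s lam, 0 < s < Rr -> Rabs lam < s ->
     is_pseries (a s) lam (v k (lam * e 0%nat, lam * e 1%nat, lam * e 2%nat))).
  { intros s lam Hs Hl. apply is_pseries_R.
    apply (is_series_ext (fun n => (2 * INR n + 1) * (lam / s) ^ n * (moment k s e n / (4 * PI)))).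
    - intros m. unfold a, Rdiv. rewrite Rpow_mult_distr, pow_inv. toR. ring.
    - apply v_series; assumption. }
  assert (CV : forall s, 0 < s < Rr -> Rbar_lt 0 (CV_radius (a s))).
  { intros s Hs. apply Rbar_lt_le_trans with (Rabs (s / 2)).
    - simpl. apply Rabs_pos_lt. lra.
    - apply Rbar_not_lt_le. intros C. apply CV_disk_outside in C.
      apply C. apply ex_series_lim_0. 
      assert (Q : is_pseries (a s) (s / 2) (v k (s / 2 * e 0%nat, s / 2 * e 1%nat, s / 2 * e 2%nat))).
      { apply P; [exact Hs|]. rewrite Rabs_right; lra. }
      apply is_pseries_R in Q. eexists. exact Q. }
  assert (E : a s1 n = a s2 n).
  { apply PSeries_ext_recip; [apply CV, H1|apply CV, H2|].
    assert (Hm : 0 < Rmin s1 s2) by (apply Rmin_pos; lra).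
    exists (mkposreal _ Hm). intros y Hy.
    change (Rabs (y - 0) < Rmin s1 s2) in Hy. rewrite Rminus_0_r in Hy.
    rewrite (is_pseries_unique _ _ _ (P s1 y H1 (Rlt_le_trans _ _ _ Hy (Rmin_l _ _)))).
    rewrite (is_pseries_unique _ _ _ (P s2 y H2 (Rlt_le_trans _ _ _ Hy (Rmin_r _ _)))).
    reflexivity. }
  unfold a in E. apply Rmult_eq_reg_l in E; [|generalize (pos_INR n); lra].
  unfold Rdiv in E |- *. apply Rmult_eq_reg_r in E; [exact E|]. apply Rinv_neq_0_compat. lra.
Qed.
End Expansion.

(** * The phase equation along rotations about the x_0-axis *)

(** The vector e turned by the angle th about the x_0-axis. *)
Definition erot (e : nat -> R) (th : R) (i : nat) : R :=
  match i with
  | 0%nat => e 0%nat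
  | 1%nat => e 1%nat * cos th - e 2%nat * sin th
  | _ => e 1%nat * sin th + e 2%nat * cos th
  end.

Lemma erot_unit e th : dot e e = 1 -> dot (erot e th) (erot e th) = 1.
Proof.
  unfold dot; simpl. generalize (sin2_cos2 th). unfold Rsqr. intros S H.
  transitivity (e 0%nat * e 0%nat + (e 1%nat * e 1%nat + e 2%nat * e 2%nat) * (sin th * sin th + cos th * cos th)); [ring|].
  rewrite S. lra.
Qed.

Lemma erot_0 e i : (i <= 2)%nat -> erot e 0 i = e i.
Proof. intros Hi. destruct i as [|[|[|i]]]; [| | |lia]; simpl; rewrite ?cos_0, ?sin_0; ring. Qed.

(** Components of the vector product of omega and e: the result of applying L_ij to <e, omega>. *)
Definition cross e i j t1 t2 : R := om i t1 t2 * e j - om j t1 t2 * e i.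

Lemma cross_cont e i j : cont2 (cross e i j).
Proof. intros a b. unfold cross. assert (Ci := om_cont i). assert (Cj := om_cont j). cont. Qed.

(** Lagrange's identity with the square of the component (1, 2) dropped. *)
Lemma cross_norm e t1 t2 : dot e e = 1 ->
  cross e 0 2 t1 t2 ^ 2 + cross e 0 1 t1 t2 ^ 2 <= 1 - sdot e t1 t2 ^ 2.
Proof.
  intros H. generalize (om_sphere t1 t2). unfold cross, sdot, dot in *.
  generalize (om 0 t1 t2) (om 1 t1 t2) (om 2 t1 t2). intros p q w E.
  revert H. generalize (e 0%nat) (e 1%nat) (e 2%nat). intros a b c H.
  generalize (pow2_ge_0 (q * c - w * b)). intros P.
  assert (L : (p * c - w * a) ^ 2 + (p * b - q * a) ^ 2 + (q * c - w * b) ^ 2 + (a * p + b * q + c * w) ^ 2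
     = (p ^ 2 + q ^ 2 + w ^ 2) * (a * a + b * b + c * c)) by ring.
  rewrite E, H in L. lra.
Qed.

Section Angular.
Variables (Rr : R) (v : nat -> pt -> R) (dv : nat -> nat -> pt -> R).
Hypothesis Hr : riesz Rr v dv.
Variable s : R.
Hypothesis Hs : 0 < s < Rr.
Variable n : nat.

Let sv k t1 t2 := v k (sphpt s t1 t2).
Let sdv k j t1 t2 := dv k j (sphpt s t1 t2).

Let sv_cont k : cont2 (sv k).
Proof. apply (v_cont2 Rr v dv Hr s k Hs). Qed.
Let sdv_cont k j : cont2 (sdv k j).
Proof.
  destruct Hr as [_ [_ [Cd _]]].
  apply (dom_cont2 (in_ball Rr) (dv k j)).
  - intros t1 t2. apply sphere_in_ball, Hs.
  - intros z Hz. apply Cd, Hz.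
  - intros t1 t2. unfold sphpt, om. cont.
Qed.

Lemma sphpt_cont s' t1 t2 :
  continuous (fun q : R * R * R => sphpt (fst (fst q)) (snd (fst q)) (snd q)) (s', t1, t2).
Proof. unfold sphpt, om. cont. Qed.

Let dleg_cont2 e : cont2 (fun t1 t2 => dleg n (sdot e t1 t2)).
Proof.
  intros a b. apply (cR_comp (dleg n) (fun q : R * R => sdot e (fst q) (snd q))).
  - apply sdot_cont.
  - apply dleg_cont.
Qed.

Section ByParts.
Variables (e : nat -> R) (k : nat).

Let G t1 t2 := sv k t1 t2 * leg n (sdot e t1 t2).
Let g j t1 t2 := s * sdv k j t1 t2 * leg n (sdot e t1 t2) + sv k t1 t2 * (dleg n (sdot e t1 t2) * e j).

Let G_cont : cont2 G.
Proof. apply cont2_mult; [apply sv_cont|apply leg_cont2]. Qed.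
Let g_cont j : cont2 (g j).
Proof.
  intros a b. unfold g. assert (C1 := sv_cont k a b). assert (C2 := sdv_cont k j a b).
  assert (C3 := leg_cont2 n e a b). assert (C4 := dleg_cont2 e a b). cbv beta in *. cont.
Qed.

Let G_D1 t1 t2 : is_derive (fun t => G t t2) t1
  (- sin t1 * g 0 t1 t2 + cos t1 * cos t2 * g 1 t1 t2 + cos t1 * sin t2 * g 2 t1 t2).
Proof.
  destruct Hr as [Hg _]. unfold G. eapply is_derive_val.
  - apply (dR_mult (fun t => sv k t t2) (fun t => leg n (sdot e t t2))).
    + apply (Hg (sphpt s t1 t2) k (sphere_in_ball Rr s t1 t2 Hs) (fun i t => s * om i t t2) t1).
      * intros i. apply dR_scal, om_D1.
      * reflexivity.
    + apply (dR_comp (leg n) (fun t => sdot e t t2)); [apply leg_derive|].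
      unfold sdot. apply dR_plus; [apply dR_plus|]; apply dR_scal, om_D1.
  - unfold g, sdv, sv, delta; simpl. ring.
Qed.

Let G_D2 t1 t2 : is_derive (fun t => G t1 t) t2
  (- sin t1 * sin t2 * g 1 t1 t2 + sin t1 * cos t2 * g 2 t1 t2).
Proof.
  destruct Hr as [Hg _]. unfold G. eapply is_derive_val.
  - apply (dR_mult (fun t => sv k t1 t) (fun t => leg n (sdot e t1 t))).
    + apply (Hg (sphpt s t1 t2) k (sphere_in_ball Rr s t1 t2 Hs) (fun i t => s * om i t1 t) t2).
      * intros i. apply dR_scal, om_D2.
      * reflexivity.
    + apply (dR_comp (leg n) (fun t => sdot e t1 t)); [apply leg_derive|].
      unfold sdot. apply dR_plus; [apply dR_plus|]; apply dR_scal, om_D2.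
  - unfold g, sdv, sv, delta; simpl. ring.
Qed.

Let G_per t1 : G t1 (2 * PI) = G t1 0.
Proof. unfold G, sv, sphpt, sdot, om. rewrite cos_2PI, sin_2PI, cos_0, sin_0. reflexivity. Qed.

(** The angular derivative L_ij v_k at a point of the sphere of radius s; [Ev] below is Euler's
    operator applied to v_k. *)
Definition Lv i j t1 t2 := s * (om i t1 t2 * sdv k j t1 t2 - om j t1 t2 * sdv k i t1 t2).

Lemma Lv_cont i j : cont2 (Lv i j).
Proof.
  intros a b. unfold Lv. assert (C1 := om_cont i). assert (C2 := om_cont j).
  assert (C3 := sdv_cont k i). assert (C4 := sdv_cont k j). cont.
Qed.

(** Stokes' theorem for v_k P_n(<e, omega>): the rotation field L_ij of the product integrates to 0,
    and L_ij P_n(<e, omega>) is P'_n times [cross]. *)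
Lemma by_parts i j : (i = 0%nat /\ j = 1%nat) \/ (i = 0%nat /\ j = 2%nat) \/ (i = 1%nat /\ j = 2%nat) ->
  SI (fun t1 t2 => leg n (sdot e t1 t2) * Lv i j t1 t2) =
  - SI (fun t1 t2 => sv k t1 t2 * (dleg n (sdot e t1 t2) * cross e i j t1 t2)).
Proof.
  intros Hij.
  assert (C1 : cont2 (fun t1 t2 => leg n (sdot e t1 t2) * Lv i j t1 t2)).
  { apply cont2_mult; [apply leg_cont2|apply Lv_cont]. }
  assert (C2 : cont2 (fun t1 t2 => sv k t1 t2 * (dleg n (sdot e t1 t2) * cross e i j t1 t2))).
  { apply cont2_mult; [apply sv_cont|apply cont2_mult; [apply dleg_cont2|apply cross_cont]]. }
  apply Rplus_opp_r_uniq. rewrite Rplus_comm, <- SI_plus by assumption.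
  destruct Hij as [[-> ->]|[[-> ->]|[-> ->]]].
  - rewrite <- (stokes_01 G (g 0) (g 1) (g 2)); auto.
    apply SI_ext. intros t1 t2. unfold g, Lv, cross, om. ring.
  - rewrite <- (stokes_02 G (g 0) (g 1) (g 2)); auto.
    apply SI_ext. intros t1 t2. unfold g, Lv, cross, om. ring.
  - rewrite <- (stokes_12 G (g 1) (g 2)); auto.
    apply SI_ext. intros t1 t2. unfold g, Lv, cross, om. ring.
Qed.

Definition Ev t1 t2 := s * (om 0 t1 t2 * sdv k 0 t1 t2 + om 1 t1 t2 * sdv k 1 t1 t2 + om 2 t1 t2 * sdv k 2 t1 t2).

Lemma Ev_cont : cont2 Ev.
Proof.
  intros a b. unfold Ev. assert (C1 := om_cont 0). assert (C2 := om_cont 1). assert (C5 := om_cont 2).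
  assert (C3 := sdv_cont k 0). assert (C4 := sdv_cont k 1). assert (C6 := sdv_cont k 2). cont.
Qed.

(** Euler's identity in integrated form: the moment is a multiple of s^n by [moment_homog], and
    differentiating in s under the integral produces the radial derivative of v_k. *)
Lemma radial_moment : (k <= 2)%nat -> dot e e = 1 ->
  SI (fun t1 t2 => leg n (sdot e t1 t2) * Ev t1 t2) = INR n * moment v k s e n.
Proof.
  intros Hk He. destruct (Hr) as [Hg [Cv [Cd _]]].
  pose (C0 := moment v k s e n / s ^ n).
  assert (L : locally s (fun s' => 0 < s' < Rr)).
  { apply (filter_and (F := locally s)).
    - apply (open_gt 0). lra.
    - apply (open_lt Rr). lra. }
  assert (D1 : is_derive (fun s' => moment v k s' e n) s
     (SI (fun t1 t2 => (om 0 t1 t2 * sdv k 0 t1 t2 + om 1 t1 t2 * sdv k 1 t1 t2 + om 2 t1 t2 * sdv k 2 t1 t2) * leg n (sdot e t1 t2)))).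
  { unfold moment.
    apply (SI_derive (fun s' t1 t2 => v k (sphpt s' t1 t2) * leg n (sdot e t1 t2))
      (fun s' t1 t2 => (om 0 t1 t2 * dv k 0%nat (sphpt s' t1 t2) + om 1 t1 t2 * dv k 1%nat (sphpt s' t1 t2)
        + om 2 t1 t2 * dv k 2%nat (sphpt s' t1 t2)) * leg n (sdot e t1 t2))).
    - revert L. apply filter_imp. intros s' Hs' t1 t2.
      eapply is_derive_val.
      + apply (dR_mult (fun u => v k (sphpt u t1 t2)) (fun _ => leg n (sdot e t1 t2))); [|apply dR_const].
        apply (Hg (sphpt s' t1 t2) k (sphere_in_ball Rr s' t1 t2 Hs') (fun i u => u * om i t1 t2) s' (fun i => om i t1 t2)).
        * intros i. auto_derive; [trivial|ring].
        * reflexivity.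
      + cbv beta. ring.
    - intros t1 t2.
      assert (K1 : forall j, continuous (fun q : R * R * R => dv k j (sphpt (fst (fst q)) (snd (fst q)) (snd q))) (s, t1, t2)).
      { intros j. apply (continuous_comp (fun q : R * R * R => sphpt (fst (fst q)) (snd (fst q)) (snd q)) (dv k j)).
        - apply sphpt_cont.
        - apply Cd, sphere_in_ball, Hs. }
      assert (K2 : continuous (fun q : R * R * R => leg n (sdot e (snd (fst q)) (snd q))) (s, t1, t2)).
      { apply (cont2_comp (fun a b => leg n (sdot e a b)) (fun q : R * R * R => snd (fst q)) (fun q => snd q));
        [apply leg_cont2|cont|cont]. }
      assert (P0 := K1 0%nat). assert (P1 := K1 1%nat). assert (P2 := K1 2%nat).
      assert (O0 := om_cont 0). assert (O1 := om_cont 1). assert (O2 := om_cont 2). cbv beta in *. cont.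
    - revert L. apply filter_imp. intros s' Hs'. apply cont2_mult; [apply (v_cont2 Rr v dv Hr s' k Hs')|apply leg_cont2].
    - intros a b. assert (C1 := om_cont 0 a b). assert (C2 := om_cont 1 a b). assert (C5 := om_cont 2 a b).
      assert (C3 := sdv_cont k 0 a b). assert (C4 := sdv_cont k 1 a b). assert (C6 := sdv_cont k 2 a b).
      assert (C7 := leg_cont2 n e a b). unfold sdv in *. cbv beta in *. cont. }
  assert (D2 : is_derive (fun s' => moment v k s' e n) s (C0 * (INR n * s ^ pred n))).
  { apply (is_derive_ext_loc (fun s' => C0 * s' ^ n)).
    - revert L. apply filter_imp. intros s' Hs'. unfold C0.
      rewrite (moment_homog Rr v dv Hr k s s' e n Hk Hs Hs' He). toR. field. apply pow_nonzero. lra.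
    - apply dR_scal. auto_derive; [trivial|ring]. }
  generalize (is_derive_unique _ _ _ D1) (is_derive_unique _ _ _ D2). intros U1 U2. rewrite U1 in U2.
  transitivity (s * (C0 * (INR n * s ^ pred n))).
  - rewrite <- U2, <- SI_scal.
    + apply SI_ext. intros t1 t2. unfold Ev. ring.
    + intros a b. assert (C1 := om_cont 0 a b). assert (C2 := om_cont 1 a b). assert (C5 := om_cont 2 a b).
      assert (C3 := sdv_cont k 0 a b). assert (C4 := sdv_cont k 1 a b). assert (C6 := sdv_cont k 2 a b).
      assert (C7 := leg_cont2 n e a b). cbv beta in *. cont.
  - unfold C0. destruct n as [|m].
    + simpl. ring.
    + simpl pred. rewrite <- tech_pow_Rmult. field. split; [apply pow_nonzero|]; lra.
Qed.
End ByParts.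
End Angular.

Section Theta.
Variables (Rr : R) (v : nat -> pt -> R) (dv : nat -> nat -> pt -> R).
Hypothesis Hr : riesz Rr v dv.
Variable s : R.
Hypothesis Hs : 0 < s < Rr.
Variable n : nat.
Variable e : nat -> R.
Hypothesis He : dot e e = 1.

Definition Mth k th := moment v k s (erot e th) n.

Lemma erot_sdot_derive th t1 t2 :
  is_derive (fun u => sdot (erot e u) t1 t2) th (- cross (erot e th) 1 2 t1 t2).
Proof. unfold sdot, cross. cbn [erot]. unfold om. auto_derive; [trivial|ring]. Qed.

Lemma sdot_erot_cont th t1 t2 :
  continuous (fun q : R * R * R => sdot (erot e (fst (fst q))) (snd (fst q)) (snd q)) (th, t1, t2).
Proof. unfold sdot, erot, om. cont. Qed.

(** Turning e makes the derivative fall on P_n as -P'_n times [cross]; integration by parts moves it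
    onto v_k. *)
Lemma Mth_derive k th : is_derive (Mth k) th
  (SI (fun t1 t2 => leg n (sdot (erot e th) t1 t2) * Lv dv s k 1 2 t1 t2)).
Proof.
  rewrite (by_parts Rr v dv Hr s Hs n (erot e th) k 1 2) by tauto.
  rewrite <- (Rmult_1_l (SI _)), <- Ropp_mult_distr_l_reverse.
  assert (Cs := v_cont2 Rr v dv Hr s k Hs).
  assert (Cd : forall u, cont2 (fun t1 t2 => dleg n (sdot (erot e u) t1 t2))).
  { intros u a b. apply (cR_comp (dleg n) (fun q : R * R => sdot (erot e u) (fst q) (snd q))).
    - apply sdot_cont.
    - apply dleg_cont. }
  rewrite <- SI_scal.
  2:{ apply cont2_mult; [exact Cs|apply cont2_mult; [apply Cd|apply cross_cont]]. }
  unfold Mth, moment.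
  apply (SI_derive (fun u t1 t2 => v k (sphpt s t1 t2) * leg n (sdot (erot e u) t1 t2))
    (fun u t1 t2 => -1 * (v k (sphpt s t1 t2) * (dleg n (sdot (erot e u) t1 t2) * cross (erot e u) 1 2 t1 t2)))).
  - apply filter_forall. intros u t1 t2.
    eapply is_derive_val.
    + apply dR_scal. apply (dR_comp (leg n) (fun w => sdot (erot e w) t1 t2)); [apply leg_derive|apply erot_sdot_derive].
    + ring.
  - intros t1 t2.
    assert (K1 : continuous (fun q : R * R * R => v k (sphpt s (snd (fst q)) (snd q))) (th, t1, t2)).
    { apply (cont2_comp (fun a b => v k (sphpt s a b)) (fun q : R * R * R => snd (fst q)) (fun q => snd q));
      [exact Cs|cont|cont]. }
    assert (K2 : continuous (fun q : R * R * R => dleg n (sdot (erot e (fst (fst q))) (snd (fst q)) (snd q))) (th, t1, t2)).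
    { apply (cR_comp (dleg n)); [apply sdot_erot_cont|apply dleg_cont]. }
    assert (K3 : continuous (fun q : R * R * R => cross (erot e (fst (fst q))) 1 2 (snd (fst q)) (snd q)) (th, t1, t2)).
    { unfold cross, erot, om. cont. }
    cont.
  - apply filter_forall. intros u. apply cont2_mult; [exact Cs|apply leg_cont2].
  - apply cont2_scal, cont2_mult; [exact Cs|apply cont2_mult; [apply Cd|apply cross_cont]].
Qed.

(** Minus the integral of P_n L_02 v_0, and [c01] likewise for L_01, in the form after integration
    by parts: only values of v_0 occur, and these are controlled by [S1]. *)
Definition c02 th := SI (fun t1 t2 => v 0%nat (sphpt s t1 t2) * (dleg n (sdot (erot e th) t1 t2) * cross (erot e th) 0 2 t1 t2)).
Definition c01 th := SI (fun t1 t2 => v 0%nat (sphpt s t1 t2) * (dleg n (sdot (erot e th) t1 t2) * cross (erot e th) 0 1 t1 t2)).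

Let dth k th := SI (fun t1 t2 => leg n (sdot (erot e th) t1 t2) * Lv dv s k 1 2 t1 t2).

(** Pointwise the Riesz system gives L_12 v_1 - E v_2 = - L_02 v_0, with E Euler's operator, which
    acts as n on the moments. *)
Lemma angular_1 th : dth 1 th - INR n * Mth 2 th = c02 th.
Proof.
  unfold dth, Mth. rewrite <- (radial_moment Rr v dv Hr s Hs n (erot e th) 2) by (lia || apply erot_unit, He).
  rewrite <- SI_minus.
  2:{ apply cont2_mult; [apply leg_cont2|apply (Lv_cont Rr v dv Hr s Hs)]. }
  2:{ apply cont2_mult; [apply leg_cont2|apply (Ev_cont Rr v dv Hr s Hs)]. }
  transitivity (- SI (fun t1 t2 => leg n (sdot (erot e th) t1 t2) * Lv dv s 0 0 2 t1 t2)).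
  2:{ rewrite (by_parts Rr v dv Hr s Hs n (erot e th) 0 0 2) by tauto. unfold c02. ring. }
  rewrite <- (Rmult_1_l (SI (fun t1 t2 => _ * Lv dv s 0 0 2 t1 t2))), <- Ropp_mult_distr_l_reverse.
  rewrite <- SI_scal by (apply cont2_mult; [apply leg_cont2|apply (Lv_cont Rr v dv Hr s Hs)]).
  apply SI_ext. intros t1 t2. unfold Lv, Ev.
  destruct Hr as [_ [_ [_ [Sy Tr]]]].
  assert (B := sphere_in_ball Rr s t1 t2 Hs).
  generalize (Sy _ 0%nat 1%nat B) (Sy _ 0%nat 2%nat B) (Sy _ 1%nat 2%nat B) (Tr _ B). intros E1 E2 E3 T.
  rewrite <- E2, <- E3.
  replace (dv 2%nat 2%nat (sphpt s t1 t2)) with (- dv 0%nat 0%nat (sphpt s t1 t2) - dv 1%nat 1%nat (sphpt s t1 t2)) by lra.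
  ring.
Qed.

(** The companion identity L_12 v_2 + E v_1 = L_01 v_0. *)
Lemma angular_2 th : dth 2 th + INR n * Mth 1 th = - c01 th.
Proof.
  unfold dth, Mth. rewrite <- (radial_moment Rr v dv Hr s Hs n (erot e th) 1) by (lia || apply erot_unit, He).
  rewrite <- SI_plus.
  2:{ apply cont2_mult; [apply leg_cont2|apply (Lv_cont Rr v dv Hr s Hs)]. }
  2:{ apply cont2_mult; [apply leg_cont2|apply (Ev_cont Rr v dv Hr s Hs)]. }
  unfold c01.
  rewrite <- (by_parts Rr v dv Hr s Hs n (erot e th) 0 0 1) by tauto.
  apply SI_ext. intros t1 t2. unfold Lv, Ev.
  destruct Hr as [_ [_ [_ [Sy Tr]]]].
  assert (B := sphere_in_ball Rr s t1 t2 Hs).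
  generalize (Sy _ 0%nat 1%nat B) (Sy _ 0%nat 2%nat B) (Sy _ 1%nat 2%nat B) (Tr _ B). intros E1 E2 E3 T.
  rewrite <- E1, <- E3.
  replace (dv 2%nat 2%nat (sphpt s t1 t2)) with (- dv 0%nat 0%nat (sphpt s t1 t2) - dv 1%nat 1%nat (sphpt s t1 t2)) by lra.
  ring.
Qed.

Variables al be : R.
Hypothesis Hab : al ^ 2 + be ^ 2 = 1.

(* al Re + be Im of e^(-i n th) (M1 - i M2) *)
Definition phase th : R :=
  al * (cos (INR n * th) * Mth 1 th - sin (INR n * th) * Mth 2 th)
  - be * (sin (INR n * th) * Mth 1 th + cos (INR n * th) * Mth 2 th).

Definition dphase th : R :=
  (al * cos (INR n * th) - be * sin (INR n * th)) * c02 th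
  + (al * sin (INR n * th) + be * cos (INR n * th)) * c01 th.

(** The factor e^(-i n th) is chosen so that its derivative cancels the terms with n, leaving only
    the moments of v_0. *)
Lemma phase_derive th : is_derive phase th (dphase th).
Proof.
  assert (Dc : is_derive (fun t => cos (INR n * t)) th (- INR n * sin (INR n * th))) by (auto_derive; [trivial|ring]).
  assert (Ds : is_derive (fun t => sin (INR n * t)) th (INR n * cos (INR n * th))) by (auto_derive; [trivial|ring]).
  assert (D1 := Mth_derive 1 th). assert (D2 := Mth_derive 2 th).
  assert (P1 := dR_mult _ _ _ _ _ Dc D1). assert (P2 := dR_mult _ _ _ _ _ Ds D2).
  assert (P3 := dR_mult _ _ _ _ _ Ds D1). assert (P4 := dR_mult _ _ _ _ _ Dc D2).
  assert (Q1 := dR_scal al _ _ _ (dR_minus _ _ _ _ _ P1 P2)).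
  assert (Q2 := dR_scal be _ _ _ (dR_plus _ _ _ _ _ P3 P4)).
  unfold phase. eapply is_derive_val.
  - exact (dR_minus _ _ _ _ _ Q1 Q2).
  - cbv beta. generalize (angular_1 th) (angular_2 th). unfold dth, dphase. intros A1 A2.
    rewrite <- A1. replace (c01 th) with (- (SI (fun t1 t2 => leg n (sdot (erot e th) t1 t2) * Lv dv s 2 1 2 t1 t2) + INR n * Mth 1 th)) by (rewrite A2; ring).
    ring.
Qed.

Variable S1 : R.
Hypothesis HS1 : forall z, in_ball Rr z -> Rabs (v 0%nat z) <= S1.

(** Both contributions are put under one integral before estimating: the coefficients ([ca], [sa])
    form a unit vector, so Cauchy-Schwarz and [cross_norm] leave (1 - c^2) P'_n(c)^2, which Sonin's
    bound controls. *)
Lemma dphase_bound th : Rabs (dphase th) <= 4 * PI * (S1 * (INR n + / 2)).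
Proof.
  assert (Cs := v_cont2 Rr v dv Hr s 0 Hs).
  assert (Cd : cont2 (fun t1 t2 => dleg n (sdot (erot e th) t1 t2))).
  { intros a b. apply (cR_comp (dleg n) (fun q : R * R => sdot (erot e th) (fst q) (snd q))).
    - apply sdot_cont.
    - apply dleg_cont. }
  assert (C1 : forall i j, cont2 (fun t1 t2 => v 0%nat (sphpt s t1 t2) * (dleg n (sdot (erot e th) t1 t2) * cross (erot e th) i j t1 t2))).
  { intros i j. apply cont2_mult; [exact Cs|apply cont2_mult; [exact Cd|apply cross_cont]]. }
  unfold dphase, c02, c01.
  rewrite <- !SI_scal, <- SI_plus by auto using cont2_scal.
  apply SI_abs_le; [auto using cont2_plus, cont2_scal|].
  intros t1 t2.
  set (ca := al * cos (INR n * th) - be * sin (INR n * th)).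
  set (sa := al * sin (INR n * th) + be * cos (INR n * th)).
  assert (Eu : ca ^ 2 + sa ^ 2 = 1).
  { unfold ca, sa. generalize (sin2_cos2 (INR n * th)). unfold Rsqr. intros E.
    transitivity ((al ^ 2 + be ^ 2) * (sin (INR n * th) * sin (INR n * th) + cos (INR n * th) * cos (INR n * th))); [ring|].
    rewrite E, Hab. ring. }
  set (x := cross (erot e th) 0 2 t1 t2). set (y := cross (erot e th) 0 1 t1 t2).
  set (d := dleg n (sdot (erot e th) t1 t2)).
  replace (ca * (v 0%nat (sphpt s t1 t2) * (d * x)) + sa * (v 0%nat (sphpt s t1 t2) * (d * y))) with
    (v 0%nat (sphpt s t1 t2) * (d * (ca * x + sa * y))) by ring.
  rewrite Rabs_mult. apply Rmult_le_compat; try apply Rabs_pos.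
  - apply HS1, sphere_in_ball, Hs.
  - assert (Hn := pos_INR n). rewrite <- (Rabs_right (INR n + / 2)) by lra.
    apply Rsqr_le_abs_0. unfold Rsqr.
    generalize (cross_norm (erot e th) t1 t2 (erot_unit e th He)) (dleg_bound n (sdot (erot e th) t1 t2) (sdot_unit _ t1 t2 (erot_unit e th He))).
    fold x y d. intros X1 X2.
    assert (X3 : (ca * x + sa * y) ^ 2 <= 1 - sdot (erot e th) t1 t2 ^ 2).
    { apply Rle_trans with ((ca ^ 2 + sa ^ 2) * (x ^ 2 + y ^ 2)); [|rewrite Eu; lra].
      generalize (pow2_ge_0 (ca * y - sa * x)). nra. }
    apply Rle_trans with ((1 - sdot (erot e th) t1 t2 ^ 2) * d ^ 2); [|lra].
    replace (d * (ca * x + sa * y) * (d * (ca * x + sa * y))) with ((ca * x + sa * y) ^ 2 * d ^ 2) by ring.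
    apply Rmult_le_compat_r; [apply pow2_ge_0|exact X3].
Qed.
End Theta.

(* The average of |t| over (-pi,pi) is pi/2 <= 2. *)
Lemma mean_deviation (f df : R -> R) (K : R) :
  (forall t, is_derive f t (df t)) -> (forall t, Rabs (df t) <= K) ->
  f 0 - / (2 * PI) * RInt f (- PI) PI <= 2 * K.
Proof.
  intros Hd HK. generalize PI_RGT_0 PI_4; intros Hpi H4.
  assert (K0 : 0 <= K) by (apply Rle_trans with (2 := HK 0); apply Rabs_pos).
  assert (Cf : forall t, continuous f t).
  { intros t. apply (ex_derive_continuous (V := R_NormedModule)). exists (df t). apply Hd. }
  assert (Lip : forall t, f 0 - K * Rabs t <= f t).
  { intros t. destruct (MVT_gen f 0 t df) as [c [_ E]].
    - intros; apply Hd.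
    - intros u _. apply continuity_pt_filterlim, Cf.
    - assert (Rabs (f t - f 0) <= K * Rabs t).
      { rewrite E, Rabs_mult, Rminus_0_r. apply Rmult_le_compat_r; [apply Rabs_pos|apply HK]. }
      apply Rabs_le_between in H. lra. }
  assert (Ca : forall t, continuous (fun t => f 0 - K * Rabs t) t) by (intros; cont).
  assert (I1 : RInt (fun t => f 0 - K * Rabs t) (- PI) PI <= RInt f (- PI) PI).
  { apply RInt_le; [lra|apply ex_RInt_contR, Ca|apply ex_RInt_contR, Cf|intros; apply Lip]. }
  assert (I2 : RInt (fun t => f 0 - K * Rabs t) (- PI) PI = 2 * PI * f 0 - K * PI ^ 2).
  { rewrite <- (RInt_Chasles (V := R_CompleteNormedModule) _ (- PI) 0 PI) by (apply ex_RInt_contR, Ca).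
    rewrite (RInt_ext _ (fun t => f 0 + K * t) (- PI) 0).
    2:{ intros t Ht. rewrite Rmin_left, Rmax_right in Ht by lra. rewrite Rabs_left by lra. toR. ring. }
    rewrite (RInt_ext (fun t => f 0 - K * Rabs t) (fun t => f 0 - K * t) 0 PI).
    2:{ intros t Ht. rewrite Rmin_left, Rmax_right in Ht by lra. rewrite Rabs_right by lra. reflexivity. }
    rewrite (RInt_deriveR (fun t => f 0 * t + K * t ^ 2 / 2) (fun t => f 0 + K * t)).
    - rewrite (RInt_deriveR (fun t => f 0 * t - K * t ^ 2 / 2) (fun t => f 0 - K * t)).
      + unfold plus; simpl. toR. field.
      + intros t. auto_derive; [trivial|field].
      + intros t. cont.
    - intros t. auto_derive; [trivial|field].
    - intros t. cont. }
  rewrite I2 in I1.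
  apply (Rmult_le_reg_l (2 * PI)); [lra|].
  replace (2 * PI * (f 0 - / (2 * PI) * RInt f (- PI) PI)) with (2 * PI * f 0 - RInt f (- PI) PI) by (field; lra).
  assert (0 <= K * PI * (4 - PI)).
  { apply Rmult_le_pos; [apply Rmult_le_pos|]; lra. }
  nra.
Qed.

(** * Angular means of Legendre polynomials *)

(** Both orders of the limits are covered because the upper one will be varied freely in
    [SI_fubini]. *)
Lemma cont2_RInt (h : R -> R -> R -> R) a u :
  (forall th t1 t2, continuous (fun q : R * R * R => h (fst (fst q)) (snd (fst q)) (snd q)) (th, t1, t2)) ->
  cont2 (fun t1 t2 => RInt (fun th => h th t1 t2) a u).
Proof.
  intros H.
  assert (Hex : forall a b t1 t2, ex_RInt (fun th => h th t1 t2) a b).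
  { intros a' b' t1 t2. apply ex_RInt_contR. intros th.
    apply (continuous_comp (fun th : R => (th, t1, t2)) (fun q : R * R * R => h (fst (fst q)) (snd (fst q)) (snd q))).
    - cont.
    - apply H. }
  assert (Le : forall a b, a <= b -> cont2 (fun t1 t2 => RInt (fun th => h th t1 t2) a b)).
  { intros a' b' Hab t1 t2.
    apply (continuous_RInt_param (fun (q : R * R) th => h th (fst q) (snd q))).
    - exact Hab.
    - intros y _.
      apply (continuous_comp (fun q : R * R * R => (snd q, fst (fst q), snd (fst q)))
        (fun q : R * R * R => h (fst (fst q)) (snd (fst q)) (snd q))).
      + cont.
      + apply H.
    - apply filter_forall. intros q. apply Hex. }
  destruct (Rle_dec a u) as [L|L]; [apply Le, L|].
  intros t1 t2.
  apply (continuous_ext (fun q : R * R => - RInt (fun th => h th (fst q) (snd q)) u a)).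
  - intros q. apply (opp_RInt_swap (V := R_CompleteNormedModule)). apply Hex.
  - apply cR_opp. apply Le. lra.
Qed.

(** As functions of the upper limit both sides have the derivative [SI (h u)] and both vanish at
    [u = a]. *)
Lemma SI_fubini (h : R -> R -> R -> R) a b :
  (forall th t1 t2, continuous (fun q : R * R * R => h (fst (fst q)) (snd (fst q)) (snd q)) (th, t1, t2)) ->
  RInt (fun th => SI (h th)) a b = SI (fun t1 t2 => RInt (fun th => h th t1 t2) a b) :> R.
Proof.
  intros H.
  assert (Ch : forall th, cont2 (h th)).
  { intros th t1 t2. apply (continuous_comp (fun q : R * R => (th, fst q, snd q))
      (fun q : R * R * R => h (fst (fst q)) (snd (fst q)) (snd q))); [cont|apply H]. }
  assert (Ct : forall t1 t2 th, continuous (fun th => h th t1 t2) th).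
  { intros t1 t2 th. apply (continuous_comp (fun th : R => (th, t1, t2))
      (fun q : R * R * R => h (fst (fst q)) (snd (fst q)) (snd q))); [cont|apply H]. }
  assert (D : forall u, is_derive (fun u => SI (fun t1 t2 => RInt (fun th => h th t1 t2) a u)) u (SI (h u))).
  { intros u. apply (SI_derive (fun u t1 t2 => RInt (fun th => h th t1 t2) a u) h).
    - apply filter_forall. intros y t1 t2.
      apply (is_derive_RInt (V := R_NormedModule) (fun th => h th t1 t2) (fun u => RInt (fun th => h th t1 t2) a u) a y).
      + apply filter_forall. intros w. apply (RInt_correct (V := R_CompleteNormedModule)), ex_RInt_contR. apply Ct.
      + apply Ct.
    - intros t1 t2. apply H.
    - apply filter_forall. intros y. apply cont2_RInt, H.
    - apply Ch. }
  rewrite (RInt_deriveR _ (fun u => SI (h u)) a b D).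
  - rewrite (SI_ext (fun t1 t2 => RInt (fun th => h th t1 t2) a a) (fun _ _ => 0)).
    + rewrite SI_const. ring.
    + intros t1 t2. apply (RInt_point (V := R_CompleteNormedModule)).
  - intros u. apply SI_continuous.
    + intros t1 t2. apply H.
    + apply filter_forall. exact Ch.
Qed.

(** * Powers of p + iq and the top Fourier mode of a Legendre polynomial *)

Fixpoint zpow (n : nat) (p q : R) : R * R :=
  match n with
  | O => (1, 0)
  | S m => let '(a, b) := zpow m p q in (p * a - q * b, p * b + q * a)
  end.
Definition zre n p q := fst (zpow n p q).
Definition zim n p q := snd (zpow n p q).

Lemma zre_S n p q : zre (S n) p q = p * zre n p q - q * zim n p q.
Proof. unfold zre, zim; simpl. destruct (zpow n p q); reflexivity. Qed.
Lemma zim_S n p q : zim (S n) p q = p * zim n p q + q * zre n p q.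
Proof. unfold zre, zim; simpl. destruct (zpow n p q); reflexivity. Qed.

(** Multiplicativity of the n-th power on (a + ib)(c - id). *)
Lemma zpow_conj_mult n a b c d :
  zre n (a * c + b * d) (b * c - a * d) = zre n a b * zre n c d + zim n a b * zim n c d /\
  zim n (a * c + b * d) (b * c - a * d) = zim n a b * zre n c d - zre n a b * zim n c d.
Proof.
  induction n as [|n [I1 I2]].
  - unfold zre, zim; simpl. split; ring.
  - rewrite !zre_S, !zim_S, I1, I2. split; ring.
Qed.

Lemma zpow_scal n k p q : zre n (k * p) (k * q) = k ^ n * zre n p q /\ zim n (k * p) (k * q) = k ^ n * zim n p q.
Proof.
  induction n as [|n [I1 I2]].
  - unfold zre, zim; simpl. split; ring.
  - rewrite !zre_S, !zim_S, I1, I2. simpl. split; ring.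
Qed.

Lemma zpow_10 n : zre n 1 0 = 1 /\ zim n 1 0 = 0.
Proof.
  induction n as [|n [I1 I2]]; [split; reflexivity|].
  rewrite zre_S, zim_S, I1, I2. split; ring.
Qed.

Lemma zpow_norm n p q : zre n p q ^ 2 + zim n p q ^ 2 = (p ^ 2 + q ^ 2) ^ n.
Proof.
  induction n as [|n I].
  - unfold zre, zim; simpl; ring.
  - rewrite zre_S, zim_S. rewrite <- (tech_pow_Rmult (p ^ 2 + q ^ 2)), <- I. ring.
Qed.

(** The binomial coefficient (2n choose n) divided by 4^n: the leading coefficient of P_n times the
    weight 2^(-n) of e^(i n th) in cos^n th. *)
Fixpoint kap (n : nat) : R :=
  match n with O => 1 | S m => (2 * INR m + 1) / (INR m + 1) * / 2 * kap m end.

Section Modes.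
Variables a p q : R.
Let c th := a + p * cos th - q * sin th.
Let Ic n N : R := RInt (fun th => cos (INR N * th) * leg n (c th)) (- PI) PI.
Let Is n N : R := RInt (fun th => sin (INR N * th) * leg n (c th)) (- PI) PI.

Let c_cont th : continuous c th.
Proof. unfold c. cont. Qed.
Let lc_cont n th : continuous (fun t => leg n (c t)) th.
Proof. apply (cR_comp (leg n) c); [apply c_cont|apply leg_cont]. Qed.
Let Ic_ex n N : ex_RInt (fun th => cos (INR N * th) * leg n (c th)) (- PI) PI.
Proof. apply ex_RInt_contR. intros th. assert (C := lc_cont n th). cont. Qed.
Let Is_ex n N : ex_RInt (fun th => sin (INR N * th) * leg n (c th)) (- PI) PI.
Proof. apply ex_RInt_contR. intros th. assert (C := lc_cont n th). cont. Qed.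

Let cos_mode N : RInt (fun th => cos (INR (S N) * th)) (- PI) PI = 0 :> R /\ RInt (fun th => sin (INR (S N) * th)) (- PI) PI = 0 :> R.
Proof.
  assert (P : INR (S N) <> 0) by (apply not_0_INR; lia).
  assert (Sp : sin (INR (S N) * PI) = 0) by (apply sin_eq_0_1; exists (Z.of_nat (S N)); rewrite INR_IZR_INZ; reflexivity).
  revert P Sp. generalize (INR (S N)). intros m P Sp.
  split.
  - rewrite (RInt_deriveR (fun th => sin (m * th) / m)).
    + rewrite Ropp_mult_distr_r_reverse, sin_neg, Sp. field. exact P.
    + intros x. auto_derive; [trivial|]. field. exact P.
    + intros x. cont.
  - rewrite (RInt_deriveR (fun th => - cos (m * th) / m)).
    + rewrite Ropp_mult_distr_r_reverse, cos_neg. field. exact P.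
    + intros x. auto_derive; [trivial|]. field. exact P.
    + intros x. cont.
Qed.

(** Multiplication by [c], which is a plus the real part of (p + iq) e^(i th), moves Fourier modes
    by at most one. *)
Let mul_c n N : 
  RInt (fun th => cos (INR (S N) * th) * (c th * leg n (c th))) (- PI) PI =
    a * Ic n (S N) + / 2 * (p * Ic n N + q * Is n N) + / 2 * (p * Ic n (S (S N)) - q * Is n (S (S N))) :> R /\
  RInt (fun th => sin (INR (S N) * th) * (c th * leg n (c th))) (- PI) PI =
    a * Is n (S N) + / 2 * (p * Is n N - q * Ic n N) + / 2 * (p * Is n (S (S N)) + q * Ic n (S (S N))) :> R.
Proof.
  assert (E1 : forall t, INR N * t = INR (S N) * t - t) by (intros; rewrite S_INR; ring).
  assert (E2 : forall t, INR (S (S N)) * t = INR (S N) * t + t) by (intros; rewrite (S_INR (S N)); ring).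
  assert (Sc : forall k f, ex_RInt f (- PI) PI -> ex_RInt (fun t => k * f t : R) (- PI) PI).
  { intros k f Hf. apply (ex_RInt_scal (V := R_NormedModule) f _ _ k Hf). }
  assert (Pl : forall f g, ex_RInt f (- PI) PI -> ex_RInt g (- PI) PI -> ex_RInt (fun t => f t + g t : R) (- PI) PI).
  { intros f g Hf Hg. apply (ex_RInt_plus (V := R_NormedModule) f g _ _ Hf Hg). }
  assert (Comb : forall k1 k2 k3 k4 k5 f1 f2 f3 f4 f5, ex_RInt f1 (- PI) PI -> ex_RInt f2 (- PI) PI ->
    ex_RInt f3 (- PI) PI -> ex_RInt f4 (- PI) PI -> ex_RInt f5 (- PI) PI ->
    RInt (fun t => k1 * f1 t + k2 * f2 t + k3 * f3 t + k4 * f4 t + k5 * f5 t) (- PI) PI =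
    k1 * RInt f1 (- PI) PI + k2 * RInt f2 (- PI) PI + k3 * RInt f3 (- PI) PI + k4 * RInt f4 (- PI) PI
     + k5 * RInt f5 (- PI) PI :> R).
  { intros k1 k2 k3 k4 k5 f1 f2 f3 f4 f5 X1 X2 X3 X4 X5.
    rewrite !RInt_plusR, !RInt_scalR by auto. reflexivity. }
  split.
  - transitivity (a * Ic n (S N) + (/ 2 * p) * Ic n N + (/ 2 * q) * Is n N + (/ 2 * p) * Ic n (S (S N)) + (- / 2 * q) * Is n (S (S N))); [|ring].
    unfold Ic, Is. rewrite <- Comb by auto. apply RInt_extR. intros t.
    rewrite (E1 t), (E2 t). unfold c at 1. rewrite cos_minus, sin_minus, cos_plus, sin_plus. field.
  - transitivity (a * Is n (S N) + (/ 2 * p) * Is n N + (- / 2 * q) * Ic n N + (/ 2 * p) * Is n (S (S N)) + (/ 2 * q) * Ic n (S (S N))); [|ring].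
    unfold Ic, Is. rewrite <- Comb by auto. apply RInt_extR. intros t.
    rewrite (E1 t), (E2 t). unfold c at 1. rewrite cos_minus, sin_minus, cos_plus, sin_plus. field.
Qed.

(** P_n of a trigonometric polynomial of degree 1 has no mode above n, and its mode n is
    proportional to (p + iq)^n. *)
Let good n := (forall N, (n < N)%nat -> Ic n N = 0 /\ Is n N = 0) /\
  Ic n n = 2 * PI * kap n * zre n p q /\ - Is n n = 2 * PI * kap n * zim n p q.

(** [R1] is Bonnet's recurrence on the modes above n, where P_(n-1) contributes nothing; so only the
    product with [c] has to be followed. *)
Let good_step n (R1 : forall N, (n < N)%nat -> 
   Ic (S n) N = (2 * INR n + 1) / (INR n + 1) * RInt (fun th => cos (INR N * th) * (c th * leg n (c th))) (- PI) PI /\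
   Is (S n) N = (2 * INR n + 1) / (INR n + 1) * RInt (fun th => sin (INR N * th) * (c th * leg n (c th))) (- PI) PI) :
  good n -> good (S n).
Proof.
  intros [Z [G1 G2]]. split.
  - intros N HN. destruct N as [|N]; [lia|]. destruct (R1 (S N) ltac:(lia)) as [-> ->].
    destruct (mul_c n N) as [-> ->].
    destruct (Z N ltac:(lia)) as [-> ->]. destruct (Z (S N) ltac:(lia)) as [-> ->]. destruct (Z (S (S N)) ltac:(lia)) as [-> ->].
    split; ring.
  - destruct (R1 (S n) ltac:(lia)) as [-> ->].
    destruct (mul_c n n) as [-> ->].
    destruct (Z (S n) ltac:(lia)) as [-> ->]. destruct (Z (S (S n)) ltac:(lia)) as [-> ->].
    replace (Is n n) with (- (2 * PI * kap n * zim n p q)) by lra. rewrite G1.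
    rewrite zre_S, zim_S. cbn [kap]. split; field; generalize (pos_INR n); lra.
Qed.

Lemma leg_modes n : good n.
Proof.
  assert (H : good n /\ good (S n)); [|apply H].
  assert (G0 : good 0).
  { split; [|split].
    - intros N HN. destruct N as [|N]; [lia|]. destruct (cos_mode N) as [C1 C2]. split.
      + rewrite <- C1. apply RInt_extR. intros t. rewrite leg_0. ring.
      + rewrite <- C2. apply RInt_extR. intros t. rewrite leg_0. ring.
    - unfold Ic. rewrite (RInt_extR _ (fun _ => 1)), RInt_constR.
      + unfold zre; simpl. ring.
      + intros t. rewrite leg_0. simpl INR. rewrite Rmult_0_l, cos_0. ring.
    - unfold Is. rewrite (RInt_extR _ (fun _ => 0)), RInt_constR.
      + unfold zim; simpl. ring.
      + intros t. rewrite leg_0. simpl INR. rewrite Rmult_0_l, sin_0. ring. }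
  induction n as [|n [IH1 IH2]].
  - split; [exact G0|]. apply good_step; [|exact G0].
    intros N HN. simpl INR. replace ((2 * 0 + 1) / (0 + 1)) with 1 by field. rewrite !Rmult_1_l. split; apply RInt_extR;
    intros t; rewrite leg_0, leg_1; ring.
  - split; [exact IH2|]. apply good_step; [|exact IH2].
    intros N HN. destruct IH1 as [Z _]. destruct (Z N ltac:(lia)) as [Z1 Z2].
    assert (P := INR2_pos n).
    assert (Ec : ex_RInt (fun th => cos (INR N * th) * (c th * leg (S n) (c th))) (- PI) PI).
    { apply ex_RInt_contR. intros th. assert (C := lc_cont (S n) th). assert (C' := c_cont th). cont. }
    assert (Es : ex_RInt (fun th => sin (INR N * th) * (c th * leg (S n) (c th))) (- PI) PI).
    { apply ex_RInt_contR. intros th. assert (C := lc_cont (S n) th). assert (C' := c_cont th). cont. }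
    assert (Sc : forall k f, ex_RInt f (- PI) PI -> ex_RInt (fun t => k * f t : R) (- PI) PI).
    { intros k f Hf. apply (ex_RInt_scal (V := R_NormedModule) f _ _ k Hf). }
    split.
    + transitivity ((2 * INR (S n) + 1) / (INR (S n) + 1) * RInt (fun th => cos (INR N * th) * (c th * leg (S n) (c th))) (- PI) PI
        - (INR n + 1) / (INR n + 2) * Ic n N); [|rewrite Z1; ring].
      unfold Ic. rewrite <- !RInt_scalR, <- RInt_minusR by auto. apply RInt_extR. intros t.
      rewrite leg_SS, S_INR. field. repeat split; lra.
    + transitivity ((2 * INR (S n) + 1) / (INR (S n) + 1) * RInt (fun th => sin (INR N * th) * (c th * leg (S n) (c th))) (- PI) PI
        - (INR n + 1) / (INR n + 2) * Is n N); [|rewrite Z2; ring].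
      unfold Is. rewrite <- !RInt_scalR, <- RInt_minusR by auto. apply RInt_extR. intros t.
      rewrite leg_SS, S_INR. field. repeat split; lra.
Qed.

Lemma leg_mode_cos n : RInt (fun th => cos (INR n * th) * leg n (a + p * cos th - q * sin th)) (- PI) PI = 2 * PI * kap n * zre n p q :> R.
Proof. apply (leg_modes n). Qed.
Lemma leg_mode_sin n : RInt (fun th => sin (INR n * th) * leg n (a + p * cos th - q * sin th)) (- PI) PI = - (2 * PI * kap n * zim n p q) :> R.
Proof. rewrite <- (proj2 (proj2 (leg_modes n))). rewrite Ropp_involutive. reflexivity. Qed.
End Modes.

(** * The mean of the phase *)

Section MeanPhase.
Variables (Rr : R) (v : nat -> pt -> R) (dv : nat -> nat -> pt -> R).
Hypothesis Hr : riesz Rr v dv.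
Variable n : nat.

Definition wre t1 t2 := zre n (om 1 t1 t2) (om 2 t1 t2).
Definition wim t1 t2 := zim n (om 1 t1 t2) (om 2 t1 t2).

Lemma zpow_cont m (f g : R -> R -> R) : cont2 f -> cont2 g ->
  cont2 (fun a b => zre m (f a b) (g a b)) /\ cont2 (fun a b => zim m (f a b) (g a b)).
Proof.
  intros Hf Hg. induction m as [|m [I1 I2]].
  - split; intros a b; apply continuous_const.
  - split; intros a b.
    + apply (continuous_ext (fun q : R * R => f (fst q) (snd q) * zre m (f (fst q) (snd q)) (g (fst q) (snd q))
         - g (fst q) (snd q) * zim m (f (fst q) (snd q)) (g (fst q) (snd q)))).
      * intros q. rewrite zre_S. reflexivity.
      * assert (X1 := I1 a b). assert (X2 := I2 a b). cbv beta in *. cont.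
    + apply (continuous_ext (fun q : R * R => f (fst q) (snd q) * zim m (f (fst q) (snd q)) (g (fst q) (snd q))
         + g (fst q) (snd q) * zre m (f (fst q) (snd q)) (g (fst q) (snd q)))).
      * intros q. rewrite zim_S. reflexivity.
      * assert (X1 := I1 a b). assert (X2 := I2 a b). cbv beta in *. cont.
Qed.

Lemma wre_cont : cont2 wre. Proof. apply (zpow_cont n (om 1) (om 2)); apply om_cont. Qed.
Lemma wim_cont : cont2 wim. Proof. apply (zpow_cont n (om 1) (om 2)); apply om_cont. Qed.

(* Real and imaginary part of the spherical integral of (v1 - i v2) times the
   conjugate of w^n, w = om1 + i om2. *)
Definition mre s := SI (fun t1 t2 => v 1%nat (sphpt s t1 t2) * wre t1 t2 - v 2%nat (sphpt s t1 t2) * wim t1 t2).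
Definition mim s := - SI (fun t1 t2 => v 1%nat (sphpt s t1 t2) * wim t1 t2 + v 2%nat (sphpt s t1 t2) * wre t1 t2).

Section Fixed.
Variable s : R.
Hypothesis Hs : 0 < s < Rr.
Variable e : nat -> R.

Let trig_swap (tr : R -> R) k : (forall t, continuous tr t) ->
  RInt (fun th => tr (INR n * th) * Mth v s n e k th) (- PI) PI =
  SI (fun t1 t2 => v k (sphpt s t1 t2) * RInt (fun th => tr (INR n * th) * leg n (sdot (erot e th) t1 t2)) (- PI) PI) :> R.
Proof.
  intros Ht.
  assert (Cs := v_cont2 Rr v dv Hr s k Hs).
  transitivity (RInt (fun th => SI (fun t1 t2 => tr (INR n * th) * (v k (sphpt s t1 t2) * leg n (sdot (erot e th) t1 t2)))) (- PI) PI).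
  - apply RInt_extR. intros th. unfold Mth, moment. rewrite SI_scal; [reflexivity|].
    apply cont2_mult; [exact Cs|apply leg_cont2].
  - rewrite (SI_fubini (fun th t1 t2 => tr (INR n * th) * (v k (sphpt s t1 t2) * leg n (sdot (erot e th) t1 t2)))).
    + apply SI_ext. intros t1 t2. rewrite <- RInt_scalR.
      * apply RInt_extR. intros; ring.
      * apply ex_RInt_contR. intros th.
        apply cR_mult; [apply (cR_comp tr (fun th => INR n * th)); [cont|apply Ht]|].
        apply (cR_comp (leg n) (fun th => sdot (erot e th) t1 t2)); [unfold sdot, erot; cont|apply leg_cont].
    + intros th t1 t2. apply cR_mult; [apply (cR_comp tr (fun q : R * R * R => INR n * fst (fst q))); [cont|apply Ht]|apply cR_mult].
      * apply (cont2_comp (fun a b => v k (sphpt s a b)) (fun q : R * R * R => snd (fst q)) (fun q => snd q)); [exact Cs|cont|cont].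
      * apply (cR_comp (leg n)); [apply sdot_erot_cont|apply leg_cont].
Qed.

(** The form a + p cos th - q sin th required for the Fourier modes, with p + iq = (e_1 + i
    e_2)(omega_1 - i omega_2). *)
Let sdot_erot th t1 t2 : sdot (erot e th) t1 t2 =
  e 0%nat * om 0 t1 t2 + (e 1%nat * om 1 t1 t2 + e 2%nat * om 2 t1 t2) * cos th
   - (e 2%nat * om 1 t1 t2 - e 1%nat * om 2 t1 t2) * sin th * (-1) * (-1) .
Proof. unfold sdot; cbn [erot]. ring. Qed.

Let cos_swap k : RInt (fun th => cos (INR n * th) * Mth v s n e k th) (- PI) PI =
  2 * PI * kap n * SI (fun t1 t2 => v k (sphpt s t1 t2) *
    (zre n (e 1%nat) (e 2%nat) * wre t1 t2 + zim n (e 1%nat) (e 2%nat) * wim t1 t2)) :> R.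
Proof.
  assert (Cs := v_cont2 Rr v dv Hr s k Hs). assert (C1 := wre_cont). assert (C2 := wim_cont).
  rewrite trig_swap by (intros; cont). rewrite <- SI_scal by (intros a b; cont; apply Cs).
  apply SI_ext. intros t1 t2.
  rewrite (RInt_extR _ (fun th => cos (INR n * th) * leg n (e 0%nat * om 0 t1 t2 + (e 1%nat * om 1 t1 t2 + e 2%nat * om 2 t1 t2) * cos th
   - (e 2%nat * om 1 t1 t2 - e 1%nat * om 2 t1 t2) * sin th))).
  - rewrite leg_mode_cos. rewrite (proj1 (zpow_conj_mult n _ _ _ _)). unfold wre, wim. ring.
  - intros th. rewrite sdot_erot. do 2 f_equal. ring.
Qed.

Let sin_swap k : RInt (fun th => sin (INR n * th) * Mth v s n e k th) (- PI) PI =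
  - (2 * PI * kap n * SI (fun t1 t2 => v k (sphpt s t1 t2) *
    (zim n (e 1%nat) (e 2%nat) * wre t1 t2 - zre n (e 1%nat) (e 2%nat) * wim t1 t2))) :> R.
Proof.
  assert (Cs := v_cont2 Rr v dv Hr s k Hs). assert (C1 := wre_cont). assert (C2 := wim_cont).
  rewrite trig_swap by (intros; cont). rewrite <- Ropp_mult_distr_l_reverse, <- SI_scal by (intros a b; cont; apply Cs).
  apply SI_ext. intros t1 t2.
  rewrite (RInt_extR _ (fun th => sin (INR n * th) * leg n (e 0%nat * om 0 t1 t2 + (e 1%nat * om 1 t1 t2 + e 2%nat * om 2 t1 t2) * cos th
   - (e 2%nat * om 1 t1 t2 - e 1%nat * om 2 t1 t2) * sin th))).
  - rewrite leg_mode_sin. rewrite (proj2 (zpow_conj_mult n _ _ _ _)). unfold wre, wim. ring.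
  - intros th. rewrite sdot_erot. do 2 f_equal. ring.
Qed.

(** After exchanging the integrals, averaging against e^(-i n th) extracts the top mode of
    P_n(<e(th), omega>), namely kap n times (e_1 + i e_2)^n times the conjugate of w^n. The power of
    e comes out of the spherical integral, which leaves the complex number mre + i mim. *)
Lemma mean_phase al be : dot e e = 1 ->
  / (2 * PI) * RInt (phase v s n e al be) (- PI) PI =
  kap n * (al * (zre n (e 1%nat) (e 2%nat) * mre s - zim n (e 1%nat) (e 2%nat) * mim s)
         + be * (zre n (e 1%nat) (e 2%nat) * mim s + zim n (e 1%nat) (e 2%nat) * mre s)).
Proof.
  intros He. generalize PI_RGT_0; intros Hpi.
  assert (Cm : forall k th, continuous (Mth v s n e k) th).
  { intros k th. apply (ex_derive_continuous (V := R_NormedModule)).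
    eexists. apply (Mth_derive Rr v dv Hr s Hs n e k th). }
  assert (X1 : forall k, ex_RInt (fun th => cos (INR n * th) * Mth v s n e k th) (- PI) PI).
  { intros k. apply ex_RInt_contR. intros th. apply cR_mult; [cont|apply (Cm k th)]. }
  assert (X2 : forall k, ex_RInt (fun th => sin (INR n * th) * Mth v s n e k th) (- PI) PI).
  { intros k. apply ex_RInt_contR. intros th. apply cR_mult; [cont|apply (Cm k th)]. }
  assert (Sc : forall k f, ex_RInt f (- PI) PI -> ex_RInt (fun t => k * f t : R) (- PI) PI).
  { intros k f Hf. apply (ex_RInt_scal (V := R_NormedModule) f _ _ k Hf). }
  assert (Pl : forall f g, ex_RInt f (- PI) PI -> ex_RInt g (- PI) PI -> ex_RInt (fun t => f t + g t : R) (- PI) PI).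
  { intros f g Hf Hg. apply (ex_RInt_plus (V := R_NormedModule) f g _ _ Hf Hg). }
  rewrite (RInt_extR _ (fun th => al * (cos (INR n * th) * Mth v s n e 1 th) + (- al) * (sin (INR n * th) * Mth v s n e 2 th)
    + (- be) * (sin (INR n * th) * Mth v s n e 1 th) + (- be) * (cos (INR n * th) * Mth v s n e 2 th)))
    by (intros; unfold phase; ring).
  rewrite !RInt_plusR, !RInt_scalR by auto.
  rewrite !cos_swap, !sin_swap.
  assert (V1 := v_cont2 Rr v dv Hr s 1 Hs). assert (V2 := v_cont2 Rr v dv Hr s 2 Hs).
  assert (W1 := wre_cont). assert (W2 := wim_cont).
  unfold mre, mim.
  assert (Y : forall k x y, cont2 (fun t1 t2 => v k (sphpt s t1 t2)) ->
     SI (fun t1 t2 => v k (sphpt s t1 t2) * (x * wre t1 t2 + y * wim t1 t2)) =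
     x * SI (fun t1 t2 => v k (sphpt s t1 t2) * wre t1 t2) + y * SI (fun t1 t2 => v k (sphpt s t1 t2) * wim t1 t2)).
  { intros k x y Ck.
    rewrite <- !SI_scal by (apply cont2_mult; assumption).
    rewrite <- SI_plus by (apply cont2_scal, cont2_mult; assumption).
    apply SI_ext; intros; ring. }
  assert (Y' : forall k x y, cont2 (fun t1 t2 => v k (sphpt s t1 t2)) ->
     SI (fun t1 t2 => v k (sphpt s t1 t2) * (x * wre t1 t2 - y * wim t1 t2)) =
     x * SI (fun t1 t2 => v k (sphpt s t1 t2) * wre t1 t2) - y * SI (fun t1 t2 => v k (sphpt s t1 t2) * wim t1 t2)).
  { intros k x y Ck. rewrite (SI_ext _ (fun t1 t2 => v k (sphpt s t1 t2) * (x * wre t1 t2 + (- y) * wim t1 t2))) by (intros; ring).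
    rewrite Y by assumption. ring. }
  rewrite !Y, !Y' by assumption.
  rewrite SI_minus, SI_plus by (apply cont2_mult; assumption).
  field. lra.
Qed.
End Fixed.

(** For e the unit vector of the x_1-axis the power of e is 1, so the choices (1, 0) and (0, 1) of
    ([al], [be]) isolate the two numbers, and homogeneity is inherited from [moment_homog]. *)
Lemma moments_homog s1 s2 : 0 < s1 < Rr -> 0 < s2 < Rr -> kap n <> 0 ->
  mre s1 / s1 ^ n = mre s2 / s2 ^ n /\ mim s1 / s1 ^ n = mim s2 / s2 ^ n.
Proof.
  intros H1 H2 Hk. generalize PI_RGT_0; intros Hpi.
  pose (e := fun i : nat => match i with 1%nat => 1 | _ => 0 end).
  assert (He : dot e e = 1) by (unfold dot, e; ring).
  destruct (zpow_10 n) as [Z1 Z2].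
  assert (Q : forall al be, kap n * (al * mre s1 + be * mim s1) / s1 ^ n = kap n * (al * mre s2 + be * mim s2) / s2 ^ n).
  { intros al be.
    generalize (mean_phase s1 H1 e al be He) (mean_phase s2 H2 e al be He).
    change (e 1%nat) with 1. change (e 2%nat) with 0. rewrite Z1, Z2. intros E1 E2.
    replace (al * mre s1 + be * mim s1) with (al * (1 * mre s1 - 0 * mim s1) + be * (1 * mim s1 + 0 * mre s1)) by ring.
    replace (al * mre s2 + be * mim s2) with (al * (1 * mre s2 - 0 * mim s2) + be * (1 * mim s2 + 0 * mre s2)) by ring.
    rewrite <- E1, <- E2.
    assert (E : RInt (phase v s1 n e al be) (- PI) PI = s1 ^ n / s2 ^ n * RInt (phase v s2 n e al be) (- PI) PI).
    { rewrite <- RInt_scalR.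
      - apply RInt_extR. intros th. unfold phase, Mth.
        assert (M : forall k, (k <= 2)%nat -> moment v k s1 (erot e th) n = s1 ^ n / s2 ^ n * moment v k s2 (erot e th) n).
        { intros k Hk'. generalize (moment_homog Rr v dv Hr k s1 s2 (erot e th) n Hk' H1 H2 (erot_unit e th He)). intros E.
          transitivity (s1 ^ n * (moment v k s1 (erot e th) n / s1 ^ n)); [field; apply pow_nonzero; lra|].
          rewrite E. field. apply pow_nonzero. lra. }
        rewrite !M by lia. ring.
      - apply ex_RInt_contR. intros th. apply (ex_derive_continuous (V := R_NormedModule)). eexists.
        apply (phase_derive Rr v dv Hr s2 H2 n e He al be th). }
    rewrite E. field. repeat split; try lra; apply pow_nonzero; lra. }
  split.
  - generalize (Q 1 0). intros E. apply (Rmult_eq_reg_l (kap n)); [|exact Hk].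
    transitivity (kap n * (1 * mre s1 + 0 * mim s1) / s1 ^ n); [field; apply pow_nonzero; lra|].
    rewrite E. field. apply pow_nonzero; lra.
  - generalize (Q 0 1). intros E. apply (Rmult_eq_reg_l (kap n)); [|exact Hk].
    transitivity (kap n * (0 * mre s1 + 1 * mim s1) / s1 ^ n); [field; apply pow_nonzero; lra|].
    rewrite E. field. apply pow_nonzero; lra.
Qed.
End MeanPhase.

(** * The hyperholomorphic constants *)

Lemma nth_padd p q i : nth i (padd p q) 0 = nth i p 0 + nth i q 0.
Proof.
  revert q i; induction p as [|a p IH]; intros [|b q] [|i]; simpl; try ring.
  apply IH.
Qed.
Lemma length_padd p q : length (padd p q) = Nat.max (length p) (length q).
Proof. revert q; induction p as [|a p IH]; intros [|b q]; simpl; auto. Qed.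
Lemma nth_pscale k p i : nth i (pscale k p) 0 = k * nth i p 0.
Proof. revert i; induction p as [|a p IH]; intros [|i]; simpl; try ring. apply IH. Qed.
Lemma length_pscale k p : length (pscale k p) = length p.
Proof. apply length_map. Qed.
Lemma nth_pderiv_aux k p i : nth i (pderiv_aux k p) 0 = INR (k + i) * nth i p 0.
Proof.
  revert k i; induction p as [|a p IH]; intros k [|i]; simpl nth; try ring.
  - rewrite Nat.add_0_r. reflexivity.
  - rewrite IH. f_equal. f_equal. lia.
Qed.
Lemma length_pderiv_aux k p : length (pderiv_aux k p) = length p.
Proof. revert k; induction p as [|a p IH]; intros k; simpl; auto. Qed.

(** The bound on the length excludes higher coefficients, so that n derivatives of a polynomial of
    degree n leave a single constant. *)
Definition has_degree (d : nat) (p : list R) : Prop := (length p <= S d)%nat /\ nth d p 0 <> 0.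

Lemma has_degree_pder d p : has_degree (S d) p -> has_degree d (pder p).
Proof.
  intros [L N]. destruct p as [|a p]; [simpl in N; lra|]. simpl in L, N. unfold pder. split.
  - rewrite length_pderiv_aux. lia.
  - rewrite nth_pderiv_aux. apply Rmult_integral_contrapositive_currified; [|exact N].
    apply not_0_INR. lia.
Qed.

Lemma has_degree_iter m d p : has_degree (m + d) p -> has_degree d (Nat.iter m pder p).
Proof.
  revert d; induction m as [|m IH]; intros d H; [exact H|].
  simpl. apply has_degree_pder, IH. replace (m + S d)%nat with (S m + d)%nat by lia. exact H.
Qed.

Lemma has_degree_pscale k d p : k <> 0 -> has_degree d p -> has_degree d (pscale k p).
Proof.
  intros Hk [L N]. split; [rewrite length_pscale; exact L|].
  rewrite nth_pscale. apply Rmult_integral_contrapositive_currified; assumption.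
Qed.

Lemma has_degree_ppow n : has_degree (n + n) (ppow [-1; 0; 1] n).
Proof.
  induction n as [|n [L N]]; [split; simpl; [lia|lra]|].
  replace (S n + S n)%nat with (S (S (n + n))) by lia. 
  change (ppow [-1; 0; 1] (S n)) with (pmul [-1; 0; 1] (ppow [-1; 0; 1] n)).
  revert L N. generalize (ppow [-1; 0; 1] n). intros q L N.
  cbn [pmul]. split.
  - repeat (rewrite length_padd || rewrite length_pscale || cbn [length]). lia.
  - rewrite nth_padd, nth_pscale. cbn [nth]. rewrite nth_padd, nth_pscale. cbn [nth].
    rewrite nth_padd, nth_pscale.
    rewrite (nth_overflow q 0 (n := S (S (n + n)))) by lia.
    rewrite (nth_overflow q 0 (n := S (n + n))) by lia.
    assert (Z : nth (n + n) [0] 0 = 0) by (destruct (n + n)%nat as [|[|k]]; reflexivity).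
    rewrite Z. lra.
Qed.

Lemma has_degree_0 p t : has_degree 0 p -> peval p t = nth 0 p 0.
Proof.
  intros [L _]. destruct p as [|a [|b p]]; simpl in *; [reflexivity|ring|lia].
Qed.

(** The constant n-th derivative of P_n. Its non-vanishing is all that is recorded, since X* <X*, f>
    does not change when X is rescaled. *)
Definition legtop (n : nat) : R := nth 0 (Nat.iter n pder (Legendre n)) 0.

Lemma legtop_spec n t : peval (Nat.iter n pder (Legendre n)) t = legtop n /\ legtop n <> 0.
Proof.
  assert (H : has_degree 0 (Nat.iter n pder (Legendre n))).
  { apply has_degree_iter. rewrite Nat.add_0_r. unfold Legendre. apply has_degree_pscale.
    - apply Rinv_neq_0_compat, Rmult_integral_contrapositive_currified.
      + apply pow_nonzero. lra.
      + apply INR_fact_neq_0.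
    - apply has_degree_iter, has_degree_ppow. }
  split; [apply has_degree_0, H|apply H].
Qed.

Lemma chebT2_eq n t : chebT2 n t = (chebT n t, chebT (S n) t).
Proof. unfold chebT. simpl. destruct (chebT2 n t); reflexivity. Qed.
Lemma chebT_SS n t : chebT (S (S n)) t = 2 * t * chebT (S n) t - chebT n t.
Proof. unfold chebT at 1. simpl. rewrite chebT2_eq. reflexivity. Qed.
Lemma chebU2_eq n t : chebU2 n t = (chebU n t, chebU (S n) t).
Proof. unfold chebU. simpl. destruct (chebU2 n t); reflexivity. Qed.
Lemma chebU_SS n t : chebU (S (S n)) t = 2 * t * chebU (S n) t - chebU n t.
Proof. unfold chebU at 1. simpl. rewrite chebU2_eq. reflexivity. Qed.

Lemma zre_SS n p q : zre (S (S n)) p q = 2 * p * zre (S n) p q - (p ^ 2 + q ^ 2) * zre n p q.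
Proof. rewrite !zre_S, zim_S. ring. Qed.
Lemma zim_SS n p q : zim (S (S n)) p q = 2 * p * zim (S n) p q - (p ^ 2 + q ^ 2) * zim n p q.
Proof. rewrite !zim_S, zre_S. ring. Qed.

Section Polar.
Variables p q rho : R.
Hypothesis Hrho : rho <> 0.
Hypothesis E : rho ^ 2 = p ^ 2 + q ^ 2.

(** With p = rho cos t these are rho^n cos(nt) = Re (p + iq)^n; both sides satisfy the same
    three-term recurrence. For U_n and the imaginary part the argument is the same. *)
Lemma cheb_zre n : rho ^ n * chebT n (p / rho) = zre n p q /\ rho ^ (S n) * chebT (S n) (p / rho) = zre (S n) p q.
Proof.
  induction n as [|n [I1 I2]].
  - unfold zre, chebT; simpl. split; [ring|field; exact Hrho].
  - split; [exact I2|]. rewrite zre_SS, <- I1, <- I2, <- E, chebT_SS. simpl. field. exact Hrho.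
Qed.
Lemma cheb_zim n : rho ^ S n * (q / rho * chebU n (p / rho)) = zim (S n) p q /\ rho ^ S (S n) * (q / rho * chebU (S n) (p / rho)) = zim (S (S n)) p q.
Proof.
  induction n as [|n [I1 I2]].
  - unfold zim, chebU; simpl. split; field; exact Hrho.
  - split; [exact I2|]. rewrite (zim_SS (S n)), <- I1, <- I2, <- E, chebU_SS. simpl. field. exact Hrho.
Qed.
End Polar.

Lemma zpow_00 n : zre (S n) 0 0 = 0 /\ zim (S n) 0 0 = 0.
Proof. rewrite zre_S, zim_S. split; ring. Qed.

(** r sin(theta_1) = rho; it persists at the origin, where the quotient is a default value but both
    sides are 0. *)
Lemma radial_factor a b c : norm3 (a, b, c) * sqrt (1 - (a / norm3 (a, b, c)) ^ 2) = sqrt (b ^ 2 + c ^ 2).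
Proof.
  unfold norm3. set (m := a ^ 2 + b ^ 2 + c ^ 2).
  assert (P : 0 <= b ^ 2 + c ^ 2) by (generalize (pow2_ge_0 b) (pow2_ge_0 c); lra).
  assert (M : 0 <= m) by (unfold m; generalize (pow2_ge_0 a); lra).
  destruct (Req_dec (sqrt m) 0) as [Z|Z].
  - rewrite Z, Rmult_0_l. apply sqrt_eq_0 in Z; [|exact M].
    replace (b ^ 2 + c ^ 2) with 0; [rewrite sqrt_0; reflexivity|].
    unfold m in Z. generalize (pow2_ge_0 a). lra.
  - assert (S0 : 0 < sqrt m) by (generalize (sqrt_pos m); lra).
    rewrite <- (sqrt_pow2 (sqrt m)) at 1 by lra.
    rewrite <- sqrt_mult_alt by apply pow2_ge_0. f_equal.
    replace (1 - (a / sqrt m) ^ 2) with ((sqrt m ^ 2 - a ^ 2) / sqrt m ^ 2) by (field; lra).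
    rewrite pow2_sqrt by exact M. unfold m. field.
    change (m <> 0). intros Q. rewrite Q, sqrt_0 in Z. lra.
Qed.

(** For l = n + 1 the Legendre factor is a constant times sin^(n+1) theta_1, so r^(n+1) combines
    with it to rho^(n+1). On the axis rho = 0 the argument of the Chebyshev polynomial is a default
    value, but the positive power makes both sides 0. *)
Lemma rU_top n a b c : rU (S n) (S n) (a, b, c) = legtop (S n) * zre (S n) b c.
Proof.
  unfold rU, assocP. rewrite (proj1 (legtop_spec (S n) _)).
  set (r := norm3 (a, b, c)). set (rho := sqrt (b ^ 2 + c ^ 2)).
  transitivity ((r * sqrt (1 - (a / r) ^ 2)) ^ S n * legtop (S n) * chebT (S n) (b / rho)).
  { rewrite Rpow_mult_distr. ring. }
  unfold r. rewrite radial_factor. fold rho.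
  assert (P : 0 <= b ^ 2 + c ^ 2) by (generalize (pow2_ge_0 b) (pow2_ge_0 c); lra).
  destruct (Req_dec rho 0) as [Z|Z].
  - rewrite Z. apply sqrt_eq_0 in Z; [|exact P].
    generalize (pow2_ge_0 b) (pow2_ge_0 c). intros.
    assert (b = 0) by nra. assert (c = 0) by nra. subst b c.
    rewrite (proj1 (zpow_00 n)). simpl. ring.
  - rewrite <- (proj2 (cheb_zre b c rho Z ltac:(unfold rho; rewrite pow2_sqrt by exact P; reflexivity) n)). ring.
Qed.

Lemma rV_top n a b c : rV (S n) (S n) (a, b, c) = legtop (S n) * zim (S n) b c.
Proof.
  unfold rV, assocP. rewrite (proj1 (legtop_spec (S n) _)).
  set (r := norm3 (a, b, c)). set (rho := sqrt (b ^ 2 + c ^ 2)).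
  replace (S n - 1)%nat with n by lia.
  transitivity ((r * sqrt (1 - (a / r) ^ 2)) ^ S n * legtop (S n) * (c / rho * chebU n (b / rho))).
  { rewrite Rpow_mult_distr. ring. }
  unfold r. rewrite radial_factor. fold rho.
  assert (P : 0 <= b ^ 2 + c ^ 2) by (generalize (pow2_ge_0 b) (pow2_ge_0 c); lra).
  destruct (Req_dec rho 0) as [Z|Z].
  - rewrite Z. apply sqrt_eq_0 in Z; [|exact P].
    generalize (pow2_ge_0 b) (pow2_ge_0 c). intros.
    assert (b = 0) by nra. assert (c = 0) by nra. subst b c.
    rewrite (proj2 (zpow_00 n)). simpl. ring.
  - rewrite <- (proj1 (cheb_zim b c rho Z ltac:(unfold rho; rewrite pow2_sqrt by exact P; reflexivity) n)). ring.
Qed.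

Lemma zpow_derive n p q :
  (is_derive (fun t => zre (S n) t q) p ((INR n + 1) * zre n p q) /\ is_derive (fun t => zim (S n) t q) p ((INR n + 1) * zim n p q)) /\
  (is_derive (fun t => zre (S n) p t) q (- (INR n + 1) * zim n p q) /\
   is_derive (fun t => zim (S n) p t) q ((INR n + 1) * zre n p q)).
Proof.
  induction n as [|n [[I1 I2] [I3 I4]]].
  - unfold zre, zim; simpl.
    split; split; (auto_derive; [trivial|ring]).
  - rewrite S_INR. split; split.
    + apply (is_derive_ext (fun t => t * zre (S n) t q - q * zim (S n) t q)); [intros; rewrite (zre_S (S n)); reflexivity|].
      eapply is_derive_val; [apply dR_minus; [apply (dR_mult (fun t => t)); [apply dR_id|exact I1]|apply dR_scal, I2]|].
      cbv beta. rewrite ?zre_S, ?zim_S. ring.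
    + apply (is_derive_ext (fun t => t * zim (S n) t q + q * zre (S n) t q)); [intros; rewrite (zim_S (S n)); reflexivity|].
      eapply is_derive_val; [apply dR_plus; [apply (dR_mult (fun t => t)); [apply dR_id|exact I2]|apply dR_scal, I1]|].
      cbv beta. rewrite ?zre_S, ?zim_S. ring.
    + apply (is_derive_ext (fun t => p * zre (S n) p t - t * zim (S n) p t)); [intros; rewrite (zre_S (S n)); reflexivity|].
      eapply is_derive_val; [apply dR_minus; [apply dR_scal, I3|apply (dR_mult (fun t => t)); [apply dR_id|exact I4]]|].
      cbv beta. rewrite ?zre_S, ?zim_S. ring.
    + apply (is_derive_ext (fun t => p * zim (S n) p t + t * zre (S n) p t)); [intros; rewrite (zim_S (S n)); reflexivity|].
      eapply is_derive_val; [apply dR_plus; [apply dR_scal, I4|apply (dR_mult (fun t => t)); [apply dR_id|exact I3]]|].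
      cbv beta. rewrite ?zre_S, ?zim_S. ring.
Qed.

Lemma pderiv_unique i F x l : pd i F x l -> pderiv i F x = l.
Proof.
  intros H. assert (K : pd i F x (pderiv i F x)).
  { unfold pderiv. apply epsilon_spec. exists l. exact H. }
  destruct x as [[a b] c]. unfold pd in *.
  destruct i as [|[|i]]; eapply uniqueness_limite; eassumption.
Qed.

Definition kapX (n : nat) : R := - / 2 * (legtop (S n) * (INR n + 1)).

Lemma kapX_neq n : kapX n <> 0.
Proof.
  unfold kapX. generalize (proj2 (legtop_spec (S n) 0)) (pos_INR n). intros H P.
  apply Rmult_integral_contrapositive_currified; [lra|].
  apply Rmult_integral_contrapositive_currified; [exact H|lra].
Qed.

Definition planar (k : R) (u w : R -> R -> R) (x : pt) : quat :=
  let '(a, b, c) := x in mkQ 0 (k * u b c) (k * w b c) 0.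

(** The potential is a multiple of Re z^(n+1) and free of x_0, so the scalar part vanishes and its
    gradient is given by z^n. The same factor [kapX n] occurs for Y, with Im z^(n+1). *)
Lemma Xd_top n : Xd (S n) n = planar (kapX n) (zre n) (fun p q => - zim n p q).
Proof.
  extensionality x. destruct x as [[a b] c]. unfold Xd, halfDbar, planar.
  assert (E : rU (S n) (S n) = fun x => let '(a, b, c) := x in legtop (S n) * zre (S n) b c).
  { extensionality y. destruct y as [[a' b'] c']. apply rU_top. }
  rewrite E. destruct (zpow_derive n b c) as [[D1 _] [D2 _]].
  f_equal.
  - rewrite (pderiv_unique _ _ _ 0); [ring|]. apply is_derive_Reals. apply dR_const.
  - rewrite (pderiv_unique _ _ _ (legtop (S n) * ((INR n + 1) * zre n b c))); [unfold kapX; ring|].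
    apply is_derive_Reals. apply dR_scal, D1.
  - rewrite (pderiv_unique _ _ _ (legtop (S n) * (- (INR n + 1) * zim n b c))); [unfold kapX; ring|].
    apply is_derive_Reals. apply dR_scal, D2.
Qed.

Lemma Yd_top n : Yd (S n) n = planar (kapX n) (zim n) (zre n).
Proof.
  extensionality x. destruct x as [[a b] c]. unfold Yd, halfDbar, planar.
  assert (E : rV (S n) (S n) = fun x => let '(a, b, c) := x in legtop (S n) * zim (S n) b c).
  { extensionality y. destruct y as [[a' b'] c']. apply rV_top. }
  rewrite E. destruct (zpow_derive n b c) as [[_ D1] [_ D2]].
  f_equal.
  - rewrite (pderiv_unique _ _ _ 0); [ring|]. apply is_derive_Reals. apply dR_const.
  - rewrite (pderiv_unique _ _ _ (legtop (S n) * ((INR n + 1) * zim n b c))); [unfold kapX; ring|].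
    apply is_derive_Reals. apply dR_scal, D1.
  - rewrite (pderiv_unique _ _ _ (legtop (S n) * ((INR n + 1) * zre n b c))); [unfold kapX; ring|].
    apply is_derive_Reals. apply dR_scal, D2.
Qed.

(** * Evaluation of the inner products on the ball *)

Lemma Defs_RInt_eq f a b : ex_RInt f a b -> Defs.RInt f a b = RInt f a b.
Proof.
  intros H. pose (pr := ex_RInt_Reals_0 f a b H).
  assert (K : exists pr : Riemann_integrable f a b, RiemannInt pr = Defs.RInt f a b).
  { unfold Defs.RInt. apply epsilon_spec. exists (RiemannInt pr), pr. reflexivity. }
  destruct K as [pr' E]. rewrite <- E. symmetry. apply RInt_Reals.
Qed.

Lemma sph_eq r t1 t2 : sph r t1 t2 = sphpt r t1 t2.
Proof. unfold sph, sphpt, om. f_equal; [f_equal|]; ring. Qed.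

(** [g] is required to describe the spherical integrals only for radii up to [rho], where F is under
    control, but to be continuous everywhere. *)
Lemma ball_int_eq (F : pt -> R) (g : R -> R) rho : 0 <= rho ->
  (forall r, 0 <= r <= rho -> cont2 (fun t1 t2 => F (sphpt r t1 t2))) ->
  (forall r, 0 <= r <= rho -> r ^ 2 * SI (fun t1 t2 => F (sphpt r t1 t2)) = g r) ->
  (forall r, continuous g r) ->
  ball_int F rho = RInt g 0 rho.
Proof.
  intros Hrho HC HE Hg. unfold ball_int.
  assert (E : forall r, 0 <= r <= rho -> Defs.RInt (fun t1 => Defs.RInt (fun t2 =>
      F (sph r t1 t2) * (r ^ 2 * sin t1)) 0 (2 * PI)) 0 PI = g r).
  { intros r Hr. rewrite <- (HE r Hr). assert (C := HC r Hr).
    assert (E1 : forall t1, Defs.RInt (fun t2 => F (sph r t1 t2) * (r ^ 2 * sin t1)) 0 (2 * PI) =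
       r ^ 2 * (RInt (fun t2 => F (sphpt r t1 t2)) 0 (2 * PI) * sin t1)).
    { intros t1. assert (X := cont2_inner _ t1 C). cbv beta in X.
      replace (fun t2 => F (sph r t1 t2) * (r ^ 2 * sin t1)) with (fun t2 => (r ^ 2 * sin t1) * F (sphpt r t1 t2)).
      2:{ extensionality t2. rewrite sph_eq. ring. }
      rewrite Defs_RInt_eq.
      - rewrite RInt_scalR by exact X. ring.
      - apply (ex_RInt_scal (V := R_NormedModule)), X. }
    rewrite (functional_extensionality _ _ E1).
    assert (X := cont2_outer _ C). cbv beta in X.
    rewrite Defs_RInt_eq.
    - rewrite RInt_scalR by exact X. reflexivity.
    - apply (ex_RInt_scal (V := R_NormedModule) (fun t1 => RInt (fun t2 => F (sphpt r t1 t2)) 0 (2 * PI) * sin t1)), X. }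
  assert (Eg : forall r, Rmin 0 rho < r < Rmax 0 rho -> g r = Defs.RInt (fun t1 => Defs.RInt (fun t2 =>
      F (sph r t1 t2) * (r ^ 2 * sin t1)) 0 (2 * PI)) 0 PI).
  { intros r Hr. rewrite Rmin_left, Rmax_right in Hr by lra. symmetry. apply E. lra. }
  rewrite Defs_RInt_eq.
  - symmetry. apply (RInt_ext (V := R_CompleteNormedModule)). exact Eg.
  - apply (ex_RInt_ext (V := R_NormedModule) g); [exact Eg|apply ex_RInt_contR, Hg].
Qed.

(** The value chosen by [epsilon] is a limit as rho tends to Rr, hence unique; for homogeneous
    integrands the integral over the ball of radius rho is a monomial in rho. *)
Lemma inner_eq Rr u w c m : 0 < Rr ->
  (forall rho, 0 < rho < Rr -> ball_int (fun x => qSc (qmul (qconj (u x)) (w x))) rho = c * rho ^ m) ->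
  inner Rr u w = c * Rr ^ m.
Proof.
  intros HR H.
  pose (P := fun l => forall eps, 0 < eps -> exists delta, 0 < delta /\
      forall rho, Rr - delta < rho < Rr ->
        Rabs (ball_int (fun x => qSc (qmul (qconj (u x)) (w x))) rho - l) < eps).
  assert (P1 : P (c * Rr ^ m)).
  { intros eps He.
    assert (C : continuous (fun t => c * t ^ m) Rr) by cont.
    destruct (C _ (locally_ball (c * Rr ^ m) (mkposreal eps He))) as [d Hd].
    exists (Rmin d Rr). split; [apply Rmin_pos; [apply cond_pos|exact HR]|].
    intros rho Hrho. generalize (Rmin_l d Rr) (Rmin_r d Rr). intros L1 L2.
    rewrite H by lra. apply (Hd rho). change (Rabs (rho - Rr) < d). rewrite Rabs_left; lra. }
  assert (P2 : P (inner Rr u w)).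
  { unfold inner. apply (epsilon_spec (inhabits 0) P). exists (c * Rr ^ m). exact P1. }
  apply cond_eq. intros eps He.
  destruct (P1 (eps / 2) ltac:(lra)) as [d1 [D1 K1]]. destruct (P2 (eps / 2) ltac:(lra)) as [d2 [D2 K2]].
  set (d := Rmin d1 d2). assert (Dp : 0 < d) by (apply Rmin_pos; assumption).
  generalize (Rmin_l d1 d2) (Rmin_r d1 d2). fold d. intros L1 L2.
  specialize (K1 (Rr - d / 2) ltac:(lra)). specialize (K2 (Rr - d / 2) ltac:(lra)).
  apply Rabs_def2 in K1. apply Rabs_def2 in K2. apply Rabs_def1; lra.
Qed.

Lemma kap_pos n : 0 < kap n.
Proof.
  induction n as [|n IH]; simpl; [lra|].
  assert (P := pos_INR n). apply Rmult_lt_0_compat; [|exact IH].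
  apply Rmult_lt_0_compat; [|lra]. apply Rdiv_lt_0_compat; lra.
Qed.

Lemma kap_le n : kap n <= 1.
Proof.
  induction n as [|n IH]; simpl; [lra|].
  assert (P := pos_INR n). assert (K := kap_pos n).
  assert (Q : (2 * INR n + 1) / (INR n + 1) * / 2 <= 1).
  { apply (Rmult_le_reg_r (2 * (INR n + 1))); [lra|]. field_simplify; lra. }
  assert (Q0 : 0 <= (2 * INR n + 1) / (INR n + 1) * / 2).
  { apply Rmult_le_pos; [|lra]. apply Rlt_le, Rdiv_lt_0_compat; lra. }
  nra.
Qed.

(** Wallis' integral of sin^(2n+1): its recursion, from the derivative of cos t sin^(2n+2) t, is
    inverse to that of (2n+1) kap n. *)
Lemma SI_axial_power n :
  (2 * INR n + 1) * kap n * SI (fun t1 t2 => (om 1 t1 t2 ^ 2 + om 2 t1 t2 ^ 2) ^ n) = 4 * PI.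
Proof.
  pose (J := fun n => RInt (fun t => sin t ^ (2 * n + 1)) 0 PI : R).
  assert (Es : SI (fun t1 t2 => (om 1 t1 t2 ^ 2 + om 2 t1 t2 ^ 2) ^ n) = 2 * PI * J n).
  { unfold SI, J. rewrite <- RInt_scalR by (apply ex_RInt_contR; intros; cont).
    apply RInt_extR. intros t1.
    rewrite (RInt_extR _ (fun _ => sin t1 ^ (2 * n))).
    - rewrite RInt_constR, Nat.add_1_r. simpl pow. ring.
    - intros t2. rewrite pow_mult. f_equal. unfold om. generalize (sin2_cos2 t2). unfold Rsqr. intros S.
      transitivity (sin t1 ^ 2 * (sin t2 * sin t2 + cos t2 * cos t2)); [ring|]. rewrite S. ring. }
  rewrite Es.
  assert (K : (2 * INR n + 1) * kap n * J n = 2).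
  { clear Es. induction n as [|n IH].
    - unfold J. simpl (kap 0). simpl (INR 0).
      rewrite (RInt_extR _ sin) by (intros; simpl; ring).
      rewrite (RInt_deriveR (fun t => - cos t)).
      + rewrite cos_PI, cos_0. ring.
      + intros x. auto_derive; [trivial|ring].
      + intros x. cont.
    - assert (P := pos_INR n).
      assert (Rec : (2 * INR n + 3) * J (S n) = (2 * INR n + 2) * J n).
      { assert (Z : RInt (fun t => (2 * INR n + 2) * sin t ^ (2 * n + 1) - (2 * INR n + 3) * sin t ^ (2 * S n + 1)) 0 PI = 0 :> R).
        { rewrite (RInt_deriveR (fun t => cos t * sin t ^ (2 * n + 2))).
          - rewrite sin_PI, sin_0. rewrite !pow_i by lia. ring.
          - intros x. eapply is_derive_val.
            + apply dR_mult; [apply is_derive_cos|].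
              apply (is_derive_pow sin (2 * n + 2) x (cos x)). apply is_derive_sin.
            + replace (sin x ^ (2 * S n + 1)) with (sin x * sin x * sin x ^ (2 * n + 1))
                by (replace (2 * S n + 1)%nat with (S (S (2 * n + 1))) by lia; simpl; ring).
              replace (sin x ^ (2 * n + 2)) with (sin x * sin x ^ (2 * n + 1))
                by (replace (2 * n + 2)%nat with (S (2 * n + 1)) by lia; simpl; ring).
              replace (pred (2 * n + 2)) with (2 * n + 1)%nat by lia.
              replace (INR (2 * n + 2)) with (2 * INR n + 2) by (rewrite plus_INR, mult_INR; simpl; ring).
              assert (C2 : cos x * cos x = 1 - sin x * sin x) by (generalize (sin2_cos2 x); unfold Rsqr; lra).
              transitivity (- (sin x * (sin x * sin x ^ (2 * n + 1))) + (2 * INR n + 2) * (cos x * cos x) * sin x ^ (2 * n + 1)); [ring|].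
              rewrite C2. ring.
          - intros x. cont. }
        rewrite RInt_minusR, !RInt_scalR in Z; try (apply ex_RInt_contR; intros; cont).
        unfold J. lra. }
      rewrite S_INR. transitivity (kap (S n) * ((2 * INR n + 3) * J (S n))); [ring|].
      rewrite Rec. cbn [kap].
      transitivity ((2 * INR n + 1) * kap n * J n); [field; lra|exact IH]. }
  transitivity (2 * PI * ((2 * INR n + 1) * kap n * J n)); [ring|]. rewrite K. ring.
Qed.

(* D f = 0 says that v = (f_0, - f_1, - f_2) has neither curl nor divergence. *)
Definition vf (f : pt -> quat) (i : nat) (x : pt) : R :=
  match i with 0%nat => q0 (f x) | 1%nat => - q1 (f x) | _ => - q2 (f x) end.

(** * The terms of h in closed form *)

Section HTerm.
Variables (Rr : R) (f : pt -> quat) (dv : nat -> nat -> pt -> R).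
Hypothesis HR : 0 < Rr.
Hypothesis Hr : riesz Rr (vf f) dv.
Variable n : nat.

Let Cre := mre (vf f) n (Rr / 2) / (Rr / 2) ^ n.
Let Cim := mim (vf f) n (Rr / 2) / (Rr / 2) ^ n.

(** Real part of c_n; with [cim] as imaginary part, c_n z^n is the mean of the degree n component of
    v_1 - i v_2. By homogeneity any radius in (0, Rr) may serve, and Rr/2 is taken. *)
Definition cre := (2 * INR n + 1) * kap n / (4 * PI) * Cre.
Definition cim := (2 * INR n + 1) * kap n / (4 * PI) * Cim.

Lemma mre_eq r : 0 < r < Rr -> mre (vf f) n r = r ^ n * Cre /\ mim (vf f) n r = r ^ n * Cim.
Proof.
  intros H. destruct (moments_homog Rr (vf f) dv Hr n (Rr / 2) r ltac:(lra) H (Rgt_not_eq _ _ (kap_pos n))) as [E1 E2].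
  unfold Cre, Cim. rewrite E1, E2. split; field; apply pow_nonzero; lra.
Qed.

Let RInt_pow c m rho : RInt (fun r => c * r ^ m) 0 rho = c / (INR m + 1) * rho ^ (S m) :> R.
Proof.
  assert (P := pos_INR m).
  rewrite (RInt_deriveR (fun r => c / (INR m + 1) * r ^ S m)).
  - rewrite (pow_i (S m)) by lia. ring.
  - intros x. eapply is_derive_val.
    + apply dR_scal. apply (is_derive_pow (fun t => t) (S m) x 1). apply dR_id.
    + rewrite S_INR. simpl pred. field. lra.
  - intros x. cont.
Qed.

Let scale_w r t1 t2 : zre n (r * om 1 t1 t2) (r * om 2 t1 t2) = r ^ n * wre n t1 t2 /\
  zim n (r * om 1 t1 t2) (r * om 2 t1 t2) = r ^ n * wim n t1 t2.
Proof. apply zpow_scal. Qed.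

(** The integrand is k^2 |z|^(2n), so X and Y have the same norm. *)
Let sq_ball k (u w : R -> R -> R) : 
  (forall p q, u p q ^ 2 + w p q ^ 2 = zre n p q ^ 2 + zim n p q ^ 2) ->
  inner Rr (planar k u w) (planar k u w) =
    k ^ 2 * (4 * PI / ((2 * INR n + 1) * kap n)) / (INR (2 * n + 2) + 1) * Rr ^ S (2 * n + 2).
Proof.
  intros Hu. apply inner_eq; [exact HR|].
  intros rho Hrho. rewrite <- RInt_pow.
  assert (Fe : forall r t1 t2, qSc (qmul (qconj (planar k u w (sphpt r t1 t2))) (planar k u w (sphpt r t1 t2))) =
     k ^ 2 * r ^ (2 * n) * (om 1 t1 t2 ^ 2 + om 2 t1 t2 ^ 2) ^ n).
  { intros r t1 t2. unfold planar, sphpt, qSc, qmul, qconj; cbn [q0 q1 q2 q3].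
    transitivity (k ^ 2 * (u (r * om 1 t1 t2) (r * om 2 t1 t2) ^ 2 + w (r * om 1 t1 t2) (r * om 2 t1 t2) ^ 2)); [ring|].
    rewrite Hu, zpow_norm, pow_mult, Rmult_assoc, <- Rpow_mult_distr. f_equal. f_equal. ring. }
  assert (C0 : cont2 (fun t1 t2 => (om 1 t1 t2 ^ 2 + om 2 t1 t2 ^ 2) ^ n)).
  { intros a b. assert (O1 := om_cont 1). assert (O2 := om_cont 2). cont. }
  apply ball_int_eq.
  - lra.
  - intros r _ a b. apply (continuous_ext (fun q : R * R => k ^ 2 * r ^ (2 * n) * (om 1 (fst q) (snd q) ^ 2 + om 2 (fst q) (snd q) ^ 2) ^ n)).
    + intros q. rewrite Fe. reflexivity.
    + apply cR_mult; [cont|apply C0].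
  - intros r _. rewrite (SI_ext _ _ (Fe r)), SI_scal by exact C0.
    replace (SI (fun t1 t2 => (om 1 t1 t2 ^ 2 + om 2 t1 t2 ^ 2) ^ n)) with (4 * PI / ((2 * INR n + 1) * kap n)).
    + rewrite (pow_add r (2 * n) 2). ring.
    + rewrite <- (SI_axial_power n). field. split; [apply Rgt_not_eq, kap_pos|]. generalize (pos_INR n); lra.
  - intros r. cont.
Qed.

Let f_ball k (u w : R -> R -> R) c :
  (forall r, 0 < r < Rr -> cont2 (fun t1 t2 => u (r * om 1 t1 t2) (r * om 2 t1 t2)) /\
     cont2 (fun t1 t2 => w (r * om 1 t1 t2) (r * om 2 t1 t2))) ->
  (forall r, 0 < r < Rr -> 
     SI (fun t1 t2 => - u (r * om 1 t1 t2) (r * om 2 t1 t2) * vf f 1 (sphpt r t1 t2)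
       - w (r * om 1 t1 t2) (r * om 2 t1 t2) * vf f 2 (sphpt r t1 t2)) = c * r ^ (2 * n)) ->
  inner Rr (planar k u w) f = k * c / (INR (2 * n + 2) + 1) * Rr ^ S (2 * n + 2).
Proof.
  intros Hc Hu. apply inner_eq; [exact HR|].
  intros rho Hrho. rewrite <- RInt_pow.
  assert (Fe : forall r t1 t2, qSc (qmul (qconj (planar k u w (sphpt r t1 t2))) (f (sphpt r t1 t2))) =
     k * (- u (r * om 1 t1 t2) (r * om 2 t1 t2) * vf f 1 (sphpt r t1 t2)
       - w (r * om 1 t1 t2) (r * om 2 t1 t2) * vf f 2 (sphpt r t1 t2))).
  { intros r t1 t2. unfold planar, sphpt, qSc, qmul, qconj, vf; cbn [q0 q1 q2 q3]. ring. }
  assert (C0 : forall r, 0 < r < Rr -> cont2 (fun t1 t2 => - u (r * om 1 t1 t2) (r * om 2 t1 t2) * vf f 1 (sphpt r t1 t2)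
       - w (r * om 1 t1 t2) (r * om 2 t1 t2) * vf f 2 (sphpt r t1 t2))).
  { intros r Hrr a b. destruct (Hc r Hrr) as [U W].
    assert (V1 := v_cont2 Rr (vf f) dv Hr r 1 Hrr a b). assert (V2 := v_cont2 Rr (vf f) dv Hr r 2 Hrr a b).
    assert (U' := U a b). assert (W' := W a b). cbv beta in *. cont. }
  apply ball_int_eq.
  - lra.
  - intros r Hrr a b.
    (* The continuity of v on spheres is available for positive radii; for r = 0 the integrand is
       constant. *)
    destruct (Req_dec r 0) as [->|N].
    + apply (continuous_ext (fun _ => qSc (qmul (qconj (planar k u w (0, 0, 0))) (f (0, 0, 0))))); [|apply continuous_const].
      intros q. unfold sphpt. rewrite !Rmult_0_l. reflexivity.
    + apply (continuous_ext (fun q : R * R => k * (- u (r * om 1 (fst q) (snd q)) (r * om 2 (fst q) (snd q)) * vf f 1 (sphpt r (fst q) (snd q))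
       - w (r * om 1 (fst q) (snd q)) (r * om 2 (fst q) (snd q)) * vf f 2 (sphpt r (fst q) (snd q))))).
      * intros q. rewrite Fe. reflexivity.
      * apply cR_mult; [cont|apply (C0 r ltac:(lra) a b)].
  - intros r Hrr. destruct (Req_dec r 0) as [->|N].
    + rewrite pow_i, (pow_i (2 * n + 2)) by lia. ring.
    + rewrite (SI_ext _ _ (Fe r)), SI_scal by (apply C0; lra). rewrite Hu by lra.
      rewrite (pow_add r (2 * n) 2). ring.
  - intros r. cont.
Qed.

Let cont_zw r : cont2 (fun t1 t2 => zre n (r * om 1 t1 t2) (r * om 2 t1 t2)) /\
  cont2 (fun t1 t2 => zim n (r * om 1 t1 t2) (r * om 2 t1 t2)).
Proof. apply (zpow_cont n (fun t1 t2 => r * om 1 t1 t2) (fun t1 t2 => r * om 2 t1 t2)); apply cont2_scal, om_cont. Qed.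

Let Q := Rr ^ S (2 * n + 2) / (INR (2 * n + 2) + 1).

Let inner_X k : inner Rr (planar k (zre n) (fun p q => - zim n p q)) f = - k * Cre * Q.
Proof.
  rewrite (f_ball _ _ _ (- Cre)).
  - unfold Q. assert (P := pos_INR (2 * n + 2)). field. lra.
  - intros r Hrr. destruct (cont_zw r) as [C1 C2]. split; [exact C1|].
    intros a b. apply cR_opp, C2.
  - intros r Hrr. destruct (mre_eq r Hrr) as [E1 _].
    replace (2 * n)%nat with (n + n)%nat by lia. rewrite pow_add.
    transitivity (- r ^ n * mre (vf f) n r); [|rewrite E1; ring].
    unfold mre. rewrite <- SI_scal.
    + apply SI_ext. intros t1 t2. rewrite (proj1 (scale_w _ _ _)), (proj2 (scale_w _ _ _)). ring.
    + assert (V1 := v_cont2 Rr (vf f) dv Hr r 1 Hrr). assert (V2 := v_cont2 Rr (vf f) dv Hr r 2 Hrr).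
      apply cont2_minus; apply cont2_mult; auto using wre_cont, wim_cont.
Qed.

Let inner_Y k : inner Rr (planar k (zim n) (zre n)) f = k * Cim * Q.
Proof.
  rewrite (f_ball _ _ _ Cim).
  - unfold Q. assert (P := pos_INR (2 * n + 2)). field. lra.
  - intros r Hrr. destruct (cont_zw r) as [C1 C2]. split; [exact C2|exact C1].
  - intros r Hrr. destruct (mre_eq r Hrr) as [_ E1].
    replace (2 * n)%nat with (n + n)%nat by lia. rewrite pow_add.
    transitivity (r ^ n * mim (vf f) n r); [|rewrite E1; ring].
    unfold mim. rewrite Ropp_mult_distr_r_reverse, <- Ropp_mult_distr_l_reverse, <- SI_scal.
    + apply SI_ext. intros t1 t2. rewrite (proj1 (scale_w _ _ _)), (proj2 (scale_w _ _ _)). ring.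
    + assert (V1 := v_cont2 Rr (vf f) dv Hr r 1 Hrr). assert (V2 := v_cont2 Rr (vf f) dv Hr r 2 Hrr).
      apply cont2_plus; apply cont2_mult; auto using wre_cont, wim_cont.
Qed.

Lemma normalize_planar u w k I : inner Rr (planar k u w) (planar k u w) = I ->
  normalize Rr (planar k u w) = planar (k / sqrt I) u w.
Proof.
  intros E. unfold normalize. rewrite E. extensionality x. destruct x as [[a b] c].
  unfold planar, qscal; cbn [q0 q1 q2 q3]. f_equal; unfold Rdiv; ring.
Qed.

(** For this term v_1 - i v_2 = c_n z^n. The squared norm contributes kapX^2, so this factor
    cancels, and [Ek] leaves precisely the constant (2n+1) kap n / (4 pi) of c_n. *)
Lemma hterm_eq a b c : hterm f Rr n (a, b, c) =
  mkQ 0 (- (cre * zre n b c - cim * zim n b c)) (cre * zim n b c + cim * zre n b c) 0.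
Proof.
  assert (K0 := kap_pos n). assert (P := pos_INR n). assert (PI0 := PI_RGT_0).
  set (I := kapX n ^ 2 * (4 * PI / ((2 * INR n + 1) * kap n)) * Q).
  assert (Qp : 0 < Q).
  { unfold Q. apply Rdiv_lt_0_compat; [apply pow_lt, HR|]. generalize (pos_INR (2 * n + 2)); lra. }
  assert (Ip : 0 < I).
  { unfold I. apply Rmult_lt_0_compat; [|exact Qp]. apply Rmult_lt_0_compat.
    - generalize (kapX_neq n). intros. generalize (pow2_gt_0 (kapX n) H). lra.
    - apply Rdiv_lt_0_compat; [lra|]. apply Rmult_lt_0_compat; lra. }
  assert (EX : Xs Rr (S n) n = planar (kapX n / sqrt I) (zre n) (fun p q => - zim n p q)).
  { unfold Xs. rewrite Xd_top. apply normalize_planar. rewrite sq_ball by (intros; ring).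
    unfold I, Q. field. repeat split; try lra. generalize (pos_INR (2 * n + 2)); lra. }
  assert (EY : Ys Rr (S n) n = planar (kapX n / sqrt I) (zim n) (zre n)).
  { unfold Ys. rewrite Yd_top. apply normalize_planar. rewrite sq_ball by (intros; ring).
    unfold I, Q. field. repeat split; try lra. generalize (pos_INR (2 * n + 2)); lra. }
  unfold hterm. rewrite EX, EY, inner_X, inner_Y.
  assert (Ek : (kapX n / sqrt I) * (kapX n / sqrt I) * Q = (2 * INR n + 1) * kap n / (4 * PI)).
  { assert (Ss : sqrt I * sqrt I = I) by (apply sqrt_sqrt; lra).
    assert (S0 : 0 < sqrt I) by (apply sqrt_lt_R0, Ip).
    transitivity (kapX n ^ 2 * Q / (sqrt I * sqrt I)); [field; lra|].
    rewrite Ss. unfold I. field. generalize (kapX_neq n). intros. repeat split; try lra; assumption. }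
  set (k := kapX n / sqrt I) in *.
  unfold planar, qadd, qscal; cbn [q0 q1 q2 q3]. unfold cre, cim. rewrite <- Ek.
  f_equal; ring.
Qed.
End HTerm.

(** * Coefficients of h *)

Lemma qnorm_ge_q1 a : Rabs (q1 a) <= qnorm a.
Proof.
  unfold qnorm. rewrite <- sqrt_Rsqr_abs. apply sqrt_le_1_alt. unfold Rsqr.
  generalize (pow2_ge_0 (q0 a)) (pow2_ge_0 (q2 a)) (pow2_ge_0 (q3 a)). intros; simpl in *; lra.
Qed.

Lemma sqrt_sum_le x y : sqrt (x ^ 2 + y ^ 2) <= Rabs x + Rabs y.
Proof.
  assert (P := Rabs_pos x). assert (Q := Rabs_pos y).
  rewrite <- (sqrt_pow2 (Rabs x + Rabs y)) by lra.
  apply sqrt_le_1_alt. rewrite <- (pow2_abs x), <- (pow2_abs y). nra.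
Qed.

Lemma zpow_le n p q t : 0 <= t -> p ^ 2 + q ^ 2 <= t ^ 2 ->
  Rabs (zre n p q) <= t ^ n /\ Rabs (zim n p q) <= t ^ n.
Proof.
  intros Ht H. assert (E := zpow_norm n p q).
  assert (K : (p ^ 2 + q ^ 2) ^ n <= (t ^ n) ^ 2).
  { rewrite <- pow_mult, Nat.mul_comm, pow_mult. apply pow_incr.
    generalize (pow2_ge_0 p) (pow2_ge_0 q). lra. }
  assert (T := pow_le t n Ht).
  generalize (pow2_ge_0 (zre n p q)) (pow2_ge_0 (zim n p q)). intros P Q.
  split; rewrite <- (Rabs_right (t ^ n)) by lra; apply Rsqr_le_abs_0; unfold Rsqr; nra.
Qed.

Lemma sum_n_single (a : nat -> R) n N : (n <= N)%nat -> (forall k, k <> n -> a k = 0) -> sum_n a N = a n.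
Proof.
  intros HN Ha.
  assert (Z : forall M, (M < n)%nat -> sum_n a M = 0).
  { induction M as [|M IH]; intros HM.
    - rewrite sum_O. apply Ha. lia.
    - rewrite sum_Sn, IH, Ha by lia. apply Rplus_0_l. }
  induction HN as [|N HN IH].
  - destruct n as [|n]; [apply sum_O|]. rewrite sum_Sn, Z by lia. apply Rplus_0_l.
  - rewrite sum_Sn, IH, (Ha (S N)) by lia. apply Rplus_0_r.
Qed.

Lemma RInt_sum_n (F : nat -> R -> R) a b N : (forall n t, continuous (F n) t) ->
  (forall t, continuous (fun t => sum_n (fun n => F n t) N) t) /\
  RInt (fun t => sum_n (fun n => F n t) N) a b = sum_n (fun n => (RInt (F n) a b : R)) N :> R.
Proof.
  intros HF. induction N as [|N [I1 I2]].
  - split.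
    + intros t. apply (continuous_ext (F 0%nat)); [intros; rewrite sum_O; reflexivity|apply HF].
    + rewrite sum_O. apply RInt_extR. intros; apply sum_O.
  - split.
    + intros t. apply (continuous_ext (fun t => sum_n (fun n => F n t) N + F (S N) t)).
      * intros; rewrite sum_Sn; reflexivity.
      * apply cR_plus; [apply I1|apply HF].
    + rewrite sum_Sn, <- I2. rewrite (RInt_extR _ (fun t => sum_n (fun n => F n t) N + F (S N) t)).
      * apply RInt_plusR; apply ex_RInt_contR; [exact I1|apply HF].
      * intros; rewrite sum_Sn; reflexivity.
Qed.

(** The index is an integer because differences of frequencies occur in the product formulas. *)
Lemma int_cos (j : Z) : RInt (fun th => cos (IZR j * th)) (- PI) PI = (if Z.eqb j 0 then 2 * PI else 0) :> R.
Proof.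
  destruct (Z.eqb_spec j 0) as [->|N].
  - rewrite (RInt_extR _ (fun _ => 1)), RInt_constR; [ring|].
    intros t. rewrite Rmult_0_l. apply cos_0.
  - assert (P : IZR j <> 0) by (intros H; apply N, eq_IZR, H).
    assert (S0 : sin (IZR j * PI) = 0) by (apply sin_eq_0_1; exists j; reflexivity).
    revert P S0. generalize (IZR j). intros m P S0.
    rewrite (RInt_deriveR (fun th => sin (m * th) / m)).
    + rewrite Ropp_mult_distr_r_reverse, sin_neg, S0. field. exact P.
    + intros x. auto_derive; [trivial|]. field. exact P.
    + intros x. cont.
Qed.

Lemma int_sin (j : Z) : RInt (fun th => sin (IZR j * th)) (- PI) PI = 0 :> R.
Proof.
  generalize (IZR j). intros m. destruct (Req_dec m 0) as [->|P].
  - rewrite (RInt_extR _ (fun _ => 0)), RInt_constR; [ring|].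
    intros t. rewrite Rmult_0_l. apply sin_0.
  - rewrite (RInt_deriveR (fun th => - cos (m * th) / m)).
    + rewrite Ropp_mult_distr_r_reverse, cos_neg. field. exact P.
    + intros x. auto_derive; [trivial|]. field. exact P.
    + intros x. cont.
Qed.

Lemma int_products (k n : nat) :
  RInt (fun th => cos (INR k * th) * cos (INR n * th)) (- PI) PI =
    / 2 * RInt (fun th => cos (IZR (Z.of_nat k - Z.of_nat n) * th)) (- PI) PI +
    / 2 * RInt (fun th => cos (IZR (Z.of_nat k + Z.of_nat n) * th)) (- PI) PI :> R /\
  RInt (fun th => sin (INR k * th) * sin (INR n * th)) (- PI) PI =
    / 2 * RInt (fun th => cos (IZR (Z.of_nat k - Z.of_nat n) * th)) (- PI) PI -
    / 2 * RInt (fun th => cos (IZR (Z.of_nat k + Z.of_nat n) * th)) (- PI) PI :> R /\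
  RInt (fun th => sin (INR k * th) * cos (INR n * th)) (- PI) PI = 0 :> R.
Proof.
  assert (Ec : forall j, ex_RInt (fun th => cos (IZR j * th)) (- PI) PI) by (intros; apply ex_RInt_contR; intros; cont).
  assert (Es : forall j, ex_RInt (fun th => sin (IZR j * th)) (- PI) PI) by (intros; apply ex_RInt_contR; intros; cont).
  assert (Sc : forall k f, ex_RInt f (- PI) PI -> ex_RInt (fun t => k * f t : R) (- PI) PI).
  { intros c f Hf. apply (ex_RInt_scal (V := R_NormedModule) f _ _ c Hf). }
  split; [|split].
  - rewrite <- !RInt_scalR, <- RInt_plusR by auto. apply RInt_extR. intros t.
    rewrite minus_IZR, plus_IZR, <- !INR_IZR_INZ, Rmult_minus_distr_r, Rmult_plus_distr_r, cos_minus, cos_plus. field.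
  - rewrite <- !RInt_scalR, <- RInt_minusR by auto. apply RInt_extR. intros t.
    rewrite minus_IZR, plus_IZR, <- !INR_IZR_INZ, Rmult_minus_distr_r, Rmult_plus_distr_r, cos_minus, cos_plus. field.
  - transitivity (/ 2 * RInt (fun th => sin (IZR (Z.of_nat k - Z.of_nat n) * th)) (- PI) PI +
      / 2 * RInt (fun th => sin (IZR (Z.of_nat k + Z.of_nat n) * th)) (- PI) PI).
    + rewrite <- !RInt_scalR, <- RInt_plusR by auto. apply RInt_extR. intros t.
      rewrite minus_IZR, plus_IZR, <- !INR_IZR_INZ, Rmult_minus_distr_r, Rmult_plus_distr_r, sin_minus, sin_plus. field.
    + rewrite !int_sin. ring.
Qed.

Section HPart.
Variables (Rr : R) (f : pt -> quat) (dv : nat -> nat -> pt -> R).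
Hypothesis HR : 0 < Rr.
Hypothesis Hr : riesz Rr (vf f) dv.

(** The sum defining h begins at degree 1; a zero term in degree 0 keeps index and exponent
    equal. *)
Definition hre k p q := match k with O => 0 | S _ => cre Rr f k * zre k p q - cim Rr f k * zim k p q end.
Definition him k p q := match k with O => 0 | S _ => cre Rr f k * zim k p q + cim Rr f k * zre k p q end.

Lemma hpartial_eq N a b c : hpartial f Rr N (a, b, c) =
  mkQ 0 (- sum_n (fun k => hre k b c) N) (sum_n (fun k => him k b c) N) 0.
Proof.
  induction N as [|N IH].
  - rewrite !sum_O. unfold hre, him. rewrite Ropp_0. reflexivity.
  - cbn [hpartial]. rewrite IH, (hterm_eq Rr f dv HR Hr (S N)).
    rewrite !sum_Sn. unfold plus; simpl. unfold qadd; cbn [q0 q1 q2 q3].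
    change (hre (S N) b c) with (cre Rr f (S N) * zre (S N) b c - cim Rr f (S N) * zim (S N) b c).
    change (him (S N) b c) with (cre Rr f (S N) * zim (S N) b c + cim Rr f (S N) * zre (S N) b c).
    f_equal; ring.
Qed.

Definition sphere_mass s := SI (fun t1 t2 => Rabs (vf f 1 (sphpt s t1 t2)) + Rabs (vf f 2 (sphpt s t1 t2))).

(** A crude bound from |w^k| <= 1, [kap k <= 1] and 4 pi >= 1. It secures convergence; the bound by
    [S2] can be derived only once h is known as a sum. *)
Lemma coef_bound s k : 0 < s < Rr ->
  Rabs (cre Rr f k) * s ^ k <= (2 * INR k + 1) * sphere_mass s /\
  Rabs (cim Rr f k) * s ^ k <= (2 * INR k + 1) * sphere_mass s.
Proof.
  intros Hs. destruct (mre_eq Rr f dv HR Hr k s Hs) as [E1 E2].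
  assert (K0 := kap_pos k). assert (K1 := kap_le k). assert (P := pos_INR k).
  assert (PI4 : 1 <= 4 * PI) by (generalize PI2_1; unfold PI2 in *; lra).
  assert (V1 := v_cont2 Rr (vf f) dv Hr s 1 Hs). assert (V2 := v_cont2 Rr (vf f) dv Hr s 2 Hs).
  assert (W1 := wre_cont k). assert (W2 := wim_cont k).
  assert (CM : cont2 (fun t1 t2 => Rabs (vf f 1 (sphpt s t1 t2)) + Rabs (vf f 2 (sphpt s t1 t2)))).
  { intros a b. assert (A1 := V1 a b). assert (A2 := V2 a b). cbv beta in *. cont. }
  assert (Wb : forall t1 t2, Rabs (wre k t1 t2) <= 1 /\ Rabs (wim k t1 t2) <= 1).
  { intros t1 t2. rewrite <- (pow1 k). apply zpow_le; [lra|].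
    generalize (om_sphere t1 t2) (pow2_ge_0 (om 0 t1 t2)). lra. }
  assert (SIb : forall g, cont2 g -> (forall t1 t2, Rabs (g t1 t2) <= Rabs (vf f 1 (sphpt s t1 t2)) + Rabs (vf f 2 (sphpt s t1 t2))) ->
     Rabs (SI g) <= sphere_mass s).
  { intros g Cg Hg. unfold sphere_mass. apply Rabs_le. split.
    - rewrite <- (Rmult_1_l (SI _)), <- Ropp_mult_distr_l_reverse, <- SI_scal by exact CM.
      apply SI_le; [apply cont2_scal, CM|exact Cg|]. intros a b. generalize (Hg a b). intros Q. apply Rabs_le_between in Q. lra.
    - apply SI_le; [exact Cg|exact CM|]. intros a b. generalize (Hg a b). intros Q. apply Rabs_le_between in Q. lra. }
  assert (M0 : 0 <= sphere_mass s).
  { apply Rle_trans with (2 := SIb (fun _ _ => 0) (cont2_const 0) ltac:(intros; cbv beta; rewrite Rabs_R0; generalize (Rabs_pos (vf f 1 (sphpt s t1 t2))) (Rabs_pos (vf f 2 (sphpt s t1 t2))); lra)). apply Rabs_pos. }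
  assert (B1 : Rabs (mre (vf f) k s) <= sphere_mass s).
  { apply SIb; [apply cont2_minus; apply cont2_mult; assumption|].
    intros t1 t2. destruct (Wb t1 t2) as [A1 A2].
    eapply Rle_trans; [apply Rabs_triang|]. rewrite Rabs_Ropp, !Rabs_mult.
    generalize (Rabs_pos (vf f 1 (sphpt s t1 t2))) (Rabs_pos (vf f 2 (sphpt s t1 t2))). nra. }
  assert (B2 : Rabs (mim (vf f) k s) <= sphere_mass s).
  { unfold mim. rewrite Rabs_Ropp. apply SIb; [apply cont2_plus; apply cont2_mult; assumption|].
    intros t1 t2. destruct (Wb t1 t2) as [A1 A2].
    eapply Rle_trans; [apply Rabs_triang|]. rewrite !Rabs_mult.
    generalize (Rabs_pos (vf f 1 (sphpt s t1 t2))) (Rabs_pos (vf f 2 (sphpt s t1 t2))). nra. }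
  assert (Fin : forall x, Rabs x <= sphere_mass s -> Rabs ((2 * INR k + 1) * kap k / (4 * PI) * x) <= (2 * INR k + 1) * sphere_mass s).
  { intros x Hx. rewrite Rabs_mult. apply Rmult_le_compat; try apply Rabs_pos; [|exact Hx].
    assert (Q : 0 <= (2 * INR k + 1) * kap k / (4 * PI)).
    { apply Rlt_le, Rdiv_lt_0_compat; [apply Rmult_lt_0_compat|]; lra. }
    rewrite Rabs_right by lra.
    apply (Rmult_le_reg_r (4 * PI)); [lra|]. unfold Rdiv. rewrite Rmult_assoc, Rinv_l by lra. nra. }
  assert (Sp : 0 < s ^ k) by (apply pow_lt; lra).
  unfold cre, cim. rewrite <- (Rabs_right (s ^ k)), <- !Rabs_mult by lra. split.
  - rewrite Rmult_assoc, (Rmult_comm _ (s ^ k)), <- E1. apply Fin, B1.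
  - rewrite Rmult_assoc, (Rmult_comm _ (s ^ k)), <- E2. apply Fin, B2.
Qed.

Lemma h_term_bound s t k p q : 0 < s < Rr -> 0 <= t -> p ^ 2 + q ^ 2 <= t ^ 2 ->
  Rabs (hre k p q) <= 2 * sphere_mass s * ((2 * INR k + 1) * (t / s) ^ k) /\
  Rabs (him k p q) <= 2 * sphere_mass s * ((2 * INR k + 1) * (t / s) ^ k).
Proof.
  intros Hs Ht Hpq. destruct (coef_bound s k Hs) as [B1 B2]. destruct (zpow_le k p q t Ht Hpq) as [Z1 Z2].
  assert (Sp : 0 < s ^ k) by (apply pow_lt; lra). assert (Tp := pow_le t k Ht).
  assert (P1 := Rabs_pos (cre Rr f k)). assert (P2 := Rabs_pos (cim Rr f k)).
  assert (E : 2 * sphere_mass s * ((2 * INR k + 1) * (t / s) ^ k) = 2 * ((2 * INR k + 1) * sphere_mass s) * (t ^ k * / s ^ k)).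
  { unfold Rdiv. rewrite Rpow_mult_distr, pow_inv. ring. }
  assert (X : (Rabs (cre Rr f k) + Rabs (cim Rr f k)) * t ^ k <= 2 * sphere_mass s * ((2 * INR k + 1) * (t / s) ^ k)).
  { rewrite E. apply (Rmult_le_reg_r (s ^ k)); [exact Sp|].
    replace (2 * ((2 * INR k + 1) * sphere_mass s) * (t ^ k * / s ^ k) * s ^ k) with (2 * ((2 * INR k + 1) * sphere_mass s) * t ^ k) by (field; lra).
    replace ((Rabs (cre Rr f k) + Rabs (cim Rr f k)) * t ^ k * s ^ k) with
     ((Rabs (cre Rr f k) * s ^ k + Rabs (cim Rr f k) * s ^ k) * t ^ k) by ring.
    apply Rmult_le_compat_r; [exact Tp|lra]. }
  assert (X0 : 0 <= 2 * sphere_mass s * ((2 * INR k + 1) * (t / s) ^ k)).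
  { eapply Rle_trans; [|exact X]. apply Rmult_le_pos; lra. }
  unfold hre, him. destruct k as [|k]; [rewrite Rabs_R0; split; exact X0|].
  split; (eapply Rle_trans; [|exact X]); (eapply Rle_trans; [apply Rabs_triang|]); rewrite ?Rabs_Ropp, !Rabs_mult.
  - generalize (Rabs_pos (zre (S k) p q)) (Rabs_pos (zim (S k) p q)). nra.
  - generalize (Rabs_pos (zre (S k) p q)) (Rabs_pos (zim (S k) p q)). nra.
Qed.

(** This is the Poisson kernel series at c = 1. *)
Lemma dominating_series q M : 0 <= q < 1 -> ex_series (fun k => M * ((2 * INR k + 1) * q ^ k)).
Proof.
  intros Hq. eexists. apply is_series_scalR.
  apply (is_series_ext (fun k => (2 * INR k + 1) * leg k 1 * q ^ k)).
  - intros k. rewrite (proj1 (leg_at_1 k)). toR. ring.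
  - apply is_pseries_R, poisson_kernel_series; [rewrite Rabs_R1; lra|rewrite Rabs_right; lra].
Qed.

(** Both planar components of the partial sums converge, so the limit named by [epsilon] exists; its
    e1-component is then identified. *)
Lemma hpart_series a b c : in_ball Rr (a, b, c) ->
  is_series (fun k => hre k b c) (- q1 (hpart f Rr (a, b, c))).
Proof.
  intros Hb.
  set (t := sqrt (b ^ 2 + c ^ 2)).
  assert (P0 : 0 <= b ^ 2 + c ^ 2) by (generalize (pow2_ge_0 b) (pow2_ge_0 c); lra).
  assert (T0 : 0 <= t) by apply sqrt_pos.
  assert (TR : t < Rr).
  { apply Rle_lt_trans with (2 := Hb). unfold norm3, t. apply sqrt_le_1_alt. generalize (pow2_ge_0 a); lra. }
  assert (T2 : b ^ 2 + c ^ 2 <= t ^ 2) by (unfold t; rewrite pow2_sqrt; lra).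
  (* A radius strictly between |z| and Rr, giving the geometric ratio t/s < 1. *)
  set (s := (t + Rr) / 2). assert (Hs : 0 < s < Rr) by (unfold s; lra).
  assert (Hq : 0 <= t / s < 1).
  { split; [apply Rmult_le_pos; [exact T0|apply Rlt_le, Rinv_0_lt_compat; lra]|].
    apply (Rmult_lt_reg_r s); [lra|]. unfold Rdiv. rewrite Rmult_assoc, Rinv_l by lra. unfold s; lra. }
  assert (E1 : ex_series (fun k => hre k b c)).
  { apply (ex_series_le (V := R_CompleteNormedModule) _ (fun k => 2 * sphere_mass s * ((2 * INR k + 1) * (t / s) ^ k))).
    - intros k. apply (h_term_bound s t k b c Hs T0 T2).
    - apply dominating_series, Hq. }
  assert (E2 : ex_series (fun k => him k b c)).
  { apply (ex_series_le (V := R_CompleteNormedModule) _ (fun k => 2 * sphere_mass s * ((2 * INR k + 1) * (t / s) ^ k))).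
    - intros k. apply (h_term_bound s t k b c Hs T0 T2).
    - apply dominating_series, Hq. }
  destruct E1 as [l1 L1]. destruct E2 as [l2 L2].
  pose (P := fun q => forall eps, 0 < eps -> exists N0, forall N, (N0 <= N)%nat ->
      qnorm (qsub (hpartial f Rr N (a, b, c)) q) < eps).
  assert (HP : P (hpart f Rr (a, b, c))).
  { unfold hpart. apply (epsilon_spec (inhabits qzero) P). exists (mkQ 0 (- l1) l2 0).
    intros eps He.
    assert (He2 : 0 < eps / 2) by lra.
    destruct (proj1 (filterlim_locally _ l1) L1 (mkposreal _ He2)) as [N1 K1].
    destruct (proj1 (filterlim_locally _ l2) L2 (mkposreal _ He2)) as [N2 K2].
    exists (Nat.max N1 N2). intros N HN. rewrite hpartial_eq.
    specialize (K1 N ltac:(lia)). specialize (K2 N ltac:(lia)).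
    change (Rabs (sum_n (fun k => hre k b c) N - l1) < eps / 2) in K1.
    change (Rabs (sum_n (fun k => him k b c) N - l2) < eps / 2) in K2.
    unfold qnorm, qsub; cbn [q0 q1 q2 q3].
    set (x := sum_n (fun k => hre k b c) N) in *. set (y := sum_n (fun k => him k b c) N) in *.
    replace ((0 - 0) ^ 2 + (- x - - l1) ^ 2 + (y - l2) ^ 2 + (0 - 0) ^ 2) with ((x - l1) ^ 2 + (y - l2) ^ 2) by ring.
    eapply Rle_lt_trans; [apply sqrt_sum_le|]. lra. }
  change (is_lim_seq (sum_n (fun k => hre k b c)) (- q1 (hpart f Rr (a, b, c)))).
  apply is_lim_seq_spec. intros eps.
  destruct (HP eps (cond_pos eps)) as [N0 K]. exists N0. intros N HN. specialize (K N HN).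
  eapply Rle_lt_trans; [|exact K]. eapply Rle_trans; [|apply qnorm_ge_q1].
  rewrite hpartial_eq. unfold qsub; cbn [q0 q1 q2 q3].
  rewrite <- Rabs_Ropp. right. f_equal. ring.
Qed.

Variable S2 : R.
Hypothesis HS2 : forall xi, in_ball Rr xi -> Rabs (qSc (qmul (hpart f Rr xi) e1)) <= S2.

Lemma zpow_polar n s th : zre n (s * cos th) (s * sin th) = s ^ n * cos (INR n * th) /\
  zim n (s * cos th) (s * sin th) = s ^ n * sin (INR n * th).
Proof.
  induction n as [|n [I1 I2]].
  - unfold zre, zim; simpl. rewrite Rmult_0_l, cos_0, sin_0. split; ring.
  - rewrite zre_S, zim_S, I1, I2, S_INR, Rmult_plus_distr_r, Rmult_1_l, cos_plus, sin_plus.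
    simpl. split; ring.
Qed.

(** On the circle |z| = s in the plane x_0 = 0, Sc(h e1) is the sum of s^k (cre cos k th - cim sin k
    th). The n-th Fourier coefficient yields pi |X| <= 2 pi S2, hence the factor 2. *)
Lemma hcoef_bound s n : 0 < s < Rr -> (1 <= n)%nat ->
  Rabs (cre Rr f n) * s ^ n <= 2 * S2 /\ Rabs (cim Rr f n) * s ^ n <= 2 * S2.
Proof.
  intros Hs Hn. generalize PI_RGT_0; intros Hpi.
  set (s' := (s + Rr) / 2). assert (Hs' : 0 < s' < Rr) by (unfold s'; lra).
  assert (Hq : 0 <= s / s' < 1).
  { split; [apply Rmult_le_pos; [lra|apply Rlt_le, Rinv_0_lt_compat; lra]|].
    apply (Rmult_lt_reg_r s'); [lra|]. unfold Rdiv. rewrite Rmult_assoc, Rinv_l by lra. unfold s'; lra. }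
  destruct (dominating_series (s / s') (2 * sphere_mass s') Hq) as [m Hm].
  set (b := fun k => 2 * sphere_mass s' * ((2 * INR k + 1) * (s / s') ^ k)) in *.
  (* Finite sums are integrated, their distance to the full sum being bounded by a tail that is
     uniform in th. *)
  assert (Ub : forall N th, Rabs (sum_n (fun k => hre k (s * cos th) (s * sin th)) N) <= S2 + (m - sum_n b N)).
  { intros N th.
    assert (Sq : (s * cos th) ^ 2 + (s * sin th) ^ 2 = s ^ 2).
    { generalize (sin2_cos2 th). unfold Rsqr. intros E.
      transitivity (s ^ 2 * (sin th * sin th + cos th * cos th)); [ring|]. rewrite E; ring. }
    assert (Ib : in_ball Rr (0, s * cos th, s * sin th)).
    { apply in_ball_sq; [lra|]. replace (0 ^ 2 + (s * cos th) ^ 2 + (s * sin th) ^ 2) with (s ^ 2) by (rewrite <- Sq; ring). nra. }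
    assert (L := hpart_series _ _ _ Ib).
    generalize (series_tail_bound _ _ _ _ N L Hm). intros T.
    assert (Tb : forall k, Rabs (hre k (s * cos th) (s * sin th)) <= b k).
    { intros k. apply (h_term_bound s' s k _ _ Hs'); lra. }
    specialize (T Tb). specialize (HS2 _ Ib).
    unfold qSc, qmul, e1 in HS2; cbn [q0 q1 q2 q3] in HS2.
    set (h := hpart f Rr (0, s * cos th, s * sin th)) in *.
    replace (q0 h * 0 - q1 h * 1 - q2 h * 0 - q3 h * 0) with (- q1 h) in HS2 by ring.
    set (x := sum_n _ N) in *.
    replace x with (- q1 h - (- q1 h - x)) by ring.
    eapply Rle_trans; [apply Rabs_triang|]. rewrite (Rabs_Ropp (- q1 h - x)). lra. }
  assert (Tc : forall k th, continuous (fun th => hre k (s * cos th) (s * sin th)) th).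
  { intros k th. destruct k as [|k]; [apply continuous_const|]. unfold hre.
    apply (continuous_ext (fun th => cre Rr f (S k) * (s ^ (S k) * cos (INR (S k) * th)) - cim Rr f (S k) * (s ^ (S k) * sin (INR (S k) * th)))).
    - intros u. destruct (zpow_polar (S k) s u) as [-> ->]. reflexivity.
    - cont. }
  (* [tr] will be cos(n th) or sin(n th): orthogonality removes every other term of the partial sum,
     and N then tends to infinity. *)
  assert (Gen : forall (tr : R -> R) X, (forall t, continuous tr t) -> (forall t, Rabs (tr t) <= 1) ->
     (forall k, k <> n -> RInt (fun th => hre k (s * cos th) (s * sin th) * tr th) (- PI) PI = 0) ->
     RInt (fun th => hre n (s * cos th) (s * sin th) * tr th) (- PI) PI = PI * X -> Rabs X <= 2 * S2).
  { intros tr X Ct Bt Z EX.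
    assert (B : forall N, (n <= N)%nat -> Rabs X <= 2 * (S2 + (m - sum_n b N))).
    { intros N HN.
      destruct (RInt_sum_n (fun k th => hre k (s * cos th) (s * sin th) * tr th) (- PI) PI N) as [C1 E1].
      { intros k t. assert (C := Tc k t). cont. }
      cbv beta in E1. rewrite (sum_n_single _ n N HN Z), EX in E1.
      apply (Rmult_le_reg_l PI); [exact Hpi|].
      rewrite <- (Rabs_right PI) at 1 by lra. rewrite <- Rabs_mult, <- E1.
      replace (PI * (2 * (S2 + (m - sum_n b N)))) with ((PI - - PI) * (S2 + (m - sum_n b N))) by ring.
      apply abs_RInt_le_const; [lra|apply ex_RInt_contR, C1|].
      intros t _. 
      replace (sum_n (fun k => hre k (s * cos t) (s * sin t) * tr t) N) with
        (sum_n (fun k => hre k (s * cos t) (s * sin t)) N * tr t) by (symmetry; apply (sum_n_mult_r (K := R_Ring))).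
      rewrite Rabs_mult. rewrite <- (Rmult_1_r (S2 + _)). apply Rmult_le_compat; try apply Rabs_pos; [apply Ub|apply Bt]. }
    assert (Lm : is_lim_seq (fun N => 2 * (S2 + (m - sum_n b N))) (2 * S2)).
    { replace (Finite (2 * S2)) with (Finite (2 * (S2 + (m - m)))) by (f_equal; ring).
      apply (is_lim_seq_scal_l (fun N => S2 + (m - sum_n b N)) 2 (S2 + (m - m))).
      apply is_lim_seq_plus'; [apply is_lim_seq_const|].
      apply is_lim_seq_minus'; [apply is_lim_seq_const|exact Hm]. }
    apply (is_lim_seq_le_loc (fun _ => Rabs X) (fun N => 2 * (S2 + (m - sum_n b N))) (Rabs X) (2 * S2)).
    - exists n. exact B.
    - apply is_lim_seq_const.
    - exact Lm. }
  assert (Exk : forall g, (forall t, continuous g t) -> ex_RInt g (- PI) PI) by (intros; apply ex_RInt_contR; assumption).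
  assert (Fk : forall k tr, (forall t, continuous tr t) ->
     RInt (fun th => hre (S k) (s * cos th) (s * sin th) * tr th) (- PI) PI =
     (cre Rr f (S k) * s ^ (S k)) * RInt (fun th => cos (INR (S k) * th) * tr th) (- PI) PI -
     (cim Rr f (S k) * s ^ (S k)) * RInt (fun th => sin (INR (S k) * th) * tr th) (- PI) PI :> R).
  { intros k tr Ct. rewrite <- !RInt_scalR, <- RInt_minusR by (apply Exk; intros; cont).
    apply RInt_extR. intros th. unfold hre. destruct (zpow_polar (S k) s th) as [-> ->]. ring. }
  assert (Z0 : forall tr, RInt (fun th => hre 0 (s * cos th) (s * sin th) * tr th) (- PI) PI = 0 :> R).
  { intros tr. rewrite (RInt_extR _ (fun _ => 0)), RInt_constR; [ring|]. intros; simpl; ring. }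
  assert (Cc : forall t, continuous (fun th => cos (INR n * th)) t) by (intros; cont).
  assert (Cs : forall t, continuous (fun th => sin (INR n * th)) t) by (intros; cont).
  assert (Sp : 0 < s ^ n) by (apply pow_lt; lra).
  destruct n as [|n']; [lia|]. set (n := S n') in *.
  assert (Zne : forall k, k <> n -> Z.eqb (Z.of_nat k - Z.of_nat n) 0 = false) by (intros; apply Z.eqb_neq; lia).
  assert (Zp : forall k, Z.eqb (Z.of_nat k + Z.of_nat n) 0 = false) by (intros; apply Z.eqb_neq; unfold n; lia).
  assert (Zd : Z.eqb (Z.of_nat n - Z.of_nat n) 0 = true) by (apply Z.eqb_eq; lia).
  split.
  - rewrite <- (Rabs_right (s ^ n)), <- Rabs_mult by lra.
    apply (Gen (fun th => cos (INR n * th))); [exact Cc| | |].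
    + intros t. apply Rabs_le. generalize (COS_bound (INR n * t)). lra.
    + intros [|k] Hk; [apply Z0|]. rewrite Fk by exact Cc.
      destruct (int_products (S k) n) as [-> [_ ->]]. rewrite !int_cos, Zne, Zp by exact Hk. toR. ring.
    + unfold n at 1. rewrite Fk by exact Cc. fold n.
      destruct (int_products n n) as [-> [_ ->]]. rewrite !int_cos, Zd, Zp. toR. field.
  - rewrite <- (Rabs_right (s ^ n)), <- Rabs_mult, <- Rabs_Ropp by lra.
    apply (Gen (fun th => sin (INR n * th))); [exact Cs| | |].
    + intros t. apply Rabs_le. generalize (SIN_bound (INR n * t)). lra.
    + intros [|k] Hk; [apply Z0|]. rewrite Fk by exact Cs.
      rewrite (RInt_extR (fun th => cos (INR (S k) * th) * sin (INR n * th)) (fun th => sin (INR n * th) * cos (INR (S k) * th))) by (intros; ring).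
      rewrite (proj2 (proj2 (int_products n (S k)))).
      rewrite (proj1 (proj2 (int_products (S k) n))). rewrite !int_cos, Zne, Zp by exact Hk. toR. ring.
    + unfold n at 1. rewrite Fk by exact Cs. fold n.
      rewrite (RInt_extR (fun th => cos (INR n * th) * sin (INR n * th)) (fun th => sin (INR n * th) * cos (INR n * th))) by (intros; ring).
      rewrite (proj2 (proj2 (int_products n n))).
      rewrite (proj1 (proj2 (int_products n n))). rewrite !int_cos, Zd, Zp. toR. field.
Qed.
End HPart.

(** * From monogenic functions to the Riesz system *)

Lemma norm3_continuous z : continuous norm3 z.
Proof.
  apply (continuous_ext (fun z : R * R * R => sqrt (fst (fst z) ^ 2 + snd (fst z) ^ 2 + snd z ^ 2))).
  - intros [[a b] c]. reflexivity.
  - cont.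
Qed.

Lemma in_ball_open Rr z : in_ball Rr z -> locally z (in_ball Rr).
Proof.
  intros H. apply (locally_lt_continuous norm3 (fun _ => Rr)).
  - apply norm3_continuous.
  - apply continuous_const.
  - exact H.
Qed.

Lemma segment_MVT (g dg : R -> R) (x y d : R) : Rabs (y - x) < d ->
  (forall t, Rabs (t - x) < d -> is_derive g t (dg t)) ->
  exists c, Rabs (c - x) <= Rabs (y - x) /\ g y - g x = dg c * (y - x).
Proof.
  intros Hd Hg.
  assert (K : forall t, Rmin x y <= t <= Rmax x y -> Rabs (t - x) <= Rabs (y - x)).
  { intros t. unfold Rmin, Rmax. destruct (Rle_dec x y); intros Ht.
    - rewrite !Rabs_right; lra.
    - rewrite !Rabs_left1; lra. }
  destruct (MVT_gen g x y dg) as [c [Hc E]].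
  - intros t Ht. apply Hg. eapply Rle_lt_trans; [apply K; lra|exact Hd].
  - intros t Ht. apply continuity_pt_filterlim. apply (ex_derive_continuous (V := R_NormedModule)).
    exists (dg t). apply Hg. eapply Rle_lt_trans; [apply K; lra|exact Hd].
  - exists c. split; [apply K, Hc|exact E].
Qed.

Section FromPartials.
Variables (Rr : R) (phi : pt -> R) (g : nat -> pt -> R).
Hypothesis Hp : forall z i, (i <= 2)%nat -> in_ball Rr z -> pd i phi z (g i z).

(** The increment is split into three moves parallel to the axes, each treated by the mean value
    theorem; continuity of the partial derivatives compares the intermediate points with y. *)
Lemma partials_frechet y : in_ball Rr y -> (forall i, continuous (g i) y) -> forall eps, 0 < eps ->
  exists d, 0 < d /\ forall z, (forall i, (i <= 2)%nat -> Rabs (co i z - co i y) < d) ->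
    Rabs (phi z - phi y - (g 0%nat y * (co 0 z - co 0 y) + g 1%nat y * (co 1 z - co 1 y) + g 2%nat y * (co 2 z - co 2 y)))
    <= eps * (Rabs (co 0 z - co 0 y) + Rabs (co 1 z - co 1 y) + Rabs (co 2 z - co 2 y)).
Proof.
  intros Hb Hc eps He.
  assert (L : forall i, locally y (fun z => Rabs (g i z - g i y) < eps)).
  { intros i. apply (Hc i _ (locally_ball (g i y) (mkposreal eps He))). }
  destruct (filter_and _ _ (in_ball_open Rr y Hb) (filter_and _ _ (L 0%nat) (filter_and _ _ (L 1%nat) (L 2%nat)))) as [d Hd].
  destruct y as [[y0 y1] y2].
  assert (Box : forall a b c, Rabs (a - y0) < d -> Rabs (b - y1) < d -> Rabs (c - y2) < d ->
    in_ball Rr (a, b, c) /\ Rabs (g 0%nat (a, b, c) - g 0%nat (y0, y1, y2)) < eps /\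
    Rabs (g 1%nat (a, b, c) - g 1%nat (y0, y1, y2)) < eps /\ Rabs (g 2%nat (a, b, c) - g 2%nat (y0, y1, y2)) < eps).
  { intros a b c Ha Hb' Hc'. apply Hd. split; [split|]; assumption. }
  exists d. split; [apply cond_pos|]. intros [[z0 z1] z2] Hz.
  assert (Z0 := Hz 0%nat ltac:(lia)). assert (Z1 := Hz 1%nat ltac:(lia)). assert (Z2 := Hz 2%nat ltac:(lia)).
  cbn [co fst snd] in *.
  assert (Y : forall w, Rabs (w - w) < d) by (intros; rewrite Rminus_diag, Rabs_R0; apply cond_pos).
  destruct (segment_MVT (fun t => phi (t, z1, z2)) (fun t => g 0%nat (t, z1, z2)) y0 z0 d Z0) as [c0 [C0 E0]].
  { intros t Ht. apply is_derive_Reals. apply (Hp (t, z1, z2) 0%nat ltac:(lia)). apply Box; assumption. }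
  destruct (segment_MVT (fun t => phi (y0, t, z2)) (fun t => g 1%nat (y0, t, z2)) y1 z1 d Z1) as [c1 [C1 E1]].
  { intros t Ht. apply is_derive_Reals. apply (Hp (y0, t, z2) 1%nat ltac:(lia)). apply Box; auto. }
  destruct (segment_MVT (fun t => phi (y0, y1, t)) (fun t => g 2%nat (y0, y1, t)) y2 z2 d Z2) as [c2 [C2 E2]].
  { intros t Ht. apply is_derive_Reals. apply (Hp (y0, y1, t) 2%nat ltac:(lia)). apply Box; auto. }
  assert (D0 := proj1 (proj2 (Box c0 z1 z2 ltac:(lra) Z1 Z2))).
  assert (D1 := proj1 (proj2 (proj2 (Box y0 c1 z2 (Y y0) ltac:(lra) Z2)))).
  assert (D2 := proj2 (proj2 (proj2 (Box y0 y1 c2 (Y y0) (Y y1) ltac:(lra))))).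
  set (k0 := g 0%nat (y0, y1, y2)) in *. set (k1 := g 1%nat (y0, y1, y2)) in *. set (k2 := g 2%nat (y0, y1, y2)) in *.
  set (m0 := g 0%nat (c0, z1, z2)) in *. set (m1 := g 1%nat (y0, c1, z2)) in *. set (m2 := g 2%nat (y0, y1, c2)) in *.
  replace (phi (z0, z1, z2) - phi (y0, y1, y2) - (k0 * (z0 - y0) + k1 * (z1 - y1) + k2 * (z2 - y2))) with
    ((m0 - k0) * (z0 - y0) + (m1 - k1) * (z1 - y1) + (m2 - k2) * (z2 - y2)) by lra.
  assert (T : forall m k w, Rabs (m - k) < eps -> Rabs ((m - k) * w) <= eps * Rabs w).
  { intros m k w Hm. rewrite Rabs_mult. apply Rmult_le_compat_r; [apply Rabs_pos|lra]. }
  eapply Rle_trans; [apply Rabs_triang|]. 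
  generalize (Rabs_triang ((m0 - k0) * (z0 - y0)) ((m1 - k1) * (z1 - y1))) (T m0 k0 (z0 - y0) D0) (T m1 k1 (z1 - y1) D1) (T m2 k2 (z2 - y2) D2).
  lra.
Qed.

(** The error of the linear approximation of phi and those of the three coordinates of the curve are
    each made at most half of [eps]; [K] and [Gm] bound the velocity and the gradient. *)
Lemma partials_hgrad y : in_ball Rr y -> (forall i, continuous (g i) y) -> hgrad phi y (fun i => g i y).
Proof.
  intros Hb Hc c t dc Hd Hy.
  split; [apply is_linear_scal_l|].
  intros x Hx. rewrite <- (is_filter_lim_locally_unique (V := R_NormedModule) t x Hx). clear x Hx.
  intros eps.
  set (K := Rabs (dc 0%nat) + Rabs (dc 1%nat) + Rabs (dc 2%nat) + 3).
  set (Gm := Rabs (g 0%nat y) + Rabs (g 1%nat y) + Rabs (g 2%nat y) + 1).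
  assert (K0 : 0 < K) by (unfold K; generalize (Rabs_pos (dc 0%nat)) (Rabs_pos (dc 1%nat)) (Rabs_pos (dc 2%nat)); lra).
  assert (G0 : 0 < Gm) by (unfold Gm; generalize (Rabs_pos (g 0%nat y)) (Rabs_pos (g 1%nat y)) (Rabs_pos (g 2%nat y)); lra).
  assert (E1 : 0 < eps / (2 * K)) by (apply Rdiv_lt_0_compat; [apply cond_pos|lra]).
  destruct (partials_frechet y Hb Hc _ E1) as [d [D0 Fr]].
  assert (E2 : 0 < Rmin 1 (eps / (2 * Gm))).
  { apply Rmin_pos; [lra|]. apply Rdiv_lt_0_compat; [apply cond_pos|lra]. }
  assert (Lc : forall i, locally t (fun u => Rabs (c i u - c i t - (u - t) * dc i) <= Rmin 1 (eps / (2 * Gm)) * Rabs (u - t))).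
  { intros i. destruct (Hd i) as [_ Hl].
    apply (Hl t (fun P HP => HP) (mkposreal _ E2)). }
  assert (Lk : forall i, locally t (fun u => Rabs (c i u - c i t) < d)).
  { intros i. assert (C : continuous (c i) t).
    { apply (ex_derive_continuous (V := R_NormedModule)). exists (dc i). apply Hd. }
    apply (C _ (locally_ball (c i t) (mkposreal d D0))). }
  generalize (filter_and _ _ (filter_and _ _ (Lc 0%nat) (filter_and _ _ (Lc 1%nat) (Lc 2%nat)))
    (filter_and _ _ (Lk 0%nat) (filter_and _ _ (Lk 1%nat) (Lk 2%nat)))).
  apply filter_imp. intros u [[A0 [A1 A2]] [B0 [B1 B2]]].
  rewrite Hy.
  change (Rabs (phi (c 0%nat u, c 1%nat u, c 2%nat u) - phi y - (u - t) * (g 0%nat y * dc 0%nat + g 1%nat y * dc 1%nat + g 2%nat y * dc 2%nat)) <= eps * Rabs (u - t)).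
  assert (Cy : co 0 y = c 0%nat t /\ co 1 y = c 1%nat t /\ co 2 y = c 2%nat t) by (rewrite <- Hy; auto).
  destruct Cy as [Y0 [Y1 Y2]].
  specialize (Fr (c 0%nat u, c 1%nat u, c 2%nat u)).
  rewrite Y0, Y1, Y2 in Fr. cbn [co fst snd] in Fr.
  assert (Fr' := Fr ltac:(intros [|[|[|i]]] Hi; [| | |lia]; rewrite ?Y0, ?Y1, ?Y2; cbn [co fst snd] in *; rewrite ?Y0, ?Y1, ?Y2; assumption)).
  clear Fr.
  set (x0 := c 0%nat u - c 0%nat t) in *. set (x1 := c 1%nat u - c 1%nat t) in *. set (x2 := c 2%nat u - c 2%nat t) in *.
  set (h := u - t) in *. set (F := phi (c 0%nat u, c 1%nat u, c 2%nat u) - phi y) in *.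
  assert (R1 := Rmin_l 1 (eps / (2 * Gm))). assert (R2 := Rmin_r 1 (eps / (2 * Gm))).
  set (rho := Rmin 1 (eps / (2 * Gm))) in *. assert (Hh := Rabs_pos h).
  assert (X : forall x d', Rabs (x - h * d') <= rho * Rabs h -> Rabs x <= (Rabs d' + 1) * Rabs h).
  { intros x d' Hx. replace x with ((x - h * d') + h * d') by ring.
    eapply Rle_trans; [apply Rabs_triang|]. rewrite (Rabs_mult h d'). nra. }
  assert (X0 := X _ _ A0). assert (X1 := X _ _ A1). assert (X2 := X _ _ A2).
  assert (P1 : eps / (2 * K) * (Rabs x0 + Rabs x1 + Rabs x2) <= eps / 2 * Rabs h).
  { apply Rle_trans with (eps / (2 * K) * (K * Rabs h)).
    - apply Rmult_le_compat_l; [lra|]. unfold K. lra.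
    - right. field. lra. }
  assert (P2 : forall k x d', Rabs (x - h * d') <= rho * Rabs h -> Rabs (k * (x - h * d')) <= Rabs k * (rho * Rabs h)).
  { intros k x d' Hx. rewrite Rabs_mult. apply Rmult_le_compat_l; [apply Rabs_pos|exact Hx]. }
  assert (Q0 := P2 (g 0%nat y) _ _ A0). assert (Q1 := P2 (g 1%nat y) _ _ A1). assert (Q2 := P2 (g 2%nat y) _ _ A2).
  assert (P3 : Gm * (rho * Rabs h) <= eps / 2 * Rabs h).
  { rewrite <- Rmult_assoc. apply Rmult_le_compat_r; [exact Hh|].
    apply Rle_trans with (Gm * (eps / (2 * Gm))); [apply Rmult_le_compat_l; lra|]. right. field. lra. }
  assert (P4 : 0 <= rho * Rabs h) by (apply Rmult_le_pos; lra).
  replace (F - h * (g 0%nat y * dc 0%nat + g 1%nat y * dc 1%nat + g 2%nat y * dc 2%nat)) with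
   ((F - (g 0%nat y * x0 + g 1%nat y * x1 + g 2%nat y * x2)) + (g 0%nat y * (x0 - h * dc 0%nat) + g 1%nat y * (x1 - h * dc 1%nat) + g 2%nat y * (x2 - h * dc 2%nat))) by ring.
  eapply Rle_trans; [apply Rabs_triang|].
  generalize (Rabs_triang (g 0%nat y * (x0 - h * dc 0%nat) + g 1%nat y * (x1 - h * dc 1%nat)) (g 2%nat y * (x2 - h * dc 2%nat)))
   (Rabs_triang (g 0%nat y * (x0 - h * dc 0%nat)) (g 1%nat y * (x1 - h * dc 1%nat))).
  unfold Gm in P3. intros T1 T2. lra.
Qed.
End FromPartials.

Lemma qcont_components g x : qcont_at g x ->
  continuous (fun z => q0 (g z)) x /\ continuous (fun z => q1 (g z)) x /\ continuous (fun z => q2 (g z)) x.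
Proof.
  intros H.
  assert (K : forall (comp : quat -> R), (forall a b, comp (qsub a b) = comp a - comp b) ->
     (forall a, Rabs (comp a) <= qnorm a) -> continuous (fun z => comp (g z)) x).
  { intros comp Hs Hn. apply filterlim_locally. intros eps.
    destruct (H eps (cond_pos eps)) as [d [D0 Hd]].
    (* Coordinates within d/2 stay at distance at most sqrt(3)/2 d < d. *)
    assert (D2 : 0 < d / 2) by lra.
    exists (mkposreal _ D2). intros y Hy.
    change (Rabs (comp (g y) - comp (g x)) < eps). rewrite <- Hs.
    eapply Rle_lt_trans; [apply Hn|]. apply Hd.
    destruct x as [[x0 x1] x2]. destruct y as [[y0 y1] y2]. destruct Hy as [[B0 B1] B2].
    change (Rabs (y0 - x0) < d / 2) in B0. change (Rabs (y1 - x1) < d / 2) in B1. change (Rabs (y2 - x2) < d / 2) in B2.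
    apply (in_ball_sq d (y0 - x0) (y1 - x1) (y2 - x2) D0).
    rewrite <- (pow2_abs (y0 - x0)), <- (pow2_abs (y1 - x1)), <- (pow2_abs (y2 - x2)).
    generalize (Rabs_pos (y0 - x0)) (Rabs_pos (y1 - x1)) (Rabs_pos (y2 - x2)). nra. }
  split; [|split]; apply K; try reflexivity; intros a; unfold qnorm; rewrite <- sqrt_Rsqr_abs; apply sqrt_le_1_alt; unfold Rsqr;
    generalize (pow2_ge_0 (q0 a)) (pow2_ge_0 (q1 a)) (pow2_ge_0 (q2 a)) (pow2_ge_0 (q3 a)); intros; simpl in *; lra.
Qed.

(** Serves to remove the derivatives of the e3-component from D f = 0, where they would otherwise
    disturb the curl equations. *)
Lemma pd_zero Rr F x i l : (i <= 2)%nat -> (forall z, in_ball Rr z -> F z = 0) -> in_ball Rr x -> pd i F x l -> l = 0.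
Proof.
  intros Hi HF Hx Hl.
  assert (Z : forall (c : R -> pt) t, continuous c t -> c t = x -> derivable_pt_lim (fun u => F (c u)) t l -> l = 0).
  { intros c t Cc Et D. apply is_derive_Reals in D.
    assert (D' : is_derive (fun u => F (c u)) t 0).
    { apply (is_derive_ext_loc (fun _ => 0)); [|apply dR_const].
      assert (L := in_ball_open Rr x Hx). rewrite <- Et in L. generalize (Cc _ L). unfold filtermap. apply filter_imp.
      intros u Hu. symmetry. apply HF, Hu. }
    rewrite <- (is_derive_unique _ _ _ D). apply is_derive_unique. exact D'. }
  destruct x as [[a b] c]. destruct i as [|[|[|i]]]; [| | |lia]; simpl in Hl.
  - apply (Z (fun t => (t, b, c)) a); [cont|reflexivity|exact Hl].
  - apply (Z (fun t => (a, t, c)) b); [cont|reflexivity|exact Hl].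
  - apply (Z (fun t => (a, b, t)) c); [cont|reflexivity|exact Hl].
Qed.

Lemma pd_opp i F x l : pd i F x l -> pd i (fun y => - F y) x (- l).
Proof.
  destruct x as [[a b] c]. destruct i as [|[|i]]; simpl; intros H; apply is_derive_Reals; apply is_derive_Reals in H;
  apply dR_opp in H; exact H.
Qed.

Lemma partials_continuous Rr phi g y : (forall z i, (i <= 2)%nat -> in_ball Rr z -> pd i phi z (g i z)) ->
  in_ball Rr y -> (forall i, continuous (g i) y) -> continuous phi y.
Proof.
  intros Hp Hb Hc. apply filterlim_locally. intros eps.
  destruct (partials_frechet Rr phi g Hp y Hb Hc 1 Rlt_0_1) as [d [D0 Fr]].
  set (L := fun z : pt => Rabs (g 0%nat y * (co 0 z - co 0 y) + g 1%nat y * (co 1 z - co 1 y) + g 2%nat y * (co 2 z - co 2 y))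
     + (Rabs (co 0 z - co 0 y) + Rabs (co 1 z - co 1 y) + Rabs (co 2 z - co 2 y))).
  assert (C : forall i, continuous (co i) y) by (intros; apply continuous_co).
  assert (CL : continuous L y) by (unfold L; cont).
  assert (Ly : L y = 0).
  { unfold L. rewrite !Rminus_diag, !Rmult_0_r, !Rplus_0_r, Rabs_R0. ring. }
  assert (L1 : locally y (fun z => L z < eps)).
  { apply (locally_lt_continuous L (fun _ => eps : R)); [exact CL|apply continuous_const|]. rewrite Ly. apply cond_pos. }
  assert (L2 : forall i, locally y (fun z => Rabs (co i z - co i y) < d)).
  { intros i. apply (C i _ (locally_ball (co i y) (mkposreal d D0))). }
  generalize (filter_and _ _ L1 (filter_and _ _ (L2 0%nat) (filter_and _ _ (L2 1%nat) (L2 2%nat)))).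
  apply filter_imp. intros z [A [B0 [B1 B2]]].
  change (Rabs (phi z - phi y) < eps).
  assert (F := Fr z ltac:(intros [|[|[|i]]] Hi; [assumption|assumption|assumption|lia])).
  eapply Rle_lt_trans; [|exact A]. unfold L.
  set (w := g 0%nat y * (co 0 z - co 0 y) + g 1%nat y * (co 1 z - co 1 y) + g 2%nat y * (co 2 z - co 2 y)) in *.
  replace (phi z - phi y) with (w + (phi z - phi y - w)) by ring.
  eapply Rle_trans; [apply Rabs_triang|]. lra.
Qed.

(** The scalar part of D f is the divergence of v; the other three components are its curl once the
    e3-derivatives are known to vanish. *)
Lemma monogenic_riesz f Rr : monogenic f Rr -> exists dv, riesz Rr (vf f) dv.
Proof.
  intros [H3 [d0 [d1 [d2 H]]]].
  pose (dq := fun (j : nat) => match j with 0%nat => d0 | 1%nat => d1 | _ => d2 end).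
  pose (dv := fun (i j : nat) (x : pt) => match i with 0%nat => q0 (dq j x) | 1%nat => - q1 (dq j x) | _ => - q2 (dq j x) end).
  exists dv.
  assert (Hq : forall x i, (i <= 2)%nat -> in_ball Rr x -> qpd i f x (dq i x)).
  { intros x i Hi Hx. destruct (H x Hx) as [A0 [A1 [A2 _]]]. destruct i as [|[|[|i]]]; [assumption|assumption|assumption|lia]. }
  assert (Hp : forall k z i, (i <= 2)%nat -> in_ball Rr z -> pd i (vf f k) z (dv k i z)).
  { intros k z i Hi Hz. destruct (Hq z i Hi Hz) as [P0 [P1 [P2 P3]]].
    destruct k as [|[|k]]; unfold vf, dv; [exact P0|apply pd_opp, P1|apply pd_opp, P2]. }
  assert (Cq : forall k j z, in_ball Rr z -> continuous (dv k j) z).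
  { intros k j z Hz. destruct (H z Hz) as [_ [_ [_ [C0 [C1 [C2 _]]]]]].
    assert (C : qcont_at (dq j) z) by (destruct j as [|[|j]]; assumption).
    destruct (qcont_components _ _ C) as [K0 [K1 K2]].
    destruct k as [|[|k]]; unfold dv; [exact K0|apply cR_opp, K1|apply cR_opp, K2]. }
  assert (Z3 : forall z j, in_ball Rr z -> (j <= 2)%nat -> q3 (dq j z) = 0).
  { intros z j Hz Hj. destruct (Hq z j Hj Hz) as [_ [_ [_ P3]]]. apply (pd_zero Rr _ z j _ Hj H3 Hz P3). }
  assert (Eq : forall z, in_ball Rr z ->
    q0 (d0 z) - q1 (d1 z) - q2 (d2 z) = 0 /\ q1 (d0 z) + q0 (d1 z) = 0 /\ q2 (d0 z) + q0 (d2 z) = 0 /\ q2 (d1 z) = q1 (d2 z)).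
  { intros z Hz. destruct (H z Hz) as [_ [_ [_ [_ [_ [_ E]]]]]].
    assert (Y0 : q3 (d0 z) = 0) by apply (Z3 z 0%nat Hz ltac:(lia)).
    assert (Y1 : q3 (d1 z) = 0) by apply (Z3 z 1%nat Hz ltac:(lia)).
    assert (Y2 : q3 (d2 z) = 0) by apply (Z3 z 2%nat Hz ltac:(lia)).
    unfold qadd, qmul, e1, e2, qzero in E; cbn [q0 q1 q2 q3] in E. injection E. intros. rewrite Y0, Y1, Y2 in *. lra. }
  split; [|split; [|split; [|split]]].
  - intros z i Hz. apply (partials_hgrad Rr (vf f i) (dv i) (Hp i) z Hz). intros j. apply Cq, Hz.
  - intros z i Hz. apply (partials_continuous Rr (vf f i) (dv i) z (Hp i) Hz). intros j. apply Cq, Hz.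
  - intros z i j Hz. apply Cq, Hz.
  - intros z i j Hz. destruct (Eq z Hz) as [X0 [X1 [X2 X3]]].
    destruct i as [|[|i]]; destruct j as [|[|j]]; unfold dv, dq; lra.
  - intros z Hz. destruct (Eq z Hz) as [X0 _]. unfold dv, dq. lra.
Qed.

(** * Summation *)

Lemma series_le_telescope (a G : nat -> R) l : is_series a l ->
  (forall n, a n <= G n - G (S n)) -> (forall n, 0 <= G n) -> l <= G 0%nat.
Proof.
  intros Ha Hb HG.
  assert (P : forall N, sum_n a N <= G 0%nat - G (S N)).
  { induction N as [|N IH].
    - rewrite sum_O. apply Hb.
    - rewrite sum_Sn. generalize (Hb (S N)). unfold plus; simpl. lra. }
  apply (is_lim_seq_le (sum_n a) (fun _ => G 0%nat) l (G 0%nat)).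
  - intros N. generalize (P N) (HG (S N)). lra.
  - exact Ha.
  - apply is_lim_seq_const.
Qed.

Lemma qnorm_triangle a b : qnorm a <= qnorm b + qnorm (qsub a b).
Proof.
  destruct a as [a0 a1 a2 a3]. destruct b as [b0 b1 b2 b3].
  unfold qnorm, qsub; cbn [q0 q1 q2 q3].
  set (d0 := a0 - b0). set (d1 := a1 - b1). set (d2 := a2 - b2). set (d3 := a3 - b3).
  replace a0 with (b0 + d0) by (unfold d0; ring). replace a1 with (b1 + d1) by (unfold d1; ring).
  replace a2 with (b2 + d2) by (unfold d2; ring). replace a3 with (b3 + d3) by (unfold d3; ring).
  clearbody d0 d1 d2 d3.
  assert (Pb : 0 <= b0 ^ 2 + b1 ^ 2 + b2 ^ 2 + b3 ^ 2) by (generalize (pow2_ge_0 b0) (pow2_ge_0 b1) (pow2_ge_0 b2) (pow2_ge_0 b3); lra).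
  assert (Pd : 0 <= d0 ^ 2 + d1 ^ 2 + d2 ^ 2 + d3 ^ 2) by (generalize (pow2_ge_0 d0) (pow2_ge_0 d1) (pow2_ge_0 d2) (pow2_ge_0 d3); lra).
  assert (Eb := pow2_sqrt _ Pb). assert (Ed := pow2_sqrt _ Pd).
  set (B := sqrt (b0 ^ 2 + b1 ^ 2 + b2 ^ 2 + b3 ^ 2)) in *. set (D := sqrt (d0 ^ 2 + d1 ^ 2 + d2 ^ 2 + d3 ^ 2)) in *.
  assert (B0 : 0 <= B) by apply sqrt_pos. assert (D0 : 0 <= D) by apply sqrt_pos.
  assert (CS : b0 * d0 + b1 * d1 + b2 * d2 + b3 * d3 <= B * D).
  { apply Rle_trans with (1 := Rle_abs _). rewrite <- (Rabs_right (B * D)) by (apply Rle_ge, Rmult_le_pos; assumption).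
    apply Rsqr_le_abs_0. unfold Rsqr.
    replace (B * D * (B * D)) with (B ^ 2 * D ^ 2) by ring. rewrite Eb, Ed.
    generalize (pow2_ge_0 (b0 * d1 - b1 * d0)) (pow2_ge_0 (b0 * d2 - b2 * d0)) (pow2_ge_0 (b0 * d3 - b3 * d0))
      (pow2_ge_0 (b1 * d2 - b2 * d1)) (pow2_ge_0 (b1 * d3 - b3 * d1)) (pow2_ge_0 (b2 * d3 - b3 * d2)). intros. nra. }
  rewrite <- (sqrt_pow2 (B + D)) by lra. apply sqrt_le_1_alt. nra.
Qed.

(** For the final passage from s < Rr to Rr. *)
Lemma le_left_limit (h : R -> R) (K a b : R) : a < b -> continuous h b ->
  (forall t, a < t < b -> K <= h t) -> K <= h b.
Proof.
  intros Hab Hc H. apply Rnot_lt_le. intros L.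
  destruct (locally_lt_continuous h (fun _ => K) b Hc (continuous_const _ _) L) as [d Hd].
  assert (Dp := cond_pos d).
  set (t := Rmax ((a + b) / 2) (b - d / 2)).
  assert (T1 := Rmax_l ((a + b) / 2) (b - d / 2)). assert (T2 := Rmax_r ((a + b) / 2) (b - d / 2)). fold t in T1, T2.
  assert (T3 : t < b) by (unfold t; apply Rmax_lub_lt; lra).
  specialize (H t ltac:(lra)).
  assert (Q : h t < K). { apply (Hd t). change (Rabs (t - b) < d). rewrite Rabs_left; lra. }
  lra.
Qed.

Definition majorant (S1 S2 q : R) : R :=
  2 * q * (6 - 3 * q + q ^ 2) / (1 - q) ^ 3 * S1 + 4 * q / (1 - q) * S2.

(* sum over n >= 1 of (2n+1)(2n+2) q^n and of q^n, as telescoping sums *)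
Lemma series_le_majorant (a : nat -> R) l S1 S2 q : 0 <= q < 1 -> 0 <= S1 -> 0 <= S2 ->
  is_series a l ->
  (forall n, a n <= ((2 * INR (S n) + 1) * (2 * INR (S n) + 2) * S1 + 4 * S2) * q ^ S n) ->
  l <= majorant S1 S2 q.
Proof.
  intros Hq H1 H2 Ha Hb.
  (* Comparing powers of m in A m^2 + B m + C - q (A (m+1)^2 + B (m+1) + C) = (2m+1)(2m+2)
     determines A, B and C; [G n] is then the exact tail of the majorizing series. *)
  set (A := 4 / (1 - q)). set (B := (6 + 2 * q * A) / (1 - q)). set (C := (2 + q * (A + B)) / (1 - q)).
  assert (A0 : 0 <= A) by (apply Rlt_le, Rdiv_lt_0_compat; lra).
  assert (B0 : 0 <= B) by (apply Rlt_le, Rdiv_lt_0_compat; nra).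
  assert (C0 : 0 <= C) by (apply Rlt_le, Rdiv_lt_0_compat; nra).
  set (G := fun n => q ^ S n * ((A * INR (S n) ^ 2 + B * INR (S n) + C) * S1 + 4 / (1 - q) * S2)).
  replace (majorant S1 S2 q) with (G 0%nat).
  2:{ unfold G, majorant, A, B, C. simpl INR. unfold A. unfold B. unfold A. field. lra. }
  apply (series_le_telescope a G l Ha).
  - intros n. eapply Rle_trans; [apply Hb|]. right. unfold G.
    rewrite (S_INR (S n)). rewrite <- (tech_pow_Rmult q (S n)).
    set (m := INR (S n)). unfold C, B, A. field. lra.
  - intros n. unfold G. assert (P := pos_INR (S n)). assert (P2 := pow2_ge_0 (INR (S n))).
    apply Rmult_le_pos; [apply pow_le; lra|].
    apply Rplus_le_le_0_compat; apply Rmult_le_pos; try assumption.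
    + apply Rplus_le_le_0_compat; [apply Rplus_le_le_0_compat|]; try assumption; apply Rmult_le_pos; assumption.
Qed.

(** * The estimate inside a sphere of radius s < R *)

Section Estimate.
Variables (Rr : R) (f : pt -> quat) (dv : nat -> nat -> pt -> R) (S1 S2 : R).
Hypothesis HR : 0 < Rr.
Hypothesis Hr : riesz Rr (vf f) dv.
Hypothesis HS1 : forall xi, in_ball Rr xi -> Rabs (qSc (f xi)) <= S1.
Hypothesis HS2 : forall xi, in_ball Rr xi -> Rabs (qSc (qmul (hpart f Rr xi) e1)) <= S2.

Let in_ball_0 : in_ball Rr (0, 0, 0).
Proof. apply in_ball_sq; [exact HR|]. replace (0 ^ 2 + 0 ^ 2 + 0 ^ 2) with 0 by ring. apply pow_lt, HR. Qed.

Let S1_pos : 0 <= S1.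
Proof. eapply Rle_trans; [apply Rabs_pos|apply (HS1 _ in_ball_0)]. Qed.
Let S2_pos : 0 <= S2.
Proof. eapply Rle_trans; [apply Rabs_pos|apply (HS2 _ in_ball_0)]. Qed.

Section Direction.
Variables (s r : R) (e : nat -> R).
Hypothesis Hs : 0 < s < Rr.
Hypothesis Hrs : 0 <= r < s.
Hypothesis He : dot e e = 1.

Let q := r / s.
Let x : pt := (r * e 0%nat, r * e 1%nat, r * e 2%nat).

Let term k n := (2 * INR n + 1) * q ^ n * (moment (vf f) k s e n / (4 * PI)).

Lemma increment_series k : (k <= 2)%nat -> is_series (fun n => term k (S n)) (vf f k x - vf f k (0, 0, 0)).
Proof.
  intros Hk.
  assert (L := v_series Rr (vf f) dv Hr k s e r Hk Hs He ltac:(rewrite Rabs_right; lra)).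
  assert (L0 := v_series Rr (vf f) dv Hr k s e 0 Hk Hs He ltac:(rewrite Rabs_R0; lra)).
  rewrite !Rmult_0_l in L0.
  assert (E0 : vf f k (0, 0, 0) = term k 0).
  (* At [lam = 0] only the term of degree 0 survives, as 0^0 = 1. *)
  { apply is_series_unique in L0. rewrite <- L0. apply is_series_unique.
    change (is_lim_seq (sum_n (fun n => (2 * INR n + 1) * (0 / s) ^ n * (moment (vf f) k s e n / (4 * PI)))) (term k 0)).
    apply (is_lim_seq_ext (fun _ => term k 0)); [|apply is_lim_seq_const].
    intros N. rewrite (sum_n_single _ 0 N); [unfold term; simpl; ring|lia|].
    intros n Hn. unfold Rdiv at 1. rewrite Rmult_0_l, pow_i by lia. ring. }
  apply (is_series_incr_1 (V := R_NormedModule) (term k)).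
  match goal with |- is_series _ ?X => replace X with (vf f k x); [exact L|] end.
  rewrite E0. change (vf f k x = vf f k x - term k 0 + term k 0). ring.
Qed.

Lemma term0_bound n : Rabs (term 0 n) <= (2 * INR n + 1) * q ^ n * S1.
Proof.
  assert (P := pos_INR n). assert (Pi := PI_RGT_0).
  assert (Q0 : 0 <= q) by (apply Rmult_le_pos; [lra|apply Rlt_le, Rinv_0_lt_compat; lra]).
  unfold term. rewrite Rabs_mult, (Rabs_right (_ * _)).
  2:{ apply Rle_ge, Rmult_le_pos; [lra|apply pow_le, Q0]. }
  apply Rmult_le_compat_l; [apply Rmult_le_pos; [lra|apply pow_le, Q0]|].
  unfold Rdiv. rewrite Rabs_mult, Rabs_inv, (Rabs_right (4 * PI)) by lra.
  apply (Rmult_le_reg_r (4 * PI)); [lra|]. rewrite Rmult_assoc, Rinv_l, Rmult_1_r, (Rmult_comm S1) by lra.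
  apply SI_abs_le.
  - apply cont2_mult; [apply (v_cont2 Rr (vf f) dv Hr s 0 Hs)|apply leg_cont2].
  - intros a b. rewrite Rabs_mult, <- (Rmult_1_r S1). apply Rmult_le_compat; try apply Rabs_pos.
    + apply (HS1 (sphpt s a b)), sphere_in_ball, Hs.
    + apply leg_bound, sdot_unit, He.
Qed.

(** At th = 0 the phase is al M_1 - be M_2. Its distance from the mean gives (2n+1)^2 S1, and the
    mean itself is a combination of Re c_n and Im c_n with coefficients of modulus at most 1. *)
Lemma term12_bound al be n : (1 <= n)%nat -> al ^ 2 + be ^ 2 = 1 ->
  al * term 1 n - be * term 2 n <= ((2 * INR n + 1) ^ 2 * S1 + 4 * S2) * q ^ n.
Proof.
  intros Hn Hab. assert (P := pos_INR n). assert (Pi := PI_RGT_0).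
  assert (Q0 : 0 <= q) by (apply Rmult_le_pos; [lra|apply Rlt_le, Rinv_0_lt_compat; lra]).
  assert (Qn := pow_le q n Q0).
  assert (MD := mean_deviation (phase (vf f) s n e al be) (dphase (vf f) s n e al be) (4 * PI * (S1 * (INR n + / 2)))
    (fun t => phase_derive Rr (vf f) dv Hr s Hs n e He al be t)
    (fun t => dphase_bound Rr (vf f) dv Hr s Hs n e He al be Hab S1 HS1 t)).
  rewrite (mean_phase Rr (vf f) dv Hr n s Hs e al be He) in MD.
  assert (E0 : phase (vf f) s n e al be 0 = al * moment (vf f) 1 s e n - be * moment (vf f) 2 s e n).
  { assert (M0 : forall k, Mth (vf f) s n e k 0 = moment (vf f) k s e n).
    { intros k. unfold Mth, moment. apply SI_ext. intros t1 t2. unfold sdot. rewrite !erot_0 by lia. reflexivity. }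
    unfold phase. rewrite !M0, Rmult_0_r, cos_0, sin_0. ring. }
  rewrite E0 in MD.
  destruct (mre_eq Rr f dv HR Hr n s Hs) as [E1 E2].
  assert (Fr : (2 * INR n + 1) / (4 * PI) * (kap n * mre (vf f) n s) = cre Rr f n * s ^ n).
  { rewrite E1. unfold cre, Rdiv. ring. }
  assert (Fi : (2 * INR n + 1) / (4 * PI) * (kap n * mim (vf f) n s) = cim Rr f n * s ^ n).
  { rewrite E2. unfold cim, Rdiv. ring. }
  destruct (hcoef_bound Rr f dv HR Hr S2 HS2 s n Hs Hn) as [B1 B2].
  set (zr := zre n (e 1%nat) (e 2%nat)) in *. set (zi := zim n (e 1%nat) (e 2%nat)) in *.
  assert (Zn : zr ^ 2 + zi ^ 2 <= 1).
  { unfold zr, zi. rewrite zpow_norm, <- (pow1 n). apply pow_incr. unfold dot in He.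
    generalize (pow2_ge_0 (e 0%nat)) (pow2_ge_0 (e 1%nat)) (pow2_ge_0 (e 2%nat)). simpl. lra. }
  assert (U : forall u w, u ^ 2 + w ^ 2 = 1 -> Rabs (u * zr + w * zi) <= 1).
  { intros u w Huw. rewrite <- (Rabs_R1). apply Rsqr_le_abs_0. unfold Rsqr.
    assert (I : (u * zr + w * zi) * (u * zr + w * zi) = (u ^ 2 + w ^ 2) * (zr ^ 2 + zi ^ 2) - (u * zi - w * zr) ^ 2) by ring.
    rewrite I, Huw. generalize (pow2_ge_0 (u * zi - w * zr)). lra. }
  assert (Sp : 0 < s ^ n) by (apply pow_lt; lra).
  set (X := cre Rr f n * s ^ n) in *. set (Y := cim Rr f n * s ^ n) in *.
  assert (BX : Rabs X <= 2 * S2) by (unfold X; rewrite Rabs_mult, (Rabs_right (s ^ n)) by lra; exact B1).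
  assert (BY : Rabs Y <= 2 * S2) by (unfold Y; rewrite Rabs_mult, (Rabs_right (s ^ n)) by lra; exact B2).
  (* Real and imaginary part of c_n s^n cost 2 S2 each. *)
  assert (W : X * (al * zr + be * zi) + Y * (be * zr + (- al) * zi) <= 4 * S2).
  { assert (U1 := U al be Hab). assert (U2 := U be (- al) ltac:(lra)).
    assert (W1 : X * (al * zr + be * zi) <= 2 * S2 * 1).
    { eapply Rle_trans; [apply Rle_abs|]. rewrite Rabs_mult. apply Rmult_le_compat; try apply Rabs_pos; assumption. }
    assert (W2 : Y * (be * zr + (- al) * zi) <= 2 * S2 * 1).
    { eapply Rle_trans; [apply Rle_abs|]. rewrite Rabs_mult. apply Rmult_le_compat; try apply Rabs_pos; assumption. }
    lra. }
  replace (al * term 1 n - be * term 2 n) with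
    (((2 * INR n + 1) / (4 * PI) * (al * moment (vf f) 1 s e n - be * moment (vf f) 2 s e n)) * q ^ n)
    by (unfold term; field; lra).
  apply Rmult_le_compat_r; [exact Qn|].
  set (mm := al * moment (vf f) 1 s e n - be * moment (vf f) 2 s e n) in *.
  set (mean := kap n * (al * (zr * mre (vf f) n s - zi * mim (vf f) n s) + be * (zr * mim (vf f) n s + zi * mre (vf f) n s))) in *.
  assert (c0 : 0 < (2 * INR n + 1) / (4 * PI)) by (apply Rdiv_lt_0_compat; lra).
  assert (Em : (2 * INR n + 1) / (4 * PI) * mean = X * (al * zr + be * zi) + Y * (be * zr + (- al) * zi)).
  { rewrite <- Fr, <- Fi. unfold mean. ring. }
  assert (I1 : (2 * INR n + 1) / (4 * PI) * mm <= (2 * INR n + 1) / (4 * PI) * (mean + 2 * (4 * PI * (S1 * (INR n + / 2))))).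
  { apply Rmult_le_compat_l; lra. }
  rewrite Rmult_plus_distr_l, Em in I1.
  replace ((2 * INR n + 1) / (4 * PI) * (2 * (4 * PI * (S1 * (INR n + / 2))))) with ((2 * INR n + 1) ^ 2 * S1) in I1 by (field; lra).
  lra.
Qed.

(** The two bounds add up through (2n+1) + (2n+1)^2 = (2n+1)(2n+2). *)
Lemma increment_bound al be sg : al ^ 2 + be ^ 2 = 1 -> Rabs sg = 1 ->
  sg * (vf f 0 x - vf f 0 (0, 0, 0)) +
  (al * (vf f 1 x - vf f 1 (0, 0, 0)) - be * (vf f 2 x - vf f 2 (0, 0, 0))) <= majorant S1 S2 q.
Proof.
  intros Hab Hsg.
  assert (Q : 0 <= q < 1).
  { split; [apply Rmult_le_pos; [lra|apply Rlt_le, Rinv_0_lt_compat; lra]|].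
    apply (Rmult_lt_reg_r s); [lra|]. unfold q, Rdiv. rewrite Rmult_assoc, Rinv_l by lra. lra. }
  apply (series_le_majorant (fun n => sg * term 0 (S n) + (al * term 1 (S n) - be * term 2 (S n)))); try assumption.
  - apply (is_series_plus (V := R_NormedModule) (fun n => sg * term 0 (S n)) (fun n => al * term 1 (S n) - be * term 2 (S n))).
    + apply is_series_scalR, increment_series. lia.
    + apply (is_series_minus (V := R_NormedModule) (fun n => al * term 1 (S n)) (fun n => be * term 2 (S n)));
        apply is_series_scalR, increment_series; lia.
  - intros n. generalize (term0_bound (S n)) (term12_bound al be (S n) ltac:(lia) Hab). intros T0 T1.
    assert (T2 : sg * term 0 (S n) <= Rabs (term 0 (S n))).
    { eapply Rle_trans; [apply Rle_abs|]. rewrite Rabs_mult, Hsg. lra. }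
    nra.
Qed.
End Direction.

Lemma pointwise_bound s x : 0 < norm3 x -> norm3 x < s < Rr ->
  q3 (f x) = 0 -> q3 (f (0, 0, 0)) = 0 ->
  qnorm (f x) <= qnorm (f (0, 0, 0)) + majorant S1 S2 (norm3 x / s).
Proof.
  intros Hx Hs Z1 Z0. set (r := norm3 x) in *.
  pose (e := fun i => co i x / r).
  assert (Nx : r ^ 2 = co 0 x ^ 2 + co 1 x ^ 2 + co 2 x ^ 2).
  { unfold r. destruct x as [[a b] c]. unfold norm3. cbn [co fst snd]. apply pow2_sqrt.
    generalize (pow2_ge_0 a) (pow2_ge_0 b) (pow2_ge_0 c); lra. }
  assert (He : dot e e = 1).
  { unfold dot, e. transitivity ((co 0 x ^ 2 + co 1 x ^ 2 + co 2 x ^ 2) / r ^ 2); [field; lra|].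
    rewrite <- Nx. field. lra. }
  assert (Ex : (r * e 0%nat, r * e 1%nat, r * e 2%nat) = x).
  { unfold e. destruct x as [[a b] c]. cbn [co fst snd]. f_equal; [f_equal|]; field; lra. }
  eapply Rle_trans; [apply (qnorm_triangle _ (f (0, 0, 0)))|]. apply Rplus_le_compat_l.
  set (D0 := vf f 0 x - vf f 0 (0, 0, 0)). set (D1 := vf f 1 x - vf f 1 (0, 0, 0)). set (D2 := vf f 2 x - vf f 2 (0, 0, 0)).
  assert (IB : forall al be sg, al ^ 2 + be ^ 2 = 1 -> Rabs sg = 1 -> sg * D0 + (al * D1 - be * D2) <= majorant S1 S2 (r / s)).
  { intros al be sg Hab Hsg.
    generalize (increment_bound s r e ltac:(lra) ltac:(lra) He al be sg Hab Hsg). rewrite Ex. exact (fun h => h). }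
  assert (N : exists sg, Rabs sg = 1 /\ sg * D0 = Rabs D0).
  { unfold Rabs at 2. destruct (Rcase_abs D0).
    - exists (-1). split; [rewrite Rabs_left; lra|ring].
    - exists 1. split; [apply Rabs_R1|ring]. }
  destruct N as [sg [Hsg Esg]].
  set (n := sqrt (D1 ^ 2 + D2 ^ 2)).
  assert (Pn : 0 <= D1 ^ 2 + D2 ^ 2) by (generalize (pow2_ge_0 D1) (pow2_ge_0 D2); lra).
  assert (N2 : n ^ 2 = D1 ^ 2 + D2 ^ 2) by (apply pow2_sqrt, Pn).
  assert (n0 : 0 <= n) by apply sqrt_pos.
  (* The unit vector along (D1, -D2), or any unit vector when both vanish. *)
  assert (Dir : exists al be, al ^ 2 + be ^ 2 = 1 /\ n <= al * D1 - be * D2).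
  { destruct (Req_dec n 0) as [E|E].
    - exists 1, 0. split; [ring|]. rewrite E in *. generalize (pow2_ge_0 D1) (pow2_ge_0 D2). intros. assert (D1 = 0) by nra. lra.
    - exists (D1 / n), (- D2 / n). split.
      + transitivity ((D1 ^ 2 + D2 ^ 2) / n ^ 2); [field; exact E|]. rewrite <- N2. field. exact E.
      + right. transitivity (n ^ 2 / n); [field; exact E|]. rewrite N2. field. exact E. }
  destruct Dir as [al [be [Hab Hn]]].
  apply Rle_trans with (Rabs D0 + n); [|generalize (IB al be sg Hab Hsg); lra].
  unfold qnorm, qsub; cbn [q0 q1 q2 q3]. rewrite Z1, Z0.
  rewrite <- (sqrt_pow2 (Rabs D0 + n)) by (generalize (Rabs_pos D0); lra).
  apply sqrt_le_1_alt.
  apply Rle_trans with (D0 ^ 2 + n ^ 2).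
  - rewrite N2. unfold D0, D1, D2, vf. right. ring.
  - rewrite <- (pow2_abs D0). generalize (Rabs_pos D0). nra.
Qed.
End Estimate.

(** The first coefficients compare by 4/5 (3R - r)(3R^2 - Rr + r^2) >= (6R^2 - 3Rr + r^2)(R - r),
    the second by 2(R - r) <= 2(2R - r). *)
Lemma majorant_le S1 S2 r Rr : 0 <= r < Rr -> 0 <= S1 -> 0 <= S2 ->
  majorant S1 S2 (r / Rr) <= 2 * r / (Rr - r) ^ 2 * (coefA1 r Rr * S1 + coefA2 r Rr * S2).
Proof.
  intros Hr H1 H2. unfold majorant, coefA1, coefA2.
  assert (P4 : 0 < (Rr - r) ^ 4) by (apply pow_lt; lra).
  assert (P2 : 0 < (Rr - r) ^ 2) by (apply pow_lt; lra).
  (* A rational lower bound, as 16/25 < 2/3, makes the comparison polynomial. *)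
  assert (W : 4 / 5 <= sqrt (2 / 3)).
  { rewrite <- (sqrt_pow2 (4 / 5)) by lra. apply sqrt_le_1_alt. lra. }
  set (w := sqrt (2 / 3)) in *.
  apply Rle_trans with (2 * r / (Rr - r) ^ 4 * ((6 * Rr ^ 2 - 3 * Rr * r + r ^ 2) * (Rr - r)) * S1 + 2 * r / (Rr - r) ^ 2 * (2 * (Rr - r)) * S2).
  - right. field. lra.
  - replace (2 * r / (Rr - r) ^ 2 * (w * ((3 * Rr - r) * (3 * Rr ^ 2 - Rr * r + r ^ 2)) / (Rr - r) ^ 2 * S1 + 2 * (2 * Rr - r) * S2)) with
     (2 * r / (Rr - r) ^ 4 * (w * ((3 * Rr - r) * (3 * Rr ^ 2 - Rr * r + r ^ 2))) * S1 + 2 * r / (Rr - r) ^ 2 * (2 * (2 * Rr - r)) * S2) by (field; lra).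
    apply Rplus_le_compat; apply Rmult_le_compat_r; try assumption; apply Rmult_le_compat_l.
    + apply Rmult_le_pos; [lra|]. apply Rlt_le, Rinv_0_lt_compat, P4.
    + apply Rle_trans with (4 / 5 * ((3 * Rr - r) * (3 * Rr ^ 2 - Rr * r + r ^ 2))).
      * assert (0 <= r ^ 2 * (Rr - r)) by (apply Rmult_le_pos; [apply pow2_ge_0|lra]).
        assert (0 <= r * Rr * (Rr - r)) by (apply Rmult_le_pos; [apply Rmult_le_pos; lra|lra]).
        assert (0 <= Rr ^ 2 * (Rr - r)) by (apply Rmult_le_pos; [apply pow2_ge_0|lra]).
        assert (0 <= r ^ 3) by (apply pow_le; lra).
        nra.
      * apply Rmult_le_compat_r; [|exact W]. apply Rmult_le_pos; [lra|]. nra.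
    + apply Rmult_le_pos; [lra|]. apply Rlt_le, Rinv_0_lt_compat, P2.
    + lra.
Qed.

Theorem theorem2 (Rr : R) (f : pt -> quat) :
  0 < Rr ->
  monogenic f Rr ->
  L2_ball f Rr ->
  forall r : R, 0 <= r < Rr ->
  forall S1 S2 : R,
    (forall xi, in_ball Rr xi -> Rabs (qSc (f xi)) <= S1) ->
    (forall xi, in_ball Rr xi -> Rabs (qSc (qmul (hpart f Rr xi) e1)) <= S2) ->
  forall x : pt, norm3 x = r ->
    qnorm (f x) <= qnorm (f (0, 0, 0))
      + 2 * r / (Rr - r) ^ 2 * (coefA1 r Rr * S1 + coefA2 r Rr * S2).
Proof.
  intros HR Hm _ r Hr S1 S2 H1 H2 x Hx.
  destruct (monogenic_riesz f Rr Hm) as [dv Hv]. destruct Hm as [H3 _].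
  assert (B0 : in_ball Rr (0, 0, 0)).
  { apply in_ball_sq; [exact HR|]. replace (0 ^ 2 + 0 ^ 2 + 0 ^ 2) with 0 by ring. apply pow_lt, HR. }
  assert (S10 : 0 <= S1) by (eapply Rle_trans; [apply Rabs_pos|apply (H1 _ B0)]).
  assert (S20 : 0 <= S2) by (eapply Rle_trans; [apply Rabs_pos|apply (H2 _ B0)]).
  eapply Rle_trans; [|apply Rplus_le_compat_l, (majorant_le S1 S2 r Rr Hr S10 S20)].
  (* The origin has no direction x/|x| and is treated apart. *)
  destruct (Req_dec r 0) as [Z|Z].
  - assert (Ex : x = (0, 0, 0)).
    { destruct x as [[a b] c]. rewrite Z in Hx. unfold norm3 in Hx.
      apply sqrt_eq_0 in Hx; [|generalize (pow2_ge_0 a) (pow2_ge_0 b) (pow2_ge_0 c); lra].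
      generalize (pow2_ge_0 a) (pow2_ge_0 b) (pow2_ge_0 c). intros.
      f_equal; [f_equal|]; nra. }
    rewrite Ex, Z. unfold majorant. right. field. lra.
  (* The point is fixed while the sphere of radius s grows towards the boundary. *)
  - apply (le_left_limit (fun s => qnorm (f (0, 0, 0)) + majorant S1 S2 (r / s)) _ r Rr); [lra| |].
    + unfold majorant.
      assert (D : 1 - r / Rr <> 0).
      { intros E. apply (Rmult_eq_compat_r Rr) in E. field_simplify in E; lra. }
      cont; try (apply pow_nonzero); try exact D; lra.
    + intros s Hs. rewrite <- Hx in *.
      apply (pointwise_bound Rr f dv S1 S2 HR Hv H1 H2 s x); [lra|lra| |].
      * apply H3. unfold in_ball. lra.
      * apply H3, B0.
Qed.
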